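(* Let $f(s)=\int_0^\infty(1-e^{-sx})\,\overline{\nu}(\mathrm{d}x)$ be a Bernstein function whose Lévy measure satisfies $\overline{\nu}(0,\infty)=\infty$ and whose tail $\nu(x)=\overline{\nu}(x,\infty)$ is absolutely continuous. Let $\{Y_f(t)\}_{t\ge0}$ be the associated inverse subordinator, with density $h_f(t,\cdot)$, and let $\{\mathcal{M}(t)\}_{t\ge0}$ be a non-homogeneous generalized counting process with intensity functions $\lambda_1(\cdot),\dots,\lambda_k(\cdot)$, independent of $\{Y_f(t)\}_{t\ge0}$. Then the pmf $q_n^f(t)=\Pr\{\mathcal{M}(Y_f(t))=n\}$ of the process $\mathcal{M}_f(t)=\mathcal{M}(Y_f(t))$ satisfies $${}^f\mathcal{D}_t\,q_n^f(t)=\int_{0}^{\infty}\bigg(-\sum_{j=1}^{k}\lambda_{j}(u)q_n(u)+\sum_{j=1}^{n\wedge k}\lambda_{j}(u)q_{n-j}(u)\bigg)h_{f}(t,u)\,\mathrm{d}u,\quad n\ge0,$$ with initial condition $q^{f}_{n}(0)=\delta_{n,0}$, where $q_n(u)=\Pr\{\mathcal{M}(u)=n\}$ and ${}^f\mathcal{D}_t$ is the generalized Caputo derivative with respect to $f$.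
   Context: Here $\overline\nu$ is a non-negative measure on $(0,\infty)$ with $\int_0^\infty(x\wedge1)\,\overline\nu(\mathrm{d}x)<\infty$; $\{D_f(t)\}_{t\ge0}$ is the subordinator with $\mathbb{E}(e^{-sD_f(t)})=e^{-tf(s)}$ and $Y_f(t)=\inf\{x\ge0:D_f(x)>t\}$. Under the stated conditions on $\overline\nu$, the density $h_f(t,x)$ of $Y_f(t)$ exists and $\int_0^\infty e^{-st}h_f(t,x)\,\mathrm{d}t=\frac{f(s)}{s}e^{-xf(s)}$. Generalized Caputo derivative (zero drift and zero killing): for absolutely continuous $u(\cdot)$, ${}^f\mathcal{D}_tu(t)=\int_0^t\frac{\partial}{\partial t}u(t-x)\,\nu(x)\,\mathrm{d}x$. Non-homogeneous generalized counting process (NGCP): given deterministic intensity functions $\lambda_j:[0,\infty)\to[0,\infty)$, $1\le j\le k$, with $\Lambda_j(t)=\int_0^t\lambda_j(u)\,\mathrm{d}u<\infty$ for all $t$, it is the counting process $\{\mathcal{M}(t)\}_{t\ge0}$ with $\mathcal{M}(0)=0$, independent increments, and $\Pr\{\mathcal{M}(t+h)=n\mid\mathcal{M}(t)=m\}$ equal to $1-\sum_{j=1}^k\lambda_j(t)h+o(h)$ if $n=m$, $\lambda_j(t)h+o(h)$ if $n=m+j$, $1\le j\le k$, and $o(h)$ if $n>m+k$. Its pmf is $$q_n(t)=\sum_{\Omega(k,n)}\prod_{j=1}^{k}\frac{(\Lambda_j(t))^{x_j}}{x_j!}e^{-\sum_{j=1}^k\Lambda_j(t)},$$ where $\Omega(k,n)=\{(x_1,\dots,x_k):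 x_j\in\{0,1,2,\dots\},\ \sum_{j=1}^k jx_j=n\}$. Also $n\wedge k=\min\{n,k\}$ and $\delta_{n,0}$ is the Kronecker delta.
   Formalization: The equation is asserted at every t>0 where the right-hand integral converges absolutely, which is shown to hold for almost every t>0; for unbounded intensities it may be undefined at exceptional t. Continuity in probability of M, implied by its stated pmf, is made explicit. *)

(* Defs.v *)
From HB Require Import structures.
From mathcomp Require Import all_boot all_order all_algebra.
From mathcomp Require Import all_classical all_reals all_analysis.

Set Implicit Arguments.
Unset Strict Implicit.
Unset Printing Implicit Defensive.

Import Order.TTheory GRing.Theory Num.Theory.
Import numFieldNormedType.Exports.

Local Open Scope classical_set_scope.
Local Open Scope ring_scope.

(* Processes are indexed by all of R, but only the times t >= 0 matter: every
   condition below is restricted to nonnegative times. *)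

Definition abs_continuous_on (R : realType) (a b : R) (u : R -> R) : Prop :=
  forall e : R, 0 < e -> exists2 d : R, 0 < d &
    forall (n : nat) (x y : 'I_n -> R),
      (forall i, a <= x i /\ x i <= y i /\ y i <= b) ->
      trivIset [set: 'I_n] (fun i => `]x i, y i[%classic) ->
      \sum_(i < n) (y i - x i) < d ->
      \sum_(i < n) `|u (y i) - u (x i)| < e.

Definition tail (R : realType)
    (nubar : {measure set (measurableTypeR R) -> \bar R}) (x : R) : R :=
  fine (nubar `]x, +oo[%classic).

(* As nubar is infinite, its tail blows up at 0: it can be absolutely
   continuous only locally on ]0, +oo[. *)
Record levy_measure (R : realType)
    (nubar : {measure set (measurableTypeR R) -> \bar R}) : Prop := {
  levy_supp : nubar `]-oo, 0]%classic = 0%E ;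
  levy_int : (\int[nubar]_(x in `]0%R, +oo[) (Num.min x 1)%:E < +oo)%E ;
  levy_infinite : nubar `]0, +oo[%classic = +oo%E ;
  levy_tail_ac : forall a b : R, 0 < a -> a < b ->
    abs_continuous_on a b (tail nubar) }.

Definition bernstein_of (R : realType)
    (nubar : {measure set (measurableTypeR R) -> \bar R}) (f : R -> R) : Prop :=
  forall s : R, 0 <= s ->
    ((f s)%:E = \int[nubar]_(x in `]0%R, +oo[) (1 - expR (- (s * x)))%:E)%E.

(* The difference of the state space V is a parameter, so that the definition
   serves both for V = R and, with truncated subtraction, for the nondecreasing
   processes with values in nat. *)
Definition independent_increments (R : realType) (d d' : measure_display)
    (T : measurableType d) (P : probability T R) (V : measurableType d')
    (diff : V -> V -> V) (X : R -> T -> V) : Prop :=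
  forall (n : nat) (t : nat -> R) (A : nat -> set V),
    0 <= t 0%N -> (forall i, (i < n)%N -> t i <= t i.+1) ->
    (forall i, measurable (A i)) ->
    P [set w | forall i, (i < n)%N -> A i (diff (X (t i.+1) w) (X (t i) w))] =
    (\prod_(i < n) P [set w | A i (diff (X (t i.+1) w) (X (t i) w))])%E.

Record subordinator (R : realType) (d : measure_display) (T : measurableType d)
    (P : probability T R) (f : R -> R) (D : R -> {RV P >-> R}) : Prop := {
  sub_start : forall w, D 0 w = 0 ;
  sub_homo : forall w s t, 0 <= s -> s <= t -> D s w <= D t w ;
  sub_rcont : forall w t, 0 <= t -> D s w @[s --> t^'+] --> D t w ;
  sub_indep : independent_increments P (fun x y : R => x - y) D ;
  sub_stationary : forall (s t : R) (A : set R), 0 <= s -> 0 <= t ->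
    measurable A -> P [set w | A (D (s + t) w - D s w)] = P [set w | A (D t w)] ;
  sub_laplace : forall s t : R, 0 <= s -> 0 <= t ->
    ('E_P[fun w => expR (- (s * D t w))] = (expR (- (t * f s)))%:E)%E }.

(* The paths of D almost surely tend to infinity, so that the set is nonempty
   almost surely; on the exceptional null set its infimum is 0 by convention. *)
Definition inverse_subordinator (R : realType) (T : Type) (D : R -> T -> R)
    (t : R) (w : T) : R := inf [set x : R | 0 <= x /\ t < D x w].

Definition is_density (R : realType) (d : measure_display)
    (T : measurableType d) (P : probability T R) (X : T -> R) (g : R -> R) :
    Prop :=
  [/\ measurable_fun (`]0, +oo[ : set R) g,
      forall x, 0 < x -> 0 <= g x &
      forall A : set (measurableTypeR R), measurable A ->
        P (X @^-1` A) =
        (\int[lebesgue_measure]_(x in A `&` `]0%R, +oo[) (g x)%:E)%E].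

Definition condP (R : realType) (d : measure_display) (T : measurableType d)
    (P : probability T R) (A B : set T) : R := fine (P (A `&` B)) / fine (P B).

Definition intensity (R : realType) (g : R -> R) : Prop :=
  [/\ measurable_fun (`[0, +oo[ : set R) g,
      forall u, 0 <= u -> 0 <= g u &
      forall t, 0 <= t ->
        (\int[lebesgue_measure]_(u in `[0%R, t]) (g u)%:E < +oo)%E].

(* The infinitesimal conditions are one-sided (h decreases to 0) and pointwise
   in t, so they do not see a jump at a fixed time: adding 1_{t >= 1} to a
   Poisson process preserves them.  Continuity in probability, which is forced
   by the pmf being a function of the continuous integrals of the intensities,
   excludes such jumps.  The conditioning event must not be negligible: if
   lam 1 = 0, say, some values m may never be taken. *)
Record ngcp (R : realType) (d : measure_display) (T : measurableType d)
    (P : probability T R) (k : nat) (lam : nat -> R -> R)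
    (M : R -> {RV P >-> nat}) : Prop := {
  ngcp_start : forall w, M 0 w = 0%N ;
  ngcp_homo : forall w s t, 0 <= s -> s <= t -> (M s w <= M t w)%N ;
  ngcp_rcont : forall w t, 0 <= t -> M s w @[s --> t^'+] --> M t w ;
  ngcp_cont : forall t, 0 <= t ->
    P [set w | M s w != M t w] @[s --> within [set s | 0 <= s] (nbhs t)]
      --> 0%E ;
  ngcp_indep : independent_increments P subn M ;
  ngcp_stay : forall (t : R) (m : nat), 0 <= t -> P [set w | M t w = m] != 0%E ->
    (fun h : R => condP P [set w | M (t + h) w = m] [set w | M t w = m]
                  - (1 - (\sum_(1 <= j < k.+1) lam j t) * h))
      =o_ (0^'+) (fun h : R => h) ;
  ngcp_jump : forall (t : R) (m j : nat), 0 <= t ->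
    P [set w | M t w = m] != 0%E -> (1 <= j <= k)%N ->
    (fun h : R => condP P [set w | M (t + h) w = (m + j)%N] [set w | M t w = m]
                  - lam j t * h)
      =o_ (0^'+) (fun h : R => h) ;
  ngcp_large : forall (t : R) (m n : nat), 0 <= t ->
    P [set w | M t w = m] != 0%E -> (m + k < n)%N ->
    (fun h : R => condP P [set w | M (t + h) w = n] [set w | M t w = m])
      =o_ (0^'+) (fun h : R => h) }.

Definition process_events (R : realType) (d d' : measure_display)
    (T : measurableType d) (V : measurableType d') (X : R -> T -> V) :
    set (set T) :=
  <<s [set E | exists t (A : set V),
         [/\ 0 <= t, measurable A & E = X t @^-1` A]] >>.

Definition independent_processes (R : realType) (d d1 d2 : measure_display)
    (T : measurableType d) (P : probability T R)
    (V1 : measurableType d1) (V2 : measurableType d2)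
    (X : R -> T -> V1) (Y : R -> T -> V2) : Prop :=
  forall E F, process_events X E -> process_events Y F ->
    P (E `&` F) = (P E * P F)%E.

Definition prob_eq (R : realType) (d : measure_display) (T : measurableType d)
    (P : probability T R) (N : T -> nat) (n : nat) : R :=
  fine (P [set w | N w = n]).

(* Meant for u absolutely continuous on [0, t], hence derivable almost
   everywhere.  The integral has values in \bar R, so that its equality with a
   real number includes its absolute convergence. *)
Definition caputo (R : realType) (nu u : R -> R) (t : R) : \bar R :=
  (\int[lebesgue_measure]_(x in `]0%R, t[)
     (derive1 (fun r => u (r - x)) t * nu x)%:E)%E.

(* The integrand of the right-hand side, without the density. *)
Definition forward_rhs (R : realType) (k : nat) (lam : nat -> R -> R)
    (q : nat -> R -> R) (n : nat) (u : R) : R :=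
  - (\sum_(1 <= j < k.+1) lam j u * q n u)
  + \sum_(1 <= j < (minn n k).+1) lam j u * q (n - j)%N u.

(* Main.v *)
Require Import Defs.
From HB Require Import structures.
From mathcomp Require Import all_boot all_order all_algebra.
From mathcomp Require Import all_classical all_reals all_analysis.
From mathcomp Require Import measurable_realfun ring lra.

(** The proof follows the state probabilities q_n of the counting process through the change
    of time. Write r_n for the right-hand side of the forward equation, X_v for the value at v
    of the subordinator, nu for the tail of its Levy measure, Y_t for the inverse.

    The counting process. Its infinitesimal description gives r_n as the right derivative of
    q_n at every time. For the nonincreasing and continuous function P(M_u <= n) a right
    derivative everywhere is enough to recover the function (right_derivative_integral), and
    by differences q_n(u) = q_n(0) + int_0^u r_n, with r_n integrable on the half-line
    (state_prob_integral, forward_integrable).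

    The inverse subordinator. At every time t > 0 it has the density v |-> E nu(t - X_v), with
    nu extended by 0 (passage_cdf). Comparing Laplace transforms in t would prove this at
    almost every t only, and the formula is claimed at every t. The passage from almost every t
    to every t rests on Steutel's identity E[X_v psi(X_v)] = v int c n(c) E psi(c + X_v) dc, n
    being the density of the Levy measure (levy_density, steutel): it turns t E nu(t - X_v),
    integrated over v, into an integral over all the levels up to t (time_cumulated_passage).
    The same identity shows that X_v has a density for v > 0 (law_densityE).

    The change of time. By independence q_n^f(t) = E q_n(Y_t) (time_changed_prob). Inserting the
    integrated forward equation, and P(Y_t >= v) = P(X_v <= t), one gets
    q_n^f(t) = q_n(0) + int_0^oo r_n(v) P(X_v <= t) dv = q_n(0) + int_0^t g, where g is the
    mixture of the densities of the X_v with the weights r_n(v) (mixture_density, mixture_cdf,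
    forward_balance). So q_n^f is absolutely continuous with derivative g almost everywhere, and
    its Caputo derivative at t is int_0^t g(y) nu(t - y) dy = int_0^oo r_n(v) E nu(t - X_v) dv
    (caputo_cdf), where E nu(t - X_v) can be replaced by the density h_f(t, v). The integrals
    are computed separately for the positive and negative parts of r_n; their finiteness at
    almost every t follows from the integrability of r_n, as the Laplace transform at 1 of
    t |-> E nu(t - X_v) is at most f(1) for every v (mixture_passage_ae). *)

Set Implicit Arguments.
Unset Strict Implicit.
Unset Printing Implicit Defensive.

Import Order.TTheory GRing.Theory Num.Theory.
Import numFieldNormedType.Exports.

Local Open Scope classical_set_scope.
Local Open Scope ring_scope.

(** * Image measures and uniqueness of the Laplace transform *)

Section density.
Local Open Scope ereal_scope.
Context d (T : measurableType d) d' (U : measurableType d') (R : realType).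
Variables (m : {measure set T -> \bar R}) (g : T -> \bar R) (Z : T -> U).
Hypotheses (mg : measurable_fun setT g) (g0 : forall x, 0 <= g x).
Hypothesis mZ : measurable_fun setT Z.

Import HBNNSimple.

(** The density may take the value +oo, where multiplication is not continuous at 0: the
    simple approximations of f vanish wherever f does, so the limit survives. *)
Let cvg_mule_nnsfun (f : U -> \bar R) (mf : measurable_fun setT f) x :
  (forall x, 0 <= f x) ->
  (nnsfun_approx measurableT mf n (Z x))%:E * g x @[n --> \oo] --> f (Z x) * g x.
Proof.
move=> f0; set h := nnsfun_approx measurableT mf.
have hf : (h n (Z x))%:E @[n --> \oo] --> f (Z x).
  by have := @cvg_nnsfun_approx _ _ _ _ measurableT _ mf (fun t _ => f0 t) (Z x) I.
have [gfin|] := boolP (g x \is a fin_num); first exact: cvgeZr.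
rewrite ge0_fin_numE// -leNgt leye_eq => /eqP ->.
have hnd := @nd_nnsfun_approx _ _ _ _ measurableT f mf.
have [fx0|fx0] := eqVneq (f (Z x)) 0.
  rewrite fx0 mul0e; apply: cvg_near_cst; apply: nearW => n.
  suff -> : h n (Z x) = 0%R by rewrite mul0e.
  have : (h n (Z x))%:E <= f (Z x).
    rewrite -(cvg_lim _ hf)//; apply: lime_ge; first by apply/cvg_ex; exists (f (Z x)).
    by exists n => // k /= nk; rewrite lee_fin; exact/lefP/hnd.
  by rewrite fx0 lee_fin => hn0; apply/eqP; rewrite eq_le hn0 fun_ge0.
have fxgt : 0 < f (Z x) by rewrite lt0e fx0 f0.
rewrite gt0_muley//; apply: cvg_near_cst.
have : \forall n \near \oo, 0 < (h n (Z x))%:E by exact: (hf _ (open_ereal_gt' fxgt)).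
by apply: filterS => n hn; rewrite gt0_muley.
Qed.

(** Change of variables for an image measure with a density, by simple approximation of f.
    Both the law of a random variable (density 1) and a measure with a density (identity map)
    are instances, which is how laws and densities are compared below. *)
Lemma integral_weighted_law (k : {measure set U -> \bar R}) (f : U -> \bar R) :
  (forall A, measurable A -> k A = \int[m]_(x in Z @^-1` A) g x) ->
  measurable_fun setT f -> (forall x, 0 <= f x) ->
  \int[k]_x f x = \int[m]_x (f (Z x) * g x).
Proof.
move=> kE mf f0; pose h := nnsfun_approx measurableT mf.
have hnd := @nd_nnsfun_approx _ _ _ _ measurableT f mf.
have mhZ n : measurable_fun setT (fun x => (h n (Z x))%:E).
  by apply/measurable_EFinP; exact: measurableT_comp.
have -> : \int[k]_x f x = lim (\int[k]_x (h n x)%:E @[n --> \oo]).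
  rewrite -monotone_convergence//.
  - apply: eq_integral => x _; apply/esym/cvg_lim => //.
    exact: (@cvg_nnsfun_approx _ _ _ _ measurableT f mf).
  - by move=> n; exact/measurable_EFinP.
  - by move=> n x _; rewrite lee_fin.
  - by move=> x _ a b ab; rewrite lee_fin; exact/lefP/hnd.
have -> : \int[m]_x (f (Z x) * g x) =
    lim (\int[m]_x ((h n (Z x))%:E * g x) @[n --> \oo]).
  rewrite -monotone_convergence//.
  - apply: eq_integral => x _; apply/esym/cvg_lim => //.
    exact: cvg_mule_nnsfun.
  - by move=> n; apply: emeasurable_funM.
  - by move=> n x _; rewrite mule_ge0// lee_fin.
  - move=> x _ a b ab; rewrite lee_wpmul2r// lee_fin.
    exact/lefP/hnd.
congr (limn _); apply/funext => n.
transitivity (\int[k]_x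
   (\sum_(y \in range (h n)) (y * \1_(h n @^-1` [set y]) x)%:E)).
  by apply: eq_integral => t tE; rewrite /= fimfunE -fsumEFin.
have indich r : measurable_fun setT (fun x => (r * \1_(h n @^-1` [set r]) x)%:E).
  by apply/measurable_EFinP; exact: measurable_funM.
have indichZ r : measurable_fun setT
    (fun x => (r * \1_(h n @^-1` [set r]) (Z x))%:E).
  exact: (measurableT_comp (indich r)).
rewrite ge0_integral_fsum//; last by move=> y x _; exact: nnfun_muleindic_ge0.
transitivity (\int[m]_x (\sum_(y \in range (h n))
    ((y * \1_(h n @^-1` [set y]) (Z x))%:E * g x))); last first.
  apply: eq_integral => x xE.
  rewrite -ge0_mule_fsuml => [|y]; last exact: nnfun_muleindic_ge0.
  by rewrite fsumEFin // -(fimfunE _ (Z x)).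
rewrite ge0_integral_fsum//; last 2 first.
  - by move=> y; apply: emeasurable_funM.
  - by move=> y x _; rewrite mule_ge0 ?g0// nnfun_muleindic_ge0.
apply: eq_fsbigr => r rhn.
have r0 : (0 <= r)%R by move: rhn; rewrite inE => -[t _ <-].
under eq_integral do rewrite EFinM.
rewrite ge0_integralZl//; last by apply/measurable_EFinP.
rewrite integral_indic// setIT kE//.
have indZ : measurable_fun setT (fun x => (\1_(h n @^-1` [set r]) (Z x))%:E : \bar R).
  by apply/measurable_EFinP; exact: measurableT_comp.
under [RHS]eq_integral do rewrite EFinM -muleA.
rewrite ge0_integralZl//; last 2 first.
  by apply: emeasurable_funM.
  by move=> x _; rewrite mule_ge0// lee_fin.
congr (_ * _); rewrite integral_mkcond; apply: eq_integral => x _.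
by rewrite epatch_indic /= muleC.
Qed.

End density.

(** The proofs are parameters so that the measure structure below can be attached to the set
    function. *)
Definition weighted_law d (T : measurableType d) d' (U : measurableType d')
    (R : realType) (m : {measure set T -> \bar R}) (g : T -> \bar R) (Z : T -> U)
    (mg : measurable_fun setT g) (g0 : forall x, (0 <= g x)%E)
    (mZ : measurable_fun setT Z) (A : set U) :=
  (\int[m]_(x in Z @^-1` A) g x)%E.

Section weighted_law_measure.
Local Open Scope ereal_scope.
Context d (T : measurableType d) d' (U : measurableType d') (R : realType).
Context (m : {measure set T -> \bar R}) (g : T -> \bar R) (Z : T -> U).
Context (mg : measurable_fun setT g) (g0 : forall x, 0 <= g x).
Context (mZ : measurable_fun setT Z).

Let k := weighted_law m mg g0 mZ.

Let k0 : k set0 = 0. Proof. by rewrite /k /weighted_law preimage_set0 integral_set0. Qed.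

Let k_ge0 A : 0 <= k A. Proof. exact: integral_ge0. Qed.

Let k_sigma_additive : semi_sigma_additive k.
Proof.
have mpre A : measurable A -> measurable (Z @^-1` A).
  by move=> mA; rewrite -[X in measurable X]setTI; exact: mZ.
move=> F mF tF mUF; rewrite /k /weighted_law preimage_bigcup.
apply: (@semi_sigma_additive_nng_induced _ _ _ m g mg g0).
- by move=> n; exact: mpre.
- apply/trivIsetP => /= i j _ _ ij; rewrite -preimage_setI.
  by move/trivIsetP : tF => /(_ _ _ _ _ ij) ->//; rewrite preimage_set0.
- by rewrite -preimage_bigcup; exact: mpre.
Qed.

HB.instance Definition _ := isMeasure.Build _ _ _ (weighted_law m mg g0 mZ)
  k0 k_ge0 k_sigma_additive.

End weighted_law_measure.

(** Upper rays are stable by intersection and generate the Borel sets; with the whole line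
    they are also exhausting. *)
Lemma eq_measure_rays (R : realType)
    (m1 m2 : {measure set (measurableTypeR R) -> \bar R}) :
  (m1 setT < +oo)%E -> m1 setT = m2 setT ->
  (forall a : R, m1 `]a, +oo[%classic = m2 `]a, +oo[%classic) ->
  forall A, measurable A -> m1 A = m2 A.
Proof.
move=> fin1 eqT eqray.
pose G : set (set (measurableTypeR R)) :=
  [set A | A = setT \/ exists a : R, A = `]a, +oo[%classic].
have mG : @measurable _ (measurableTypeR R) = <<s G >>.
  rewrite [LHS]RGenOInfty.measurableE; apply/seteqP; split.
    by apply: sub_sigma_algebra2 => A [a ->]; right; exists a.
  apply: smallest_sub; first exact: smallest_sigma_algebra.
  move=> A [->|Aa]; last exact: sub_sigma_algebra.
  by have := @measurableT _ (g_sigma_algebraType (@RGenOInfty.G R)).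
apply: (measure_unique G (fun=> setT)) => //.
- move=> A B [->|[a ->]] [->|[b ->]].
  + by rewrite setIT; left.
  + by rewrite setTI; right; exists b.
  + by rewrite setIT; right; exists a.
  + right; exists (Num.max a b); apply/seteqP; split => x /=;
      rewrite !in_itv/= !andbT gt_max.
      by move=> [-> ->].
    by move/andP.
- by move=> _; left.
- exact: bigcup_const.
- by move=> A [->|[a ->]].
Qed.

Section laplace_uniqueness.
Context (R : realType).

Let test (n K : nat) (x : R) : R := (1 - expR (- (n%:R * x))) ^+ K.

Let itest (n K : nat) (x : R) : 0 <= x -> 0 <= test n K x <= 1.
Proof.
move=> x0; have e1 : expR (- (n%:R * x)) <= 1.
  by rewrite -expR0 ler_expR oppr_le0 mulr_ge0.
by rewrite exprn_ge0 ?subr_ge0//= exprn_ile1 ?subr_ge0// lerBlDr lerDl expR_ge0.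
Qed.

(** The exponent that makes (1 - e^(- n x))^K a sharp cut-off at a: K e^(- n x)
    tends to 0 for x > a and is at least n for x <= a. *)
Let cut (a : R) (n : nat) : nat := (Num.trunc (n%:R * expR (n%:R * a))).+1.

(** Bounds the defect of the cut-off on the side where it tends to 1. *)
Let bernoulli_le (y : R) K : 0 <= y <= 1 -> 1 - K%:R * y <= (1 - y) ^+ K.
Proof.
move=> /andP[y0 y1]; elim: K => [|K IH]; first by rewrite mul0r subr0 expr0.
rewrite exprS; apply: (@le_trans _ _ ((1 - y) * (1 - K%:R * y))); last first.
  by rewrite ler_wpM2l// subr_ge0.
rewrite -natr1; have : 0 <= K%:R * y * y by rewrite !mulr_ge0.
lra.
Qed.

(** On x > a Bernoulli's inequality leaves the defect K e^(- n x), of the order of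
    n e^(- n (x - a)); on x <= a, (1 - y)^K <= e^(- K y) with K y >= n. *)
Let cvg_cutoff (a x : R) : 0 <= a -> 0 <= x ->
  test n (cut a n) x @[n --> \oo] --> (if a < x then 1 else 0 : R).
Proof.
move=> a0 x0; set K := cut a.
have K1 n : n%:R * expR (n%:R * a) <= (K n)%:R.
  by rewrite /K/cut ltW// truncnS_gt.
have K2 n : (K n)%:R <= n%:R * expR (n%:R * a) + 1.
  by rewrite /K/cut -natr1 lerD2r truncn_le// mulr_ge0 ?expR_ge0.
have cinv : (n%:R^-1 : R) @[n --> \oo] --> (0 : R).
  by rewrite -(cvg_shiftn 1); under eq_fun do rewrite addn1; exact: cvg_harmonic.
have [ax|xa] := ltP a x.
  have d0 : 0 < x - a by rewrite subr_gt0.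
  have h : \forall n \near \oo,
      1 - 4 / (x - a) ^+ 2 * n%:R^-1 <= test n (K n) x <= 1.
    exists 1%N => // n /= n1; have /andP[_ ->] := itest n (K n) x0.
    rewrite andbT; set y := expR (- (n%:R * x)).
    have n0 : 0 < n%:R :> R by rewrite ltr0n.
    have y1 : 0 <= y <= 1.
      by rewrite expR_ge0 -expR0 ler_expR oppr_le0 mulr_ge0.
    apply: le_trans (bernoulli_le _ y1); rewrite lerD2l lerN2.
    pose u := n%:R * (x - a); have u0 : 0 < u by rewrite mulr_gt0.
    have yE : y * expR (n%:R * a) = expR (- u).
      by rewrite -expRD /u; congr expR; ring.
    have ylt : y <= expR (- u).
      by rewrite ler_expR /u mulrBr; rewrite lerN2 gerBl mulr_ge0.
    have eu : expR (- u) <= 2 / u ^+ 2.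
      rewrite expRN -[leRHS]invrK lef_pV2 ?posrE ?expR_gt0//; last first.
        by rewrite invr_gt0 divr_gt0// exprn_gt0.
      rewrite invf_div (le_trans _ (expR_ge1Dxn 1 (ltW u0)))//.
      by rewrite ler_wpDl.
    apply: (@le_trans _ _ (n%:R * expR (- u) + expR (- u))).
      rewrite (le_trans (ler_wpM2r _ (K2 n)))//; first by case/andP: y1.
      by rewrite mulrDl mul1r -mulrA [expR _ * y]mulrC yE lerD2l.
    apply: (@le_trans _ _ (2 * (n%:R * (2 / u ^+ 2)))).
      have : expR (- u) <= n%:R * expR (- u).
        by rewrite ler_peMl ?expR_ge0// ler1n.
      have : n%:R * expR (- u) <= n%:R * (2 / u ^+ 2) by rewrite ler_wpM2l// ltW.
      lra.
    rewrite le_eqVlt; apply/orP; left; apply/eqP; rewrite /u.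
    by field; rewrite !gt_eqF.
  apply: (squeeze_cvgr h); last exact: cvg_cst.
  rewrite -[X in _ --> X](subr0 1) -(mulr0 (4 / (x - a) ^+ 2)).
  by apply: cvgB; [exact: cvg_cst|apply: cvgMr; exact: cinv].
have h : \forall n \near \oo, 0 <= test n (K n) x <= expR (- n%:R).
  apply: nearW => n; have /andP[-> _]/= := itest n (K n) x0.
  set y := expR (- (n%:R * x)).
  apply: (@le_trans _ _ (expR (- y) ^+ K n)).
    rewrite lerXn2r ?nnegrE ?expR_ge0//; last exact: expR_ge1Dx.
    by rewrite subr_ge0 -expR0 ler_expR oppr_le0 mulr_ge0.
  rewrite -expRM_natl ler_expR mulrN lerN2.
  apply: (le_trans _ (ler_wpM2r (expR_ge0 _) (K1 n))).
  rewrite -mulrA -expRD ler_peMr// -expR0 ler_expR.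
  by rewrite -mulrBr mulr_ge0// subr_ge0.
apply: (squeeze_cvgr h); first exact: cvg_cst.
exact: cvgn_expR.
Qed.

Let D : set R := `[0, +oo[.

(** Bounded, hence integrable for a finite measure. *)
Let test_integrable (k : {measure set (measurableTypeR R) -> \bar R}) s n K :
  (k setT < +oo)%E -> 0 <= s ->
  k.-integrable D (fun x => (expR (- (s * x)) * test n K x)%:E).
Proof.
move=> kfin s0; apply: (@measurable_bounded_integrable _ _ _ k).
- exact: measurable_itv.
- by rewrite (le_lt_trans _ kfin)// le_measure ?inE//; exact: measurable_itv.
- apply: measurable_funTS; apply: measurable_funM.
    by apply: measurableT_comp => //; apply: measurableT_comp => //; exact: measurable_funM.
  apply: measurable_funX; apply: measurable_funB => //.
    by apply: measurableT_comp => //; apply: measurableT_comp => //; exact: measurable_funM.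
- exists 1; split => // M M1 x; rewrite /D/= in_itv/= andbT => x0.
  have /andP[t0 t1] := itest n K x0.
  rewrite ger0_norm ?mulr_ge0 ?expR_ge0//.
  rewrite (le_trans _ (ltW M1))// mulr_ile1// ?expR_ge0//.
  by rewrite -expR0 ler_expR oppr_le0 mulr_ge0.
Qed.

Section finite_case.
Context (k1 k2 : {measure set (measurableTypeR R) -> \bar R}).
Hypothesis fin1 : (k1 setT < +oo)%E.
Hypothesis fin2 : (k2 setT < +oo)%E.
Hypothesis kN1 : k1 `]-oo, 0[%classic = 0%E.
Hypothesis kN2 : k2 `]-oo, 0[%classic = 0%E.
Hypothesis eqL : forall s, 0 <= s ->
  (\int[k1]_(x in D) (expR (- (s * x)))%:E = \int[k2]_(x in D) (expR (- (s * x)))%:E)%E.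

Let eq_test (n K : nat) (s : R) : 0 <= s ->
  (\int[k1]_(x in D) (expR (- (s * x)) * test n K x)%:E =
   \int[k2]_(x in D) (expR (- (s * x)) * test n K x)%:E)%E.
Proof.
elim: K s => [|K IH] s s0.
  under eq_integral do rewrite /test expr0 mulr1.
  by under [RHS]eq_integral do rewrite /test expr0 mulr1; exact: eqL.
have E x : expR (- (s * x)) * test n K.+1 x =
    expR (- (s * x)) * test n K x - expR (- ((s + n%:R) * x)) * test n K x.
  have -> : - ((s + n%:R) * x) = - (s * x) + - (n%:R * x) by ring.
  by rewrite /test exprS expRD; ring.
have sn : 0 <= s + n%:R by rewrite addr_ge0.
under eq_integral do rewrite E.
under [RHS]eq_integral do rewrite E.
rewrite !integralB_EFin ?IH//; first [exact: test_integrable | exact: measurable_itv].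
Qed.

(** The Laplace transforms at the points s + j n determine the integrals of the cut-offs, by
    expanding their powers one factor at a time; in the limit they determine the measures of
    the upper rays. *)
Lemma laplace_unique_finite (A : set (measurableTypeR R)) : measurable A -> k1 A = k2 A.
Proof.
have mD : measurable (D : set (measurableTypeR R)) by exact: measurable_itv.
have kD (k : {measure set (measurableTypeR R) -> \bar R}) B :
    k `]-oo, 0[%classic = 0%E -> measurable B -> k B = k (B `&` D).
  move=> kN mB.
  rewrite [LHS](measureDI k _ mD)// [X in (X + _)%E](_ : _ = 0%E) ?add0e//.
  apply: (subset_measure0 _ _ _ kN) => //.
  - exact: measurableD.
  - by move=> x [_]; rewrite /D/= !in_itv/= andbT => /negP; rewrite -ltNge.
have eqT : k1 D = k2 D.
  have := eqL (lexx 0); under eq_integral do rewrite mul0r oppr0 expR0.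
  under [in RHS]eq_integral do rewrite mul0r oppr0 expR0.
  by rewrite !integral_cst// !mul1e.
move: A; apply: eq_measure_rays => //; first by rewrite (kD k1)// (kD k2)// !setTI.
move=> a; have mray b : measurable (`]b, +oo[ : set (measurableTypeR R)).
  exact: measurable_itv.
have [a0|a0] := ltP a 0.
  rewrite (kD k1)// (kD k2)// (_ : _ `&` _ = D)//.
  rewrite setIidr// => x; rewrite /D/= !in_itv/= !andbT.
  exact: lt_le_trans.
have lim (k : {measure set (measurableTypeR R) -> \bar R}) : (k setT < +oo)%E ->
    (\int[k]_(x in D) (expR (- (0 * x)) * test n (cut a n) x)%:E @[n --> \oo] -->
     k (`]a, +oo[%classic `&` D))%E.
  move=> kfin; pose ind (x : R) : R := if a < x then 1 else 0.
  have indE : ind = \1_(`]a, +oo[%classic : set R).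
    apply/funext => x; rewrite /ind indicE.
    by rewrite mem_setE in_itv/= andbT; case: ifP.
  have -> : k (`]a, +oo[%classic `&` D) = (\int[k]_(x in D) (ind x)%:E)%E.
    by rewrite indE integral_indic//.
  have mind : measurable_fun D (fun x => (ind x)%:E).
    by apply/measurable_EFinP; apply: measurable_funTS; rewrite indE.
  have [] := @dominated_convergence _ _ R k D mD
    (fun n x => (expR (- (0 * x)) * test n (cut a n) x)%:E) (fun x => (ind x)%:E) (cst 1%E).
  - by move=> n; apply: measurable_int; apply: (@test_integrable k 0).
  - exact: mind.
  - apply: aeW => x; rewrite /D/= in_itv/= andbT => x0.
    apply/cvg_EFin; first exact: nearW.
    under eq_fun do rewrite /= mul0r oppr0 expR0 mul1r.
    exact: cvg_cutoff.
  - have := test_integrable 0 0 kfin (lexx 0); apply: eq_integrable => // x _.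
    by rewrite /test expr0 mul0r oppr0 expR0 mulr1.
  - apply: aeW => x n; rewrite /D/= in_itv/= andbT => x0.
    rewrite mul0r oppr0 expR0 mul1r lee_fin.
    by have /andP[t0 t1] := itest n (cut a n) x0; rewrite ger0_norm.
  - by [].
rewrite (kD k1)// (kD k2)//.
apply/esym; rewrite -(cvg_lim _ (lim k1 fin1))// -(cvg_lim _ (lim k2 fin2))//.
by congr (limn _); apply/funext => n; rewrite eq_test.
Qed.

End finite_case.

End laplace_uniqueness.

(** The two weighted laws of the maps Z1 and Z2, once damped by e^(- x), are
    finite measures on the half-line with the same Laplace transform. *)
Lemma laplace_unique d1 d2 (T1 : measurableType d1) (T2 : measurableType d2)
    (R : realType) (m1 : {measure set T1 -> \bar R})
    (m2 : {measure set T2 -> \bar R}) (a1 : T1 -> \bar R) (a2 : T2 -> \bar R)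
    (Z1 : T1 -> R) (Z2 : T2 -> R) (psi : R -> \bar R) :
  measurable_fun setT a1 -> measurable_fun setT a2 ->
  measurable_fun setT Z1 -> measurable_fun setT Z2 ->
  (forall x, (0 <= a1 x)%E) -> (forall x, (0 <= a2 x)%E) ->
  (forall x, 0 <= Z1 x) -> (forall x, 0 <= Z2 x) ->
  (forall s, 0 < s -> (\int[m1]_x ((expR (- (s * Z1 x)))%:E * a1 x) < +oo)%E) ->
  (forall s, 0 < s -> (\int[m1]_x ((expR (- (s * Z1 x)))%:E * a1 x) =
                       \int[m2]_x ((expR (- (s * Z2 x)))%:E * a2 x))%E) ->
  measurable_fun setT psi -> (forall x, (0 <= psi x)%E) ->
  (\int[m1]_x (psi (Z1 x) * a1 x) = \int[m2]_x (psi (Z2 x) * a2 x))%E.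
Proof.
move=> ma1 ma2 mZ1 mZ2 a10 a20 Z10 Z20 Lfin Leq mpsi psi0.
have mexp (s : R) : measurable_fun [set: R] (fun x => (expR (- (s * x)))%:E).
  apply/measurable_EFinP; apply: measurableT_comp => //.
  by apply: measurableT_comp => //; exact: measurable_funM.
have mb d (T : measurableType d) (a : T -> \bar R) (Z : T -> R) (s : R) :
    measurable_fun setT a -> measurable_fun setT Z ->
    measurable_fun setT (fun x => (expR (- (s * Z x)))%:E * a x)%E.
  move=> ma mZ; apply: emeasurable_funM => //.
  exact: (measurableT_comp (mexp s) mZ).
have b0 d (T : measurableType d) (a : T -> \bar R) (Z : T -> R) (s : R) :
    (forall x, 0 <= a x)%E -> (forall x, 0 <= (expR (- (s * Z x)))%:E * a x)%E.
  by move=> a0 x; rewrite mule_ge0// lee_fin expR_ge0.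
pose k d (T : measurableType d) (m : {measure set T -> \bar R}) (a : T -> \bar R)
    (Z : T -> measurableTypeR R) (ma : measurable_fun setT a)
    (mZ : measurable_fun setT Z) (a0 : forall x, (0 <= a x)%E) :
    {measure set (measurableTypeR R) -> \bar R} :=
  weighted_law m (mb d T a Z 1 ma mZ) (b0 d T a Z 1 a0) mZ.
pose k1 := k _ _ m1 a1 Z1 ma1 mZ1 a10.
pose k2 := k _ _ m2 a2 Z2 ma2 mZ2 a20.
have kint d (T : measurableType d) (m : {measure set T -> \bar R}) a Z ma mZ a0 
    (phi : R -> \bar R) : measurable_fun setT phi -> (forall x, 0 <= phi x)%E ->
    (\int[k d T m a Z ma mZ a0]_x phi x =
     \int[m]_x (phi (Z x) * ((expR (- (1 * Z x)))%:E * a x)))%E.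
  by move=> mphi phi0; apply: integral_weighted_law => //; [apply mb|apply b0].
have kN d (T : measurableType d) (m : {measure set T -> \bar R}) a Z ma mZ a0 :
    (forall x, 0 <= Z x) -> k d T m a Z ma mZ a0 `]-oo, 0[%classic = 0%E.
  move=> Z0; rewrite /k/= /weighted_law (_ : _ @^-1` _ = set0) ?integral_set0//.
  by apply/seteqP; split => // x; rewrite /= in_itv/= ltNge Z0.
have kT d (T : measurableType d) (m : {measure set T -> \bar R}) a Z ma mZ a0 :
    k d T m a Z ma mZ a0 setT = (\int[m]_x ((expR (- (1 * Z x)))%:E * a x))%E.
  by rewrite /k/= /weighted_law preimage_setT.
have kL d (T : measurableType d) (m : {measure set T -> \bar R}) a Z ma mZ a0 s :
    (forall x, 0 <= Z x) ->
    (\int[k d T m a Z ma mZ a0]_(x in `[0%R, +oo[) (expR (- (s * x)))%:E =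
     \int[m]_x ((expR (- ((s + 1) * Z x)))%:E * a x))%E.
  move=> Z0; rewrite (_ : (\int[_]_(x in _) _)%E =
      (\int[k d T m a Z ma mZ a0]_x (expR (- (s * x)))%:E)%E); last first.
    rewrite [RHS](ge0_negligible_integral _ _ _ _ (kN d T m a Z ma mZ a0 Z0))//.
      by rewrite setTD setCitvl.
    by apply mexp.
  rewrite kint//; apply: eq_integral => x _.
  by rewrite muleA -EFinM -expRD; congr ((expR _)%:E * _)%E; ring.
have kE A : measurable A -> k1 A = k2 A.
  apply: laplace_unique_finite.
  - by rewrite kT Lfin.
  - by rewrite kT -Leq// Lfin.
  - exact: kN.
  - exact: kN.
  - by move=> s s0; rewrite !kL// Leq// ltr_wpDl.
have psiE d (T : measurableType d) (m : {measure set T -> \bar R}) a Z ma mZ a0 :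
    (\int[m]_x (psi (Z x) * a x) =
     \int[k d T m a Z ma mZ a0]_x (psi x * (expR x)%:E))%E.
  rewrite kint.
  - apply: eq_integral => x _.
    by rewrite -!muleA; congr *%E; rewrite muleA -EFinM mul1r expRxMexpNx_1 mul1e.
  - by apply: emeasurable_funM => //; apply/measurable_EFinP.
  - by move=> x; rewrite mule_ge0// lee_fin expR_ge0.
rewrite (psiE _ _ m1 a1 Z1 ma1 mZ1 a10) (psiE _ _ m2 a2 Z2 ma2 mZ2 a20).
by apply: eq_measure_integral => // A mA _; exact: kE.
Qed.

(** * Absolute continuity and right derivatives *)

Section grid.
Context (R : realType).
Let mu : {measure set (measurableTypeR R) -> \bar R} := @lebesgue_measure R.

Let step (a b : R) (n : nat) : R := (b - a) / n.+1%:R.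

Definition grid_lo (a b : R) (n i : nat) : R := a + i%:R * step a b n.

(** Upper end of the i-th cell, collapsed to the lower end when the cell leaves U. *)
Definition grid_hi (U : set R) (a b : R) (n i : nat) : R :=
  if pselect (`]grid_lo a b n i, grid_lo a b n i.+1] `<=` U) is left _
  then grid_lo a b n i.+1 else grid_lo a b n i.

Context (U : set R) (a b : R) (ab : a < b).
Local Notation lo := (grid_lo a b).
Local Notation hi := (grid_hi U a b).

Let step_gt0 n : 0 < step a b n.
Proof. by rewrite divr_gt0// subr_gt0. Qed.

Let loS n i : lo n i.+1 = lo n i + step a b n.
Proof. by rewrite /grid_lo -natr1; ring. Qed.

Let lo_le n i j : (i <= j)%N -> lo n i <= lo n j.
Proof. by move=> ij; rewrite lerD2l ler_wpM2r ?ler_nat// ltW. Qed.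

Let lo0 n : lo n 0 = a. Proof. by rewrite /grid_lo mul0r addr0. Qed.

Let lo_last n : lo n n.+1 = b.
Proof. by rewrite /grid_lo /step mulrCA divff ?mulr1 1?addrC ?subrK// pnatr_eq0. Qed.

Lemma grid_le n i : (i < n.+1)%N -> a <= lo n i /\ lo n i <= hi n i /\ hi n i <= b.
Proof.
move=> ilt; split; first by rewrite -[X in X <= _](lo0 n) lo_le.
have h : lo n i <= lo n i.+1 by rewrite lo_le.
have h2 : lo n i.+1 <= b by rewrite -[X in _ <= X](lo_last n) lo_le.
by rewrite /grid_hi; case: pselect => _; split => //; exact: le_trans h h2.
Qed.

Lemma grid_hi_le n i : hi n i <= lo n i.+1.
Proof. by rewrite /grid_hi; case: pselect => _ //; exact: lo_le. Qed.

Lemma grid_width n i : hi n i - lo n i <= (b - a) / n.+1%:R.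
Proof. by rewrite lerBlDl -loS grid_hi_le. Qed.

Lemma grid_sub n i : `]lo n i, hi n i] `<=` U.
Proof.
rewrite /grid_hi; case: pselect => //= _ x /=.
by rewrite in_itv/= => /andP[] /lt_le_trans /[apply]; rewrite ltxx.
Qed.

Lemma grid_trivIset n (s : bool) :
  trivIset [set: 'I_n.+1] (fun i : 'I_n.+1 => [set` Interval (BRight (lo n i)) (BSide s (hi n i))]).
Proof.
apply/trivIsetP => /= i j _ _; wlog ij : i j / (i < j)%N => [H|_].
  rewrite neq_ltn => /orP[ij|ij]; first by apply: H => //; rewrite neq_ltn ij.
  by rewrite setIC; apply: H => //; rewrite neq_ltn ij.
apply/seteqP; split => // x /= []; rewrite !itv_boundlr => /andP[_ xhi] /andP[].
rewrite bnd_simp => xlo _.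
have := lt_le_trans xlo _; move=> /(_ x).
have xh : x <= hi n i by case: s xhi; rewrite bnd_simp => // /ltW.
have := le_lt_trans (le_trans xh (le_trans (grid_hi_le n i) (lo_le n ij))) xlo.
by rewrite ltxx.
Qed.

Definition grid_set n : set (measurableTypeR R) := \big[setU/set0]_(i < n.+1) `]lo n i, hi n i]%classic.

Lemma measurable_grid_set n : measurable (grid_set n).
Proof. by apply: bigsetU_measurable => i _; exact: measurable_itv. Qed.

Lemma measure_grid_set (k : {measure set (measurableTypeR R) -> \bar R}) n :
  (k (grid_set n) = \sum_(i < n.+1) k `]lo n i, hi n i]%classic)%E.
Proof.
apply: (@measure_semi_additive_ord _ _ _ k n.+1 (fun i : 'I_n.+1 => `]lo n i, hi n i]%classic)).
- by move=> i; exact: measurable_itv.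
- exact: (@grid_trivIset n false).
- exact: measurable_grid_set.
Qed.

Lemma grid_length n : open U -> (\sum_(i < n.+1) (hi n i - lo n i)%:E <= mu U)%E.
Proof.
move=> oU; apply: (@le_trans _ _ (mu (grid_set n))).
  rewrite measure_grid_set; apply: lee_sum => i _; rewrite [leRHS](lebesgue_measure_itv `]lo n i, hi n i])/= lte_fin.
  by have [//|h] := ltP; rewrite lee_fin subr_le0.
apply: le_measure; rewrite ?inE.
- exact: measurable_grid_set.
- exact: open_measurable.
- rewrite /grid_set -(bigcup_mkord _ (fun i => `]lo n i, hi n i]%classic)).
  by move=> x [i _]; exact: grid_sub.
Qed.

(** Once the cells are shorter than a radius of a ball around x inside U, the cell of x stays
    in U. The cells are closed on the right and x differs from a, so x is in one of them. *)
Lemma grid_exhaust x : open U -> U x -> a < x <= b -> \forall n \near \oo, grid_set n x.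
Proof.
move=> oU Ux /andP[ax xb].
have /nbhs_ballP[r r0 rU] : nbhs x U by exact: open_nbhs_nbhs.
have : \forall n \near \oo, (b - a) / n.+1%:R < r.
  near=> n; rewrite ltr_pdivrMr// mulrC -ltr_pdivrMr//.
  rewrite (lt_trans (truncnS_gt _))// ltr_nat ltnS.
  by near: n; exact: nbhs_infty_ge.
apply: filterS => n hn.
have ex : exists j, x <= lo n j by exists n.+1; rewrite lo_last.
case: (ex_minnP ex) => -[|i]; first by rewrite lo0 leNgt ax.
move=> xi imin; have ilt : (i < n.+1)%N by apply: imin; rewrite lo_last.
have lox : lo n i < x by rewrite ltNge; apply/negP => /imin; rewrite ltnn.
rewrite /grid_set -(bigcup_mkord _ (fun i => `]lo n i, hi n i]%classic)).
exists i => //.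
rewrite /grid_hi; case: pselect => [h|]; first by rewrite /= in_itv/= lox.
case; move=> y /=; rewrite in_itv/= => /andP[loy yi]; apply: rU.
rewrite /ball/= ltr_distl; move: xi yi; rewrite loS => xi yi.
rewrite -/(step a b n) in hn.
by apply/andP; split; lra.
Unshelve. all: by end_near. Qed.

(** A is the increasing union of its parts that all the grids finer than a given one cover. *)
Lemma grid_measure_le (k : {measure set (measurableTypeR R) -> \bar R}) (A : set R) e :
  open U -> measurable A -> A `<=` U `&` `]a, b] ->
  (\forall n \near \oo, k (A `&` grid_set n) <= e)%E -> (k A <= e)%E.
Proof.
move=> oU mA AU ke.
pose B N := \bigcap_(n >= N) (A `&` grid_set n).
have mB N : measurable (B N).
  apply: bigcap_measurable => [|n _]; first by exists N => /=.
  by apply: measurableI => //; exact: measurable_grid_set.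
have AE : A = \bigcup_N B N.
  apply/seteqP; split => [x Ax|x [N _ /(_ N)]]; last by move=> /(_ (leqnn N))[].
  have [Ux] := AU _ Ax; rewrite /= in_itv/= => xab.
  by have [N _ hN] := grid_exhaust oU Ux xab; exists N => // n /= Nn; split => //; exact: hN.
rewrite AE.
have cv : k (B N) @[N --> \oo] --> k (\bigcup_N B N).
  apply: nondecreasing_cvg_mu => //; first exact: bigcupT_measurable.
  by apply/nondecreasing_seqP => N; apply/subsetPset => x h n /= Nn; apply: h => /=; exact: ltnW.
rewrite -(cvg_lim _ cv)//; apply: lime_le; first by apply/cvg_ex; exists (k (\bigcup_N B N)).
apply: filterS ke => N; apply: le_trans.
apply: le_measure; rewrite ?inE; last by move=> x /(_ N (leqnn N)).
  exact: mB.
by apply: (@measurableI _ (measurableTypeR R)) => //; exact: measurable_grid_set.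
Qed.

End grid.

Lemma null_open_cover (R : realType) (A : set (measurableTypeR R)) (d : R) :
  measurable A -> lebesgue_measure A = 0%E -> 0 < d ->
  exists U : set R, [/\ open U, A `<=` U & (lebesgue_measure U < d%:E)%E].
Proof.
move=> mA A0 d0; have Afin : (lebesgue_measure A < +oo)%E by rewrite A0.
have [U [oU AU Ud]] := lebesgue_regularity_outer mA Afin d0.
have mU : measurable (U : set (measurableTypeR R)) by exact: open_measurable.
exists U; split => //; apply: le_lt_trans Ud; rewrite (measureDI lebesgue_measure mU mA).
rewrite [X in (_ + X)%E](_ : _ = 0%E) ?adde0//.
by apply: (subset_measure0 _ _ _ A0) => //; exact: measurableI.
Qed.

(** A Lebesgue-null set lies in open sets of small length, and the cells of a grid inside
    such a set are a finite disjoint family of small total length, on which the absolute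
    continuity of u bounds the measure k. *)
Lemma abs_continuous_null (R : realType)
    (k : {measure set (measurableTypeR R) -> \bar R}) (u : R -> R) (a b : R)
    (A : set (measurableTypeR R)) : a < b ->
  (forall x y, a <= x -> x <= y -> y <= b -> k `]x, y]%classic = (u x - u y)%:E) ->
  abs_continuous_on a b u ->
  measurable A -> A `<=` `]a, b] -> lebesgue_measure A = 0%E -> k A = 0%E.
Proof.
move=> ab ku acu mA Aab A0; apply/eqP; rewrite eq_le measure_ge0 andbT.
apply/lee_addgt0Pr => e e0; rewrite add0e.
have [d d0 H] := acu _ e0.
have [U [oU AU Ud]] := null_open_cover mA A0 d0.
apply: (@grid_measure_le _ U a b) => //.
  by move=> x Ax; split; [exact: AU|exact: Aab].
apply: nearW => n; pose lo := grid_lo a b n; pose hi := grid_hi U a b n.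
have lohi (i : 'I_n.+1) : a <= lo i /\ lo i <= hi i /\ hi i <= b by exact: grid_le.
have h : \sum_(i < n.+1) `|u (hi i) - u (lo i)| < e.
  apply: (H n.+1 (fun i => lo i) (fun i => hi i) lohi); first exact: (@grid_trivIset R U a b ab n true).
  rewrite -lte_fin -sumEFin.
  by apply: le_lt_trans Ud; exact: grid_length.
apply: (@le_trans _ _ (k (grid_set U a b n))).
  have mg := @measurable_grid_set R U a b n.
  by apply: le_measure; rewrite ?inE//; exact: measurableI.
rewrite measure_grid_set//.
apply: (@le_trans _ _ (\sum_(i < n.+1) `|u (hi i) - u (lo i)|)%:E); last by rewrite lee_fin ltW.
rewrite -sumEFin; apply: lee_sum => i _.
by have [? [? ?]] := lohi i; rewrite ku// lee_fin distrC ler_norm.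
Qed.

Lemma derivable_cvg_derive1 (R : realType) (f : R -> R) x : derivable f x 1 ->
  h^-1 *: (f (h + x) - f x) @[h --> 0^'] --> derive1 f x.
Proof.
rewrite /derivable /derive1.
have -> : (fun h => h^-1 *: (f (h + x) - f x)) =
    (fun h => h^-1 *: ((f \o shift x) (h *: 1) - f x)).
  by apply/funext => y /=; rewrite [y%:A]mulr1.
exact.
Qed.

Section right_derivative.
Context (R : realType).
Let mu : {measure set (measurableTypeR R) -> \bar R} := @lebesgue_measure R.

Context (F : R -> R) (ndF : {homo F : x y / x <= y}) (cF : continuous F).

Let rcF : right_continuous F.
Proof. exact: right_continuousW. Qed.

Let F_cumulative : cumulative R R := HB.pack F (isCumulative.Build R _ R F ndF rcF).

Let m : {measure set (measurableTypeR R) -> \bar R} :=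
  lebesgue_stieltjes_measure F_cumulative.

Let mE x y : x <= y -> m `]x, y]%classic = (F y - F x)%:E.
Proof.
move=> xy; rewrite /m/= /lebesgue_stieltjes_measure /measure_extension.
rewrite measurable_mu_extE/=; last exact: is_ocitv.
by rewrite wlength_itv_bnd.
Qed.

(** The points from which F grows at rate at most k, up to a distance 1 / (k + 1). *)
Let slope (k : nat) : set R :=
  [set x | forall y, x < y < x + k.+1%:R^-1 -> F y - F x <= k%:R * (y - x)].

Let measurable_slope k : measurable (slope k : set (measurableTypeR R)).
Proof.
apply: closed_measurable => x clx y /andP[xy yx]; rewrite leNgt; apply/negP => Fy.
have [] := clx [set z | z < y /\ y < z + k.+1%:R^-1 /\ k%:R * (y - z) < F y - F z].
  near=> z; split; [|split].
  - by near: z; exact: lt_nbhsl.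
  - rewrite -ltrBlDr; near: z; apply: lt_nbhsr; rewrite ltrBlDr//.
  - rewrite -subr_gt0; near: z.
    have : (F y - F z - k%:R * (y - z)) @[z --> x] --> F y - F x - k%:R * (y - x).
      apply: cvgB; first by apply: cvgB; [exact: cvg_cst|exact: cF].
      by apply: cvgMr; apply: cvgB; [exact: cvg_cst|exact: cvg_id].
    by move=> /cvgr_gt; apply; rewrite subr_gt0.
move=> z [zs [zy [yz]]]; rewrite ltNge zs//.
by rewrite zy.
Unshelve. all: by end_near. Qed.

(** Up to its right end e, F grows at rate at most k from any point of S, hence, by continuity,
    from the infimum of S. *)
Let slope_cell k (S : set R) (c e : R) : measurable (S : set (measurableTypeR R)) ->
  S `<=` slope k -> S `<=` `]c, e] -> e - c < k.+1%:R^-1 -> c <= e ->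
  (m S <= (k%:R * (e - c))%:E)%E.
Proof.
move=> mS Sk Sce ec ce.
have [->|/set0P[x0 Sx0]] := eqVneq S set0; first by rewrite measure0 lee_fin mulr_ge0 ?subr_ge0.
have hS : has_inf S.
  by split; [exists x0|exists c => x /Sce/=; rewrite in_itv/= => /andP[/ltW]].
pose a := inf S.
have ca : c <= a by apply: lb_le_inf; [exists x0|move=> x /Sce/=; rewrite in_itv/= => /andP[/ltW]].
have key x : S x -> F e - F x <= k%:R * (e - x).
  move=> Sx; have := Sce _ Sx; rewrite /= in_itv/= => /andP[cx].
  rewrite le_eqVlt => /orP[/eqP->|xe]; first by rewrite !subrr mulr0.
  by apply: (Sk _ Sx); rewrite xe/= -ltrBlDl (le_lt_trans _ ec)// lerB// ltW.
have keya : F e - F a <= k%:R * (e - a).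
  rewrite leNgt; apply/negP => h.
  have : \forall z \near a, k%:R * (e - z) < F e - F z.
    near=> z; rewrite -subr_gt0; near: z.
    have : (F e - F z - k%:R * (e - z)) @[z --> a] --> F e - F a - k%:R * (e - a).
      apply: cvgB; first by apply: cvgB; [exact: cvg_cst|exact: cF].
      by apply: cvgMr; apply: cvgB; [exact: cvg_cst|exact: cvg_id].
    by move=> /cvgr_gt; apply; rewrite subr_gt0.
  move=> /nbhs_ballP[r /= r0 hr].
  have [x Sx xa] := inf_adherent r0 hS.
  have ax : a <= x by apply: ge_inf => //; case: hS.
  have bx : ball a r x by rewrite /ball/= distrC ger0_norm ?subr_ge0// ltrBlDl.
  by have := hr _ bx; rewrite ltNge key.
apply/lee_addgt0Pr => eps eps0.
have [r r0 hr] : exists2 r, 0 < r & F a - F (a - r) <= eps.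
  have /cvgr_dist_lt/(_ _ eps0)/nbhs_ballP[r /= r0 h] := @cF a.
  exists (r / 2); first by rewrite divr_gt0.
  have : `|F a - F (a - r / 2)| < eps.
    by apply: h; rewrite /ball/= opprB addrC subrK gtr0_norm ?divr_gt0// ltr_pdivrMr// ltr_pMr// ltr1n.
  by move=> /ltW; apply: le_trans; exact: ler_norm.
apply: (@le_trans _ _ (m `]a - r, e]%classic)).
  apply: le_measure; rewrite ?inE//.
  move=> x Sx; have := Sce _ Sx; rewrite /= !in_itv/= => /andP[_ ->]; rewrite andbT.
  have ax : a <= x by apply: ge_inf => //; case: hS.
  by rewrite (lt_le_trans _ ax)// ltrBlDr ltrDl.
have ae : a <= e.
  have ax : a <= x0 by apply: ge_inf => //; case: hS.
  by have := Sce _ Sx0; rewrite /= in_itv/= => /andP[_]; exact: le_trans.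
rewrite mE; last by lra.
rewrite -EFinD lee_fin.
have : k%:R * (e - a) <= k%:R * (e - c) by rewrite ler_wpM2l// lerB.
lra.
Unshelve. all: by end_near. Qed.

Let slope_null (a b : R) k (A : set (measurableTypeR R)) : a < b -> measurable A -> mu A = 0%E ->
  A `<=` slope k -> A `<=` `]a, b] -> m A = 0%E.
Proof.
move=> ab mA A0 Ak Aab; apply/eqP; rewrite eq_le measure_ge0 andbT.
apply/lee_addgt0Pr => e e0; rewrite add0e.
have d0 : 0 < e / k.+1%:R by rewrite divr_gt0.
have [U [oU AU Ud]] := null_open_cover mA A0 d0.
apply: (@grid_measure_le _ U a b) => //.
  by move=> x Ax; split; [exact: AU|exact: Aab].
have : \forall n \near \oo, (b - a) / n.+1%:R < k.+1%:R^-1.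
  near=> n; rewrite ltr_pdivrMr// mulrC -ltr_pdivrMr// invrK.
  rewrite (lt_trans (truncnS_gt _))// ltr_nat ltnS.
  by near: n; exact: nbhs_infty_ge.
apply: filterS => n hn.
pose lo := grid_lo a b n; pose hi := grid_hi U a b n.
have mg := @measurable_grid_set R U a b n.
have -> : A `&` grid_set U a b n = \big[setU/set0]_(i < n.+1) (A `&` `]lo i, hi i]%classic).
  by rewrite /grid_set big_distrr.
apply: (@le_trans _ _ (\sum_(i < n.+1) m (A `&` `]lo i, hi i]%classic))%E).
  apply: (@Boole_inequality _ _ _ m (fun i => A `&` `]lo i, hi i]%classic)).
  by move=> i _; apply: measurableI => //; exact: measurable_itv.
apply: (@le_trans _ _ (\sum_(i < n.+1) k%:R%:E * (hi i - lo i)%:E)%E).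
  apply: lee_sum => i _; rewrite -EFinM; apply: slope_cell.
  - by apply: measurableI => //; exact: measurable_itv.
  - by move=> x [/Ak].
  - by move=> x [].
  - exact: le_lt_trans (grid_width U ab n i) hn.
  - by have [? []] := @grid_le R U a b ab n i (ltn_ord i).
rewrite -ge0_sume_distrr; last first.
  by move=> i _; rewrite lee_fin subr_ge0; have [? []] := @grid_le R U a b ab n i (ltn_ord i).
apply: (@le_trans _ _ (k%:R%:E * (e / k.+1%:R)%:E)%E).
  rewrite lee_wpmul2l ?lee_fin//; apply: le_trans (ltW Ud); exact: grid_length.
rewrite -EFinM lee_fin mulrCA ler_piMr ?(ltW e0)// ler_pdivrMr// mul1r.
by rewrite ler_nat.
Unshelve. all: by end_near. Qed.

(** A finite right derivative bounds the growth rate close enough to the point on its right. *)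
Let slope_cover x l : (F (x + h) - F x) / h @[h --> 0^'+] --> (l : R) ->
  exists k, slope k x.
Proof.
move=> Fl; have : \forall h \near 0^'+, (F (x + h) - F x) / h < l + 1.
  by move: Fl => /cvgr_lt; apply; rewrite ltrDl.
move=> /nbhs_ballP[r /= r0 hr].
pose k := maxn (Num.trunc (l + 1)).+1 (Num.trunc r^-1).+1.
exists k => y /andP[xy yx].
have xy0 : 0 < y - x by rewrite subr_gt0.
have := hr (y - x); rewrite [x + _]addrC subrK => /(_ _ xy0) h.
rewrite -ler_pdivrMr// ltW// (lt_le_trans (h _))//.
  rewrite /ball/= sub0r normrN gtr0_norm// ltrBlDl (lt_le_trans yx)// lerD2l.
  rewrite -[leRHS]invrK lef_pV2 ?posrE ?invr_gt0//.
  rewrite (le_trans (ltW (truncnS_gt _)))// ler_nat.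
  by rewrite (leq_trans (leq_maxr (Num.trunc (l + 1)).+1 _))//.
by rewrite (le_trans (ltW (truncnS_gt _)))// ler_nat leq_maxl.
Qed.

(** A right derivative everywhere is enough for a nondecreasing continuous F to be the
    integral of it. The sets slope k exhaust the line and the Stieltjes measure of F is at
    most k times the length on each of them, hence it is absolutely continuous; its
    Radon-Nikodym density is, almost everywhere, the derivative of F. *)
Lemma right_derivative_integral (g : R -> R) (a b : R) : a < b ->
  (forall x, (F (x + h) - F x) / h @[h --> 0^'+] --> g x) ->
  measurable_fun setT g ->
  mu.-integrable `]a, b] (EFin \o g) /\
  (F b - F a)%:E = (\int[mu]_(x in `]a, b]) (g x)%:E)%E.
Proof.
move=> ab Fg mg.
have mab : measurable (`]a, b]%classic : set (measurableTypeR R)) by exact: measurable_itv.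
have mfin : (m `]a, b]%classic < +oo)%E by rewrite mE ?ltry// ltW.
pose k : {finite_measure set (measurableTypeR R) -> \bar R} := mfrestr mab mfin.
have kE x : a <= x <= b -> k `]a, x]%classic = (F x - F a)%:E.
  move=> /andP[ax xb]; rewrite /k/= /mfrestr /mrestr setIidl ?mE//.
  by apply: subset_itvl; rewrite bnd_simp.
have kmu : k `<< @lebesgue_measure R.
  apply/null_content_dominatesP => A mA A0.
  have := @measure_sigma_subadditive _ _ _ m (A `&` `]a, b]%classic)
    (fun j => A `&` `]a, b]%classic `&` slope j).
  rewrite /k/= /mfrestr /mrestr => H.
  apply/eqP; rewrite eq_le measure_ge0 andbT; apply: (le_trans (H _ _ _)).
  - by move=> j; apply: measurableI => //; exact: measurableI.
  - exact: measurableI.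
  - by move=> x Ax; have [j xj] := slope_cover (Fg x); exists j.
  rewrite eseries0// => j _ _; apply: (@slope_null a b j) => //.
  - by apply: measurableI => //; exact: measurableI.
  - apply: (subset_measure0 _ _ _ A0) => //.
      by apply: measurableI => //; exact: measurableI.
    by move=> x [[]].
  - by move=> x [[]].
have [G [G0 Gfin Gint GE]] := radon_nikodym_sigma_finite kmu.
pose G' := fine \o G.
have G'E : EFin \o G' = G by apply/funext => x; rewrite /G'/= fineK.
have iG' : mu.-integrable setT (EFin \o G') by rewrite G'E.
have FE x : a <= x <= b -> F x - F a = \int[mu]_(t in `]a, x]) G' t.
  move=> axb; rewrite /Rintegral (eq_integral G) => [|t _]; last by rewrite -G'E.
  by rewrite -GE ?kE//; exact: measurable_itv.
have lG : locally_integrable [set: R] G'.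
  exact: open_integrable_locally openT iG'.
have iGa y : mu.-integrable [set` Interval (BRight a) (BRight y)] (EFin \o G').
  by apply: integrableS iG' => //; exact: measurable_itv.
have dG := FTC1 iGa lG.
have gG : {ae mu, forall x, `]a, b[%classic x -> (g x)%:E = G x}.
  move: dG; apply: filterS; first exact: (ae_filter_ringOfSetsType lebesgue_measure).
  move=> x dx /=; rewrite in_itv/= => /andP[ax xb].
  have [df dE] := dx ax.
  rewrite -G'E /=; congr EFin; rewrite -dE.
  apply: (@cvg_unique _ (@Rhausdorff R) _ _ _ _ (Fg x)).
  pose FG y := \int[mu]_(t in `]a, y]) G' t.
  have /cvg_dnbhs_at_right : h^-1 *: (FG (h + x) - FG x) @[h --> 0^'] --> derive1 FG x.
    exact: derivable_cvg_derive1.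
  apply: cvg_trans; apply: near_eq_cvg.
  near=> h; have h0 : 0 < h by [].
  have xhb : x + h <= b by rewrite -lerBrDl; near: h; apply: nbhs_right_le; rewrite subr_gt0.
  rewrite /= mulrC; congr (_ * _).
  have E1 : FG x = F x - F a by rewrite FE// (ltW ax) ltW.
  have E2 : FG (h + x) = F (x + h) - F a.
    by rewrite [h + x]addrC FE// xhb andbT ler_wpDr ?(ltW ax)// ltW.
  by rewrite E1 E2; ring.
have gGE : ae_eq mu (`]a, b]%classic : set R) (EFin \o g) G.
  have : {ae mu, forall x, x != b}.
    exists [set b]; split => //; first exact: lebesgue_measure_set1.
    by move=> x /= /negP; rewrite negbK => /eqP.
  move: gG; apply: filterS2; first exact: (ae_filter_ringOfSetsType mu).
  move=> x gx xb; rewrite /= in_itv/= => /andP[ax].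
  by rewrite le_eqVlt (negbTE xb)/= => xb'; apply: gx; rewrite /= in_itv/= ax.
have mGab : measurable_fun (`]a, b]%classic : set (measurableTypeR R)) G.
  by apply: measurable_funTS; exact: measurable_int Gint.
have mgab : measurable_fun (`]a, b]%classic : set (measurableTypeR R)) (EFin \o g).
  by apply/measurable_EFinP; exact: measurable_funTS.
split.
  apply/integrableP; split => //.
  rewrite (ae_eq_integral (abse \o G))//.
  - have : mu.-integrable `]a, b] G by apply: integrableS Gint.
    by move/integrableP => [].
  - exact: measurableT_comp.
  - exact: measurableT_comp.
  - exact: ae_eq_abse.
by rewrite (ae_eq_integral G)// -GE// kE// lexx ltW.
Unshelve. all: by end_near. Qed.

End right_derivative.

(** * The density of the Levy measure *)

Section levy_density.
Context (R : realType) (nubar : {measure set (measurableTypeR R) -> \bar R}).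
Hypothesis Hnu : levy_measure nubar.
Let mu : {measure set (measurableTypeR R) -> \bar R} := @lebesgue_measure R.

Lemma measurable_minr1 (A : set R) : measurable_fun A (fun x : R => (Num.min x 1)%:E).
Proof. by apply/measurable_EFinP; apply: measurable_minr. Qed.

(** Above x the integrand min(y, 1) is bounded below by min(x, 1). *)
Lemma levy_tail_fin (x : R) : 0 < x -> (nubar `]x, +oo[%classic < +oo)%E.
Proof.
move=> x0; pose c := Num.min x 1.
have c0 : 0 < c by rewrite lt_min x0 ltr01.
have mx : measurable (`]x, +oo[%classic : set (measurableTypeR R)) by exact: measurable_itv.
have : (c%:E * nubar `]x, +oo[%classic < +oo)%E.
  rewrite -integral_cst//; apply: le_lt_trans (levy_int Hnu).
  apply: (@le_trans _ _ (\int[nubar]_(y in `]x, +oo[) (Num.min y 1)%:E)%E).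
    apply: ge0_le_integral => //.
    - by move=> y _; rewrite lee_fin ltW.
    - exact: measurable_minr1.
    - move=> y /=; rewrite in_itv/= andbT => xy; rewrite lee_fin /c.
      by rewrite le_min ge_min (ltW xy)/= ge_min lexx orbT.
  apply: ge0_subset_integral => //.
  - exact: measurable_minr1.
  - move=> y /=; rewrite in_itv/= andbT => y0; rewrite lee_fin le_min (ltW y0).
    exact: ler01.
  - by move=> y /=; rewrite !in_itv/= !andbT; exact: lt_trans.
rewrite !ltey; apply: contra => /eqP ->.
by rewrite gt0_muley ?lte_fin.
Qed.

Lemma levy_tailE (x : R) : 0 < x -> (tail nubar x)%:E = nubar `]x, +oo[%classic.
Proof. by move=> x0; rewrite /tail fineK// ge0_fin_numE// levy_tail_fin. Qed.

Let levy_itv (x y : R) : 0 < x -> x <= y ->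
  nubar `]x, y]%classic = (tail nubar x - tail nubar y)%:E.
Proof.
move=> x0 xy; have y0 : 0 < y by exact: lt_le_trans xy.
have fx : nubar `]x, y]%classic \is a fin_num.
  rewrite ge0_fin_numE//; apply: le_lt_trans (levy_tail_fin x0).
  by apply: le_measure; rewrite ?inE//; exact: subset_itvl.
have H : nubar `]x, +oo[%classic = (nubar `]x, y]%classic + nubar `]y, +oo[%classic)%E.
  rewrite -measureU//=.
  - congr (nubar _); apply/seteqP; split => z /=; rewrite !in_itv/= !andbT.
      by move=> ->; case: (leP z y) => _; [left|right].
    by move=> [/andP[]//|]; exact: le_lt_trans.
  - apply/seteqP; split => z //= []; rewrite !in_itv/= => /andP[_ zy].
    by rewrite andbT ltNge zy.
rewrite EFinB !levy_tailE// H addeK//.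
by rewrite ge0_fin_numE// levy_tail_fin.
Qed.

(** The tail is absolutely continuous away from 0 only, so the half-line is covered by the
    intervals ]1 / (M + 1), M + 2]. *)
Lemma levy_null (A : set (measurableTypeR R)) : measurable A -> mu A = 0%E -> nubar A = 0%E.
Proof.
move=> mA A0; pose B (M : nat) : set (measurableTypeR R) := `]M.+1%:R^-1, M.+2%:R]%classic.
have := @measure_sigma_subadditive _ _ _ nubar A
  (fun M => if M is M'.+1 then A `&` B M' else `]-oo, 0]%classic).
have B_lt M : M.+1%:R^-1 < M.+2%:R :> R.
  by apply: (@le_lt_trans _ _ 1); rewrite ?ltr1n// invf_le1// ler1n.
have mAB M : measurable (A `&` B M) by apply: measurableI => //; exact: measurable_itv.
move=> H; apply/eqP; rewrite eq_le measure_ge0 andbT; apply: (le_trans (H _ _ _)) => //.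
- by case=> [|M] //; exact: measurable_itv.
- move=> x Ax; have [x0|x0] := leP x 0; first by exists 0%N => //=; rewrite in_itv.
  pose M := maxn (Num.trunc x^-1) (Num.trunc x).
  exists M.+1 => //; split => //; rewrite /B/= in_itv/=; apply/andP; split.
    rewrite -[ltRHS]invrK ltf_pV2 ?posrE ?invr_gt0//.
    by rewrite (lt_le_trans (truncnS_gt _))// ler_nat ltnS leq_maxl.
  rewrite (le_trans (ltW (truncnS_gt _)))// ler_nat ltnS.
  by rewrite (leq_trans (leq_maxr (Num.trunc x^-1) _)).
rewrite eseries0// => -[|M] _ _; first exact: (levy_supp Hnu).
apply: (@abs_continuous_null _ nubar (tail nubar) M.+1%:R^-1 M.+2%:R) => //.
- by move=> x y ax xy yb; rewrite levy_itv// (lt_le_trans _ ax).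
- exact: (levy_tail_ac Hnu).
- by apply: (subset_measure0 _ _ _ A0).
Qed.

(** The measure is finite on each of the disjoint rings between 1 / (j + 1) and 1 / j, where
    the Radon-Nikodym theorem applies; the density is the sum of the densities on the rings. *)
Lemma levy_density : exists n : R -> \bar R,
  [/\ measurable_fun setT n, forall c, (0 <= n c)%E, forall c, c <= 0 -> n c = 0%E &
      forall phi : R -> \bar R, measurable_fun setT phi -> (forall c, 0 <= phi c)%E ->
        (\int[nubar]_c phi c = \int[mu]_c (phi c * n c))%E].
Proof.
pose F (j : nat) : set (measurableTypeR R) := `]j.+1%:R^-1, +oo[%classic.
have mF j : measurable (F j) by exact: measurable_itv.
pose E := seqDU F.
have mE j : measurable (E j).
  by apply: measurableD => //; exact: bigsetU_measurable.
have Efin j : (nubar (E j) < +oo)%E.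
  apply: le_lt_trans (levy_tail_fin (_ : 0 < j.+1%:R^-1)); last by [].
  by apply: le_measure; rewrite ?inE//; exact: subDsetl.
have UE : \bigcup_j E j = `]0, +oo[%classic.
  rewrite -seqDU_bigcup_eq; apply/seteqP; split => x.
    by move=> [j _]; rewrite /F/= !in_itv/= !andbT; apply: lt_trans.
  rewrite /= in_itv/= andbT => x0; exists (Num.trunc x^-1) => //.
  rewrite /F/= in_itv/= andbT -[ltRHS]invrK ltf_pV2 ?posrE ?invr_gt0//.
  exact: truncnS_gt.
pose k j : {finite_measure set (measurableTypeR R) -> \bar R} := mfrestr (mE j) (Efin j).
have kmu j : k j `<< @lebesgue_measure R.
  apply/null_content_dominatesP => A mA A0.
  rewrite /k/= /mfrestr /mrestr; apply: levy_null; first exact: measurableI.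
  by apply: (subset_measure0 _ _ _ A0) => //; exact: measurableI.
have /choice[G HG] := fun j => radon_nikodym_sigma_finite (kmu j).
have mG j : measurable_fun setT (G j) by have [_ _ /measurable_int] := HG j.
have G0 j x : (0 <= G j x)%E by have [] := HG j.
pose n0 x : \bar R := (\sum_(j <oo) G j x)%E.
have mn0 : measurable_fun setT n0.
  by apply: ge0_emeasurable_sum => // j x _ _; exact: G0.
have n00 x : (0 <= n0 x)%E by exact: nneseries_ge0.
have mpos : measurable (`]0, +oo[%classic : set (measurableTypeR R)) by exact: measurable_itv.
have nuE A : measurable A -> nubar A = (\int[mu]_(x in A) (n0 \_ `]0%R, +oo[) x)%E.
  move=> mA; have -> : nubar A = nubar (A `&` `]0%R, +oo[%classic).
    rewrite (measureDI nubar mA mpos) [X in (X + _)%E](_ : _ = 0%E) ?add0e//.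
    apply: (subset_measure0 _ _ _ (levy_supp Hnu)) => //; first exact: measurableD.
    by move=> x [_] /=; rewrite !in_itv/= andbT => /negP; rewrite -leNgt.
  have mAp : measurable (A `&` `]0%R, +oo[%classic) by exact: measurableI.
  rewrite -integral_mkcondr integral_nneseries//; last by move=> j; exact: measurable_funTS.
  rewrite [X in nubar X](_ : _ = \bigcup_j (A `&` `]0%R, +oo[%classic `&` E j)); last first.
    by rewrite -setI_bigcupr UE -setIA setIid.
  rewrite measure_bigcup//=.
  - rewrite (@eq_eseriesl _ _ xpredT) => [|j]; last by rewrite in_setT.
    by apply: eq_eseriesr => j _; have [_ _ _ GE] := HG j; rewrite -GE.
  - by move=> j _; exact: measurableI.
  - apply/trivIsetP => i j _ _ ij.
    have /trivIsetP/(_ i j I I ij) := trivIset_seqDU F.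
    by rewrite -/E => Eij; rewrite setIACA Eij setI0.
exists (n0 \_ `]0%R, +oo[); split.
- by apply/measurable_restrict => //; rewrite setTI; exact: measurable_funTS.
- by move=> c; rewrite patchE; case: ifP.
- by move=> c c0; rewrite patchE memNset//= in_itv/= andbT ltNge c0.
- move=> phi mphi phi0; apply: (@integral_weighted_law _ _ _ _ _ mu _ id) => //.
  + by apply/measurable_restrict => //; rewrite setTI; exact: measurable_funTS.
  + by move=> c; rewrite patchE; case: ifP.
Qed.

End levy_density.

(** * Explicit integrals *)

(** Indicators with extended real values turn conditions on the variables, or domains of
    integration, into factors that can be moved through Tonelli's theorem. *)
Definition ind {R : realType} (b : bool) : \bar R := if b then 1%E else 0%E.

Section indicator.
Local Open Scope ereal_scope.
Context (R : realType).

Lemma ind_ge0 (b : bool) : 0 <= ind b :> \bar R.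
Proof. by case: b. Qed.

Lemma ind_mul (b : bool) (x : \bar R) : ind b * x = if b then x else 0.
Proof. by case: b; rewrite /= ?mul1e ?mul0e. Qed.

Lemma ind_and (b c : bool) : ind (b && c) = ind b * ind c :> \bar R.
Proof. by rewrite ind_mul; case: b. Qed.

Lemma measurable_ind d (T : measurableType d) (b : T -> bool) :
  measurable_fun setT b -> measurable_fun setT (fun x => ind (b x) : \bar R).
Proof. by move=> mb; exact: measurable_fun_ifT. Qed.

Lemma integral_ind_itv d (T : measurableType d) (m : {measure set T -> \bar R})
    (b : T -> bool) (f : T -> \bar R) :
  \int[m]_x (ind (b x) * f x) = \int[m]_(x in [set x | b x]) f x.
Proof.
rewrite [RHS]integral_mkcond; apply: eq_integral => x _; rewrite patchE ind_mul.
by case: ifP => bx; [rewrite mem_set|rewrite memNset//= bx].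
Qed.

End indicator.

Lemma comp_measurable d1 d2 d3 (T1 : measurableType d1) (T2 : measurableType d2)
    (T3 : measurableType d3) (f : T2 -> T3) (g : T1 -> T2) :
  measurable_fun setT f -> measurable_fun setT g -> measurable_fun setT (fun x => f (g x)).
Proof. exact: measurableT_comp. Qed.

Lemma comp2_measurable d1 d2 d3 d4 (T1 : measurableType d1) (T2 : measurableType d2)
    (T3 : measurableType d3) (T4 : measurableType d4) (f : T2 -> T3 -> T4) (g : T1 -> T2) (h : T1 -> T3) :
  measurable_fun setT (fun z => f z.1 z.2) -> measurable_fun setT g ->
  measurable_fun setT h -> measurable_fun setT (fun x => f (g x) (h x)).
Proof.
move=> mf mg mh.
exact: (measurableT_comp mf (measurable_fun_pair mg mh)).
Qed.

(** Measurability of a function given by an explicit formula, by induction on the formula. *)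
Ltac meas_step := match goal with
  | H : measurable_fun _ ?f |- measurable_fun _ ?g => constr_eq f g; exact: H
  | |- measurable_fun _ (fun _ => ?c) => exact: measurable_cst
  | |- measurable_fun _ (fun x => x) => exact: measurable_id
  | |- measurable_fun _ (fun x => fst x) => exact: measurable_fst
  | |- measurable_fun _ (fun x => snd x) => exact: measurable_snd
  | |- measurable_fun _ (fun x => fst (@?g x)) => apply: (@comp_measurable _ _ _ _ _ _ fst g); first exact: measurable_fst
  | |- measurable_fun _ (fun x => snd (@?g x)) => apply: (@comp_measurable _ _ _ _ _ _ snd g); first exact: measurable_snd
  | |- measurable_fun _ (fun x => ind (@?b x)) => apply: (@measurable_ind _ _ _ b)
  | |- measurable_fun _ (fun x => andb (@?b x) (@?c x)) => apply: measurable_and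
  | |- measurable_fun _ (fun x => Order.lt (@?b x) (@?c x)) => apply: measurable_fun_ltr
  | |- measurable_fun _ (fun x => Order.le (@?b x) (@?c x)) => apply: measurable_fun_ler
  | |- measurable_fun _ (fun x => (@?b x * @?c x)%E) => apply: emeasurable_funM
  | |- measurable_fun _ (fun x => (@?b x + @?c x)%E) => apply: emeasurable_funD
  | |- measurable_fun _ (fun x => (@?b x)%:E) => apply/(@measurable_EFinP _ _ _ _ b)
  | |- measurable_fun _ (fun x => expR (@?b x)) => apply: (@comp_measurable _ _ _ _ _ _ expR b); first exact: measurable_expR
  | |- measurable_fun _ (fun x => (@?b x - @?c x)%R) => apply: measurable_funB
  | |- measurable_fun _ (fun x => (- @?b x)%R) => apply: measurable_funN
  | |- measurable_fun _ (fun x => (@?b x + @?c x)%R) => first [apply: measurable_funD | apply: emeasurable_funD]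
  | |- measurable_fun _ (fun x => (@?b x * @?c x)%R) => apply: measurable_funM
  | |- measurable_fun _ (fun x => Num.max (@?b x) (@?c x)) => apply: measurable_maxr
  | |- measurable_fun _ (fun x => Num.min (@?b x) (@?c x)) => apply: measurable_minr
  | H : measurable_fun _ (fun z => ?F z.1 z.2) |- measurable_fun _ (fun x => ?G (@?g x) (@?h x)) =>
      constr_eq F G; apply: (comp2_measurable H)
  | H : measurable_fun _ ?F |- measurable_fun _ (fun x => ?G (@?g x)) =>
      constr_eq F G; apply: (comp_measurable H)
  | H : forall v, measurable_fun _ (?F v) |- measurable_fun _ (fun x => ?G ?v (@?g x)) =>
      constr_eq F G; apply: (comp_measurable (H v))
  | |- measurable_fun ?D ?f =>
      (* an eta-reduced body *)
      lazymatch f with (fun _ => _) => fail | _ => change (measurable_fun D (fun x => f x)) end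
  end.

Ltac meas := repeat meas_step.

(** Nonnegativity, likewise. *)
Ltac nng_step := match goal with
  | H : is_true (Order.lt _ ?a) |- is_true (Order.le _ ?b) => constr_eq a b; exact: (ltW H)
  | |- is_true (Order.le _ (mule _ _)) => apply: mule_ge0
  | |- is_true (Order.le _ (adde _ _)) => apply: adde_ge0
  | |- is_true (Order.le _ (ind _)) => exact: ind_ge0
  | |- is_true (Order.le _ (integral _ _ _)) => apply: integral_ge0 => ? _
  | |- is_true (Order.le _ (EFin _)) => rewrite lee_fin
  | |- is_true (Order.le _ (expR _)) => exact: expR_ge0
  | |- is_true (Order.le _ (GRing.inv _)) => rewrite invr_ge0
  | |- is_true (Order.le _ (GRing.mul _ _)) => apply: mulr_ge0
  | |- is_true (Order.le _ (GRing.add _ _)) => first [apply: adde_ge0 | apply: addr_ge0]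
  | H : forall x, is_true (Order.le _ (?F x)) |- is_true (Order.le _ (?G _)) => constr_eq F G; exact: H
  | H : forall x y, is_true (Order.le _ (?F x y)) |- is_true (Order.le _ (?G _ _)) =>
      constr_eq F G; exact: H
  | H : is_true (Order.le _ ?a) |- is_true (Order.le _ ?b) => constr_eq a b; exact: H
  end.

Ltac nng := repeat nng_step.

Lemma integralZ d (T : measurableType d) (R : realType) (m : {measure set T -> \bar R})
    (A : set T) (k : R) (f : T -> \bar R) : measurable A -> 0 <= k ->
  measurable_fun setT f -> (forall x, 0 <= f x)%E ->
  (\int[m]_(x in A) (k%:E * f x) = k%:E * \int[m]_(x in A) f x)%E.
Proof.
by move=> mA k0 mf f0; rewrite ge0_integralZl//; exact: measurable_funTS.
Qed.

Lemma integral_addition d (T : measurableType d) (R : realType) (m : {measure set T -> \bar R})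
    (A : set T) (f g : T -> \bar R) : measurable A ->
  measurable_fun setT f -> (forall x, 0 <= f x)%E ->
  measurable_fun setT g -> (forall x, 0 <= g x)%E ->
  (\int[m]_(x in A) (f x + g x) = \int[m]_(x in A) f x + \int[m]_(x in A) g x)%E.
Proof.
by move=> mA mf f0 mg g0; rewrite ge0_integralD//; exact: measurable_funTS.
Qed.

Section tonelli.
Local Open Scope ereal_scope.
Context d1 d2 (T1 : measurableType d1) (T2 : measurableType d2) (R : realType).
Context (m1 : {sigma_finite_measure set T1 -> \bar R}) (m2 : {sigma_finite_measure set T2 -> \bar R}).
Context (A : set T1) (B : set T2) (mA : measurable A) (mB : measurable B).
Context (f : T1 -> T2 -> \bar R).
Hypothesis mf : measurable_fun setT (fun z => f z.1 z.2).
Hypothesis f0 : forall x y, 0 <= f x y.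

Let g : T1 * T2 -> \bar R := (fun z => f z.1 z.2) \_ (A `*` B).

Let mg : measurable_fun setT g.
Proof.
apply/measurable_restrict => //; first exact: measurableX.
by rewrite setTI; exact: measurable_funTS.
Qed.

Let g0 z : 0 <= g z. Proof. by rewrite /g patchE; case: ifP. Qed.

Lemma measurable_integral1 : measurable_fun setT (fun x => \int[m2]_(y in B) f x y).
Proof.
have := @measurable_fun_fubini_tonelli_F _ _ _ _ _ m2
  ((fun z => f z.1 z.2) \_ (setT `*` B)).
have -> : fubini_F m2 ((fun z => f z.1 z.2) \_ ([set: T1] `*` B)) = (fun x => \int[m2]_(y in B) f x y).
  apply/funext => x; rewrite /fubini_F [RHS]integral_mkcond; apply: eq_integral => y _.
  by rewrite !patchE in_setX in_setT.
apply.
- apply/measurable_restrict => //; first exact: measurableX.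
  by rewrite setTI; exact: measurable_funTS.
- by move=> z; rewrite patchE; case: ifP.
Qed.

Lemma tonelli :
  \int[m1]_(x in A) \int[m2]_(y in B) f x y = \int[m2]_(y in B) \int[m1]_(x in A) f x y.
Proof.
have := @fubini_tonelli _ _ _ _ _ m1 m2 g mg g0.
have -> : \int[m1]_x \int[m2]_y g (x, y) = \int[m1]_(x in A) \int[m2]_(y in B) f x y.
  rewrite [RHS]integral_mkcond; apply: eq_integral => x _; rewrite patchE.
  case: ifP => Ax; last by apply: integral0_eq => y _; rewrite /g patchE in_setX Ax.
  by rewrite [RHS]integral_mkcond; apply: eq_integral => y _; rewrite /g !patchE in_setX Ax.
move=> ->; rewrite [RHS]integral_mkcond; apply: eq_integral => y _; rewrite patchE.
case: ifP => By; last by apply: integral0_eq => x _; rewrite /g patchE in_setX By andbF.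
by rewrite [RHS]integral_mkcond; apply: eq_integral => x _; rewrite /g !patchE in_setX By andbT.
Qed.

End tonelli.

Arguments tonelli {d1 d2 T1 T2 R m1 m2 A B} mA mB f.
Arguments measurable_integral1 {d1 d2 T1 T2 R} m2 {B} mB f.

Section lebesgue_invariance.
Local Open Scope ereal_scope.
Context (R : realType).
Local Notation mu := (@lebesgue_measure R).

(** A map that preserves the length of intervals preserves the Lebesgue measure. *)
Let ge0_invariance (Z : R -> R) (phi : R -> \bar R) : measurable_fun setT Z ->
  (forall X : set R, ocitv X -> mu X = mu (Z @^-1` X)) ->
  measurable_fun setT phi -> (forall x, 0 <= phi x) ->
  \int[mu]_x phi (Z x) = \int[mu]_x phi x.
Proof.
move=> mZ H mphi phi0.
have m10 : forall x : measurableTypeR R, 0 <= (cst 1 x : \bar R) by [].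
have mc : measurable_fun [set: measurableTypeR R] (cst 1 : _ -> \bar R) by [].
have mZ' : measurable_fun setT (Z : measurableTypeR R -> measurableTypeR R) by [].
have wE A : weighted_law mu mc m10 mZ' A = \int[mu]_(x in Z @^-1` A) 1 by [].
pose k : {measure set (measurableTypeR R) -> \bar R} := mu.
have := @integral_weighted_law _ (measurableTypeR R) _ (measurableTypeR R) R mu (cst 1) Z mc m10 mZ'
  k phi _ mphi phi0.
move=> ->; first by apply: eq_integral => x _; rewrite mule1.
move=> A mA; rewrite -(wE A).
apply: (@lebesgue_measure_unique _ (weighted_law mu mc m10 mZ')) => // X oX.
rewrite (H X oX) /= /weighted_law integral_cst ?mul1e//.
rewrite -[X in measurable X]setTI; apply: mZ => //.
by apply: sub_sigma_algebra.
Qed.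

Lemma integral_shift (a : R) (phi : R -> \bar R) :
  measurable_fun setT phi -> (forall x, 0 <= phi x) ->
  \int[mu]_x phi (x - a)%R = \int[mu]_x phi x.
Proof.
apply: ge0_invariance; first exact: measurable_funB.
move=> _ [[x y] _ <-] /=.
have -> : (fun z : R => (z - a)%R) @^-1` `]x, y]%classic = `](x + a)%R, (y + a)%R]%classic.
  by apply/seteqP; split => z /=; rewrite !in_itv/= ltrBrDr lerBlDr.
rewrite !lebesgue_measure_itv/= !lte_fin ltrD2r; case: ifP => // _.
by rewrite -!EFinB; congr EFin; ring.
Qed.

Lemma integral_reflect (a : R) (phi : R -> \bar R) :
  measurable_fun setT phi -> (forall x, 0 <= phi x) ->
  \int[mu]_x phi (a - x)%R = \int[mu]_x phi x.
Proof.
apply: ge0_invariance; first exact: measurable_funB.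
move=> _ [[x y] _ <-] /=.
have -> : (fun z : R => (a - z)%R) @^-1` `]x, y]%classic = `[(a - y)%R, (a - x)%R[%classic.
  by apply/seteqP; split => z /=; rewrite !in_itv/= => /andP[? ?]; apply/andP; split; lra.
rewrite !lebesgue_measure_itv/= !lte_fin ltrD2l ltrN2; case: ifP => // _.
by rewrite -!EFinB; congr EFin; ring.
Qed.

End lebesgue_invariance.

Section exponential_integrals.
Context (R : realType).
Local Notation mu := (@lebesgue_measure R).

Lemma integral_is_derive (f F : R -> R) (x : R) : 0 < x ->
  (forall z : R, is_derive z (1 : R) F (f z)) -> continuous f ->
  (\int[mu]_(z in `]0%R, x[) (f z)%:E = (F x - F 0)%:E)%E.
Proof.
move=> x0 dF cf.
have cF : continuous F.
  by move=> z; apply/differentiable_continuous/derivable1_diffP; exact: ex_derive.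
rewrite -(@integral_itv_bndoo _ _ _ _ true false); last first.
  by apply/measurable_EFinP; apply: measurable_funTS; exact: continuous_measurable_fun.
rewrite EFinB; apply: continuous_FTC2 => //.
- exact: continuous_subspaceT.
- split.
  + by move=> z _; exact: ex_derive.
  + by apply: cvg_at_right_filter; exact: cF.
  + by apply: cvg_at_left_filter; exact: cF.
- by move=> z _; rewrite derive1E; exact: derive_val.
Qed.

Context (t : R) (t0 : 0 < t).

Let cexp : continuous (fun z : R => expR (- (t * z))).
Proof.
move=> z; apply: continuous_comp; last exact: continuous_expR.
by apply: continuousN; apply: continuousM => //; exact: cst_continuous.
Qed.

Let dexp (z : R) : is_derive z (1 : R) (fun z => - (expR (- (t * z)) / t)) (expR (- (t * z))).
Proof.
have t1 : t != 0 by rewrite gt_eqF.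
by apply: is_derive_eq; rewrite /GRing.scale/=; field.
Qed.

Let dmexp (z : R) : is_derive z (1 : R)
  (fun z => - ((z / t + t ^- 2) * expR (- (t * z)))) (z * expR (- (t * z))).
Proof.
have t1 : t != 0 by rewrite gt_eqF.
by apply: is_derive_eq; rewrite /GRing.scale/=; field.
Qed.

Lemma integral_expR (x : R) : 0 <= x ->
  (\int[mu]_(z in `]0%R, x[) (expR (- (t * z)))%:E = ((1 - expR (- (t * x))) / t)%:E)%E.
Proof.
rewrite le_eqVlt => /orP[/eqP<-|x0].
  by rewrite set_itvoo0 ?integral_set0 ?mulr0 ?oppr0 ?expR0 ?subrr ?mul0r.
rewrite (integral_is_derive x0 dexp cexp); congr EFin.
by rewrite mulr0 oppr0 expR0; ring.
Qed.

Lemma integral_mul_expR (x : R) : 0 <= x ->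
  (\int[mu]_(z in `]0%R, x[) (z * expR (- (t * z)))%:E =
   ((1 - expR (- (t * x))) / t ^+ 2 - x * expR (- (t * x)) / t)%:E)%E.
Proof.
rewrite le_eqVlt => /orP[/eqP<-|x0].
  rewrite set_itvoo0 integral_set0 mulr0 oppr0 expR0 subrr !mul0r; congr EFin; ring.
rewrite (integral_is_derive x0 dmexp); last first.
  by move=> z; apply: cvgM; [exact: cvg_id|exact: cexp].
by congr EFin; rewrite mulr0 oppr0 expR0; field; rewrite gt_eqF.
Qed.

Lemma integral_expRy :
  (\int[mu]_(z in `[0%R, +oo[) (expR (- (t * z)))%:E = (t^-1)%:E)%E.
Proof.
rewrite (@ge0_continuous_FTC2y _ _ (fun z => - (expR (- (t * z)) / t)) _ 0)//.
- by rewrite mulr0 oppr0 expR0 mul1r sub0e EFinN oppeK.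
- exact: continuous_subspaceT.
- rewrite -oppr0 -(mul0r t^-1); apply: cvgN; apply: cvgMl.
  apply: (@cvg_comp _ _ _ (fun z => t * z) (fun z => expR (- z)) _ (pinfty_nbhs R)); last exact: cvgr_expR.
  exact: gt0_cvgMry.
- apply: cvgN; apply: cvgMl; apply/cvg_at_right_filter; exact: cexp.
- by move=> z _; rewrite derive1E; have H := dexp z; exact: derive_val.
Qed.

End exponential_integrals.

(** * First passage densities of a subordinator *)

(** Uniqueness for densities on the line carried by the half-line: the map is r |-> max(r, 0). *)
Lemma laplace_unique_line (R : realType) (a1 a2 psi : R -> \bar R) :
  measurable_fun setT a1 -> measurable_fun setT a2 ->
  (forall r, 0 <= a1 r)%E -> (forall r, 0 <= a2 r)%E ->
  (forall r, r < 0 -> a1 r = 0%E) -> (forall r, r < 0 -> a2 r = 0%E) ->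
  (forall s, 0 < s ->
     (\int[lebesgue_measure]_r ((expR (- (s * r)))%:E * a1 r) < +oo)%E) ->
  (forall s, 0 < s ->
     (\int[lebesgue_measure]_r ((expR (- (s * r)))%:E * a1 r) =
      \int[lebesgue_measure]_r ((expR (- (s * r)))%:E * a2 r))%E) ->
  measurable_fun setT psi -> (forall r, 0 <= psi r)%E ->
  (\int[lebesgue_measure]_r (psi r * a1 r) = \int[lebesgue_measure]_r (psi r * a2 r))%E.
Proof.
move=> ma1 ma2 a10 a20 a1N a2N fin eqL mpsi psi0.
have E (g a : R -> \bar R) : (forall r, r < 0 -> a r = 0%E) ->
    (\int[lebesgue_measure]_r (g (Num.max r 0)%R * a r) = \int[lebesgue_measure]_r (g r * a r))%E.
  move=> aN; apply: eq_integral => r _; have [r0|r0] := leP 0 r; last by rewrite aN// !mule0.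
  by [].
have mZ : measurable_fun setT (fun r : R => Num.max r 0) by meas.
rewrite -(E psi a1)// -(E psi a2)//.
pose Z (r : R) := Num.max r 0.
have Z0 (r : measurableTypeR R) : 0 <= Z r by rewrite /Z le_max lexx orbT.
apply: (@laplace_unique _ _ (measurableTypeR R) (measurableTypeR R) R
  lebesgue_measure lebesgue_measure a1 a2 Z Z psi ma1 ma2 mZ mZ a10 a20 Z0 Z0 _ _ mpsi psi0).
- by move=> s s0; rewrite (E (fun z => (expR (- (s * z)))%:E) a1 a1N) fin.
- move=> s s0; rewrite (E (fun z => (expR (- (s * z)))%:E) a1 a1N).
  by rewrite (E (fun z => (expR (- (s * z)))%:E) a2 a2N) eqL.
Qed.

(** As k grows, the middle term is the difference quotient that appears when the Laplace
    transform of a mass at a is differentiated, with step 1 / k. The upper bound dominates these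
    quotients by their limit; the lower one bounds the damped mean by the exponent itself. *)
Lemma difference_quotient_bounds (R : realType) (a k : R) : 0 <= a -> 0 < k ->
  a * expR (- (a / k)) <= k * (1 - expR (- (a / k))) <= a.
Proof.
move=> a0 k0; have e1 := @expR_ge1Dx R (- (a / k)).
have e2 := @expR_ge1Dx R (a / k).
have e3 : expR (a / k) * expR (- (a / k)) = 1 by rewrite expRxMexpNx_1.
have e4 := @expR_gt0 R (- (a / k)).
have ak : a = k * (a / k) by rewrite mulrCA divff ?mulr1// gt_eqF.
set b := a / k in e1 e2 e3 e4 ak *; set E := expR (- b) in e1 e3 e4 *.
have h : (1 + b) * E <= 1 by apply: (le_trans (ler_wpM2r (ltW e4) e2)); rewrite e3.
rewrite ak; apply/andP; split.
  by rewrite -mulrA ler_wpM2l ?(ltW k0)//; lra.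
by rewrite ler_wpM2l ?(ltW k0)//; lra.
Qed.

Lemma cvg_difference_quotient (R : realType) (u : nat -> R) (l : R) : (forall m, 0 <= u m) ->
  u m @[m --> \oo] --> l ->
  m.+1%:R * (1 - expR (- (u m / m.+1%:R))) @[m --> \oo] --> l.
Proof.
move=> u0 ul.
have h : \forall m \near \oo, u m * expR (- (u m / m.+1%:R)) <= m.+1%:R * (1 - expR (- (u m / m.+1%:R))) <= u m.
  by apply: nearW => m; exact: difference_quotient_bounds.
apply: (squeeze_cvgr h) (ul).
have -> : l = l * expR (- (l * 0)) by rewrite mulr0 oppr0 expR0 mulr1.
have c2 : expR (- (u m / m.+1%:R)) @[m --> \oo] --> expR (- (l * 0)).
  apply: continuous_cvg; first exact: continuous_expR.
  by apply: cvgN; apply: cvgM => //; exact: cvg_harmonic.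
exact: cvgM ul c2.
Qed.

Lemma integral_ind (R : realType) (b : R -> bool) (i : interval R) :
  (forall r, b r = (r \in i)) ->
  (\int[lebesgue_measure]_r ind (b r) = lebesgue_measure [set` i])%E.
Proof.
move=> bi; transitivity (\int[lebesgue_measure]_r (ind (b r) * cst 1 r))%E.
  by apply: eq_integral => r _; rewrite mule1.
rewrite integral_ind_itv integral_cst ?mul1e; last first.
  by rewrite (_ : [set x | b x] = [set` i])//; apply/seteqP; split => r; rewrite /= bi.
by congr (lebesgue_measure _); apply/seteqP; split => r; rewrite /= bi.
Qed.

Lemma integralZe d (T : measurableType d) (R : realType) (m : {measure set T -> \bar R})
    (A : set T) (k : \bar R) (f : T -> \bar R) : measurable A -> (0 <= k)%E ->
  measurable_fun setT f -> (forall x, 0 <= f x)%E ->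
  (\int[m]_(x in A) (k * f x) = k * \int[m]_(x in A) f x)%E.
Proof.
by move=> mA k0 mf f0; rewrite ge0_integralZl//; exact: measurable_funTS.
Qed.

Lemma mule_swap (R : realType) (a b c : \bar R) : (a * b * c = b * (a * c))%E.
Proof. by rewrite -muleA muleCA. Qed.

Section subordinator_laws.
Local Open Scope ereal_scope.
Context (R : realType).
Local Notation mu := (@lebesgue_measure R).
Context (n : R -> \bar R) (f : R -> R).
Hypothesis mn : measurable_fun setT n.
Hypothesis n0 : forall c, 0 <= n c.
Hypothesis nN : forall c, (c <= 0)%R -> n c = 0.
Hypothesis Hf : forall s, (0 <= s)%R ->
  (f s)%:E = \int[mu]_c ((1 - expR (- (s * c)))%:E * n c).
Hypothesis Hinf : \int[mu]_c n c = +oo.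

(** The tail of the Levy measure of density n. It vanishes on the left half-line, so that
    convolutions with it are integrals over the whole line. *)
Definition ltail (z : R) : \bar R := \int[mu]_c (ind (0 < z < c)%R * n c).

Let prod_ge0 s c : (0 <= s)%R -> 0 <= (1 - expR (- (s * c)))%:E * n c.
Proof.
move=> s0; have [c0|c0] := leP c 0%R; first by rewrite nN// mule0.
rewrite mule_ge0// lee_fin subr_ge0 -expR0 ler_expR oppr_le0.
by rewrite mulr_ge0// ltW.
Qed.

Lemma levy_exponent_ge0 s : (0 <= s)%R -> (0 <= f s)%R.
Proof.
move=> s0; rewrite -lee_fin Hf//; apply: integral_ge0 => c _; exact: prod_ge0.
Qed.

Lemma levy_exponent_gt0 s : (0 < s)%R -> (0 < f s)%R.
Proof.
move=> s0; rewrite lt0r levy_exponent_ge0 ?(ltW s0)// andbT; apply/eqP => fs0.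
have mfs : measurable_fun setT (fun c => (1 - expR (- (s * c)))%:E * n c) by meas.
have : \int[mu]_c `|(1 - expR (- (s * c)))%:E * n c| = 0.
  rewrite -[RHS]/(0%:E) -fs0 Hf ?(ltW s0)//; apply: eq_integral => c _.
  by rewrite gee0_abs// prod_ge0// ltW.
move=> /((ae_eq_integral_abs mu measurableT mfs).1) H.
have : \int[mu]_c n c = 0.
  rewrite -(@integral0 _ _ R mu setT); apply: ge0_ae_eq_integral => //.
  have aeF := ae_filter_ringOfSetsType (@lebesgue_measure R).
  move: H; apply: filterS => c /(_ I) /= /eqP; rewrite mule_eq0 => /orP[|/eqP//].
  rewrite eqe subr_eq0 eq_sym -[X in _ == X]expR0 (inj_eq (@expR_inj R)) oppr_eq0 mulf_eq0 gt_eqF//=.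
  by move=> /eqP -> _; rewrite nN.
by rewrite Hinf.
Qed.

Lemma ltail_ge0 z : 0 <= ltail z.
Proof. by apply: integral_ge0 => c _; rewrite mule_ge0// ind_ge0. Qed.

Lemma ltailN z : (z <= 0)%R -> ltail z = 0.
Proof.
by move=> z0; apply: integral0_eq => c _; rewrite ltNge z0/= mul0e.
Qed.

Lemma measurable_ltail : measurable_fun setT ltail.
Proof.
apply: (measurable_integral1 mu measurableT (fun (z : R) c => ind (0 < z < c)%R * n c)).
  by meas.
by move=> z c; rewrite mule_ge0// ind_ge0.
Qed.

Let mtail := measurable_ltail.
Let tail0 := ltail_ge0.

Let integral_exp0 (s c : R) : (0 < s)%R -> (0 <= c)%R ->
  \int[mu]_z (ind (0 < z < c)%R * (expR (- (s * z)))%:E) = ((1 - expR (- (s * c))) / s)%:E.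
Proof. by move=> s0 c0; rewrite integral_ind_itv integral_expR. Qed.

(** By Tonelli, from the integral of e^(- s z) over ]0, c[. *)
Lemma laplace_ltail s : (0 < s)%R ->
  \int[mu]_z ((expR (- (s * z)))%:E * ltail z) = (f s / s)%:E.
Proof.
move=> s0.
transitivity (\int[mu]_z \int[mu]_c ((expR (- (s * z)))%:E * (ind (0 < z < c)%R * n c))).
  by apply: eq_integral => z _; rewrite integralZ; [|by []|nng|meas|move=> c; nng].
etransitivity; first by apply: tonelli; [by []|by []|meas|move=> z c; nng].
transitivity (\int[mu]_c ((s^-1)%:E * ((1 - expR (- (s * c)))%:E * n c))).
  apply: eq_integral => c _.
  have [c0|c0] := leP c 0%R.
    by rewrite nN// !mule0; apply: integral0_eq => z _; rewrite !mule0.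
  under eq_integral do rewrite muleA [(_ %:E * ind _)]muleC muleC.
  rewrite ge0_integralZl//; [|by meas|by move=> z _; nng].
  by rewrite integral_exp0// ?(ltW c0)// EFinM muleC [RHS]muleA [(s^-1)%:E * _]muleC.
rewrite integralZ; [|by []|by nng|by meas|by move=> c; rewrite prod_ge0// ltW].
by rewrite -Hf ?(ltW s0)// -EFinM mulrC.
Qed.

Let laplace_shift_ltail s x : (0 < s)%R ->
  \int[mu]_r ((expR (- (s * r)))%:E * ltail (r - x)) = (expR (- (s * x)) * (f s / s))%:E.
Proof.
move=> s0; rewrite EFinM -laplace_ltail// -integralZ; [|by []|nng|meas|by move=> r; nng].
rewrite -(@integral_shift _ x (fun r => (expR (- (s * x)))%:E * ((expR (- (s * r)))%:E * ltail r))).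
- apply: eq_integral => r _; rewrite muleA -EFinM -expRD; congr ((expR _)%:E * _); ring.
- by meas.
- by move=> r; nng.
Qed.

Context d (T : measurableType d) (P : probability T R) (X : R -> T -> R).
Hypothesis mX : measurable_fun setT (fun z => X z.1 z.2).
Hypothesis X0 : forall v w, (0 <= X v w)%R.
Hypothesis XL : forall v s, (0 <= v)%R -> (0 <= s)%R ->
  \int[P]_w (expR (- (s * X v w)))%:E = (expR (- (v * f s)))%:E.

Let mXv v : measurable_fun setT (X v).
Proof. exact: (comp2_measurable mX (@measurable_cst _ _ _ _ _ _) (@measurable_id _ _ _)). Qed.

(** The density at v of the first time at which X exceeds the level r, as passage_cdf
    establishes: X overshoots r from X v by a jump larger than r - X v. *)
Definition passage (r v : R) : \bar R := \int[P]_w ltail (r - X v w).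

Lemma passage_ge0 r v : 0 <= passage r v.
Proof. by apply: integral_ge0 => w _; exact: ltail_ge0. Qed.

Lemma passageN r v : (r <= 0)%R -> passage r v = 0.
Proof.
by move=> r0; apply: integral0_eq => w _; rewrite ltailN// subr_le0 (le_trans r0).
Qed.

Lemma measurable_passage : measurable_fun setT (fun z => passage z.1 z.2).
Proof.
apply: (measurable_integral1 P measurableT
  (fun (z : R * R) w => ltail (z.1 - X z.2 w))).
  by meas.
by move=> z w; exact: ltail_ge0.
Qed.

Let mpass := measurable_passage.

Lemma laplace_passage s v : (0 < s)%R -> (0 <= v)%R ->
  \int[mu]_r ((expR (- (s * r)))%:E * passage r v) = (expR (- (v * f s)) * (f s / s))%:E.
Proof.
move=> s0 v0.
transitivity (\int[mu]_r \int[P]_w ((expR (- (s * r)))%:E * ltail (r - X v w))).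
  by apply: eq_integral => r _; rewrite integralZ; [|by []|nng|meas|move=> w; exact: ltail_ge0].
etransitivity; first by apply: tonelli; [by []|by []|meas|move=> r w; nng].
under eq_integral do rewrite laplace_shift_ltail// mulrC EFinM.
rewrite integralZ; [|by []|by nng; rewrite levy_exponent_ge0// ltW|by meas|by move=> w; nng].
by rewrite XL ?(ltW s0)// EFinM muleC.
Qed.

Let f0 s : (0 <= s)%R -> (0 <= f s)%R := @levy_exponent_ge0 s.
Let pass0 := passage_ge0.

Lemma measurable_passage_integral (w : R -> \bar R) (x : R) :
  measurable_fun setT w -> (forall v, 0 <= w v) ->
  measurable_fun setT (fun r => \int[mu]_(v in `]0%R, x[) (w v * passage r v)).
Proof.
move=> mw w0; apply: (measurable_integral1 mu (measurable_itv _) (fun r v => w v * passage r v)).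
  by meas.
by move=> r v; nng.
Qed.

Let laplace_weighted_passage (w : R -> \bar R) (x s : R) : (0 < s)%R ->
  measurable_fun setT w -> (forall v, 0 <= w v) ->
  \int[mu]_r ((expR (- (s * r)))%:E * \int[mu]_(v in `]0%R, x[) (w v * passage r v)) =
  (f s / s)%:E * \int[mu]_(v in `]0%R, x[) (w v * (expR (- (f s * v)))%:E).
Proof.
move=> s0 mw w0.
have fs0 : (0 <= f s / s)%R by rewrite divr_ge0 ?f0 ?ltW.
transitivity (\int[mu]_r \int[mu]_(v in `]0%R, x[)
    ((expR (- (s * r)))%:E * (w v * passage r v))).
  by apply: eq_integral => r _; rewrite [RHS]integralZ; [|exact: measurable_itv|nng|meas|move=> v; nng].
etransitivity; first by apply: tonelli; [by []|exact: measurable_itv|meas|move=> r v; nng].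
rewrite -integralZ; [|exact: measurable_itv|by []|meas|move=> v; nng].
apply: eq_integral => v; rewrite inE/= in_itv/= => /andP[v0 _].
under eq_integral do rewrite muleCA.
rewrite ge0_integralZl//; [|by meas|by move=> r _; nng].
by rewrite laplace_passage ?(ltW v0)// [(v * _)%R]mulrC EFinM muleA muleC.
Qed.

Let survival_laplace s v : (0 < s)%R -> (0 <= v)%R ->
  \int[mu]_r ((expR (- (s * r)))%:E * (ind (0 <= r)%R * \int[P]_w ind (r < X v w)%R)) =
  ((1 - expR (- (f s * v))) / s)%:E.
Proof.
move=> s0 v0.
transitivity (\int[mu]_r \int[P]_w (ind (0 <= r < X v w)%R * (expR (- (s * r)))%:E)).
  apply: eq_integral => r _; rewrite muleA -ge0_integralZl//; [|by meas|by move=> w _; nng|by nng].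
  by apply: eq_integral => w _; rewrite ind_and muleC [(expR _)%:E * _]muleC muleA [ind _ * ind _]muleC.
etransitivity; first by apply: tonelli; [by []|by []|meas|move=> r w; nng].
transitivity (\int[P]_w ((s^-1)%:E * (1 - expR (- (s * X v w)))%:E)).
  apply: eq_integral => w _; rewrite integral_ind_itv.
  rewrite (_ : [set r | (0 <= r < X v w)%R] = `[0%R, X v w[%classic)//.
  rewrite integral_itv_bndoo; last by apply: measurable_funTS; meas.
  by rewrite integral_expR// EFinM muleC.
rewrite integralZ; [|by []|by nng|by meas|]; last first.
  by move=> w; rewrite lee_fin subr_ge0 -expR0 ler_expR oppr_le0 mulr_ge0// ltW.
rewrite muleC EFinM; congr (_ * _).
suff : \int[P]_w (1 - expR (- (s * X v w)))%:E + (expR (- (v * f s)))%:E = 1.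
  move=> h; have : \int[P]_w (1 - expR (- (s * X v w)))%:E = 1 - (expR (- (v * f s)))%:E.
    by rewrite -h addeK.
  by rewrite [(v * _)%R]mulrC.
rewrite -XL ?(ltW s0)// -integral_addition; [|by []|by meas| |by meas|by move=> w; nng].
  under eq_integral do rewrite -EFinD subrK.
  by rewrite integral_cst// mul1e; exact: probability_setT.
by move=> w; rewrite lee_fin subr_ge0 -expR0 ler_expR oppr_le0 mulr_ge0// ltW.
Qed.

Let cdf_laplace s v : (0 < s)%R -> (0 <= v)%R ->
  \int[mu]_r ((expR (- (s * r)))%:E * \int[P]_w ind (X v w <= r)%R) =
  (expR (- (f s * v)) / s)%:E.
Proof.
move=> s0 v0.
transitivity (\int[mu]_r \int[P]_w ((expR (- (s * r)))%:E * ind (X v w <= r)%R)).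
  by apply: eq_integral => r _; rewrite integralZ; [|by []|nng|meas|move=> w; nng].
etransitivity; first by apply: tonelli; [by []|by []|meas|move=> r w; nng].
transitivity (\int[P]_w ((s^-1)%:E * (expR (- (s * X v w)))%:E)).
  apply: eq_integral => w _.
  transitivity (\int[mu]_r ((expR (- (s * X v w)))%:E *
      (ind (0 <= r - X v w)%R * (expR (- (s * (r - X v w))))%:E))).
    apply: eq_integral => r _; rewrite subr_ge0 muleC [RHS]muleCA -EFinM -expRD.
    by congr (_ * (expR _)%:E); ring.
  rewrite integralZ; [|by []|by nng|by meas|by move=> r; nng].
  rewrite (integral_shift _ (phi := fun r => ind (0 <= r)%R * (expR (- (s * r)))%:E)); [|meas|move=> r; nng].
  rewrite integral_ind_itv (_ : [set r | (0 <= r)%R] = `[0%R, +oo[%classic).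
    by rewrite integral_expRy// muleC.
  by apply/seteqP; split => r; rewrite /= in_itv/= andbT.
rewrite integralZ; [|by []|by nng|by meas|by move=> w; nng].
by rewrite XL ?(ltW s0)// muleC EFinM [(v * _)%R]mulrC.
Qed.

(** Both sides have the Laplace transform (1 - e^(- x f s)) / s. This is the law of the first
    passage, but only at almost every level r. *)
Lemma passage_survival (x : R) (psi : R -> \bar R) : (0 < x)%R ->
  measurable_fun setT psi -> (forall r, 0 <= psi r) ->
  \int[mu]_r (psi r * \int[mu]_(v in `]0%R, x[) passage r v) =
  \int[mu]_r (psi r * (ind (0 <= r)%R * \int[P]_w ind (r < X x w)%R)).
Proof.
move=> x0 mpsi psi0.
pose F r := \int[mu]_(v in `]0%R, x[) (1 * passage r v).
have -> : \int[mu]_r (psi r * \int[mu]_(v in `]0%R, x[) passage r v) = \int[mu]_r (psi r * F r).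
  by apply: eq_integral => r _; congr *%E; apply: eq_integral => v _; rewrite mul1e.
have mF : measurable_fun setT F by exact: (@measurable_passage_integral (cst 1)).
have mG : measurable_fun setT (fun r : R => \int[P]_w ind (r < X x w)%R : \bar R).
  by apply: (measurable_integral1 P measurableT (fun (r : R) w => ind (r < X x w)%R)); [meas|move=> r w; nng].
have L s : (0 < s)%R -> \int[mu]_r ((expR (- (s * r)))%:E * F r) = ((1 - expR (- (f s * x))) / s)%:E.
  move=> s0; rewrite (@laplace_weighted_passage (cst 1))//.
  under eq_integral do rewrite mul1e.
  rewrite integral_expR ?levy_exponent_gt0 ?(ltW x0)// -EFinM; congr EFin.
  by field; rewrite !gt_eqF ?levy_exponent_gt0.
apply: laplace_unique_line => //.
- by meas.
- by move=> r; rewrite /F; nng.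
- by move=> r; nng.
- by move=> r r0; apply: integral0_eq => v _; rewrite passageN ?mule0// ltW.
- by move=> r r0; rewrite leNgt r0 mul0e.
- by move=> s s0; rewrite L// ltry.
- by move=> s s0; rewrite L// survival_laplace// ltW.
Qed.

(** Both sides have the Laplace transform (1 - e^(- x f s)) / (s f s); on the left, the boundary
    term of the integration by parts in v cancels against the second summand. *)
Lemma weighted_passage_cdf (x : R) (psi : R -> \bar R) : (0 < x)%R ->
  measurable_fun setT psi -> (forall r, 0 <= psi r) ->
  \int[mu]_r (psi r * (\int[mu]_(v in `]0%R, x[) (v%:E * passage r v) + x%:E * \int[P]_w ind (X x w <= r)%R)) =
  \int[mu]_r (psi r * \int[mu]_(v in `]0%R, x[) \int[P]_w ind (X v w <= r)%R).
Proof.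
move=> x0 mpsi psi0.
pose wt v := (Num.max v 0)%:E : \bar R.
have mwt : measurable_fun setT wt by rewrite /wt; meas.
have wt0 v : 0 <= wt v by rewrite lee_fin le_max lexx orbT.
have wtE v : v \in `]0%R, x[%classic -> v%:E = wt v.
  by rewrite inE/= in_itv/= => /andP[v0 _]; rewrite /wt max_l// ltW.
pose V r := \int[mu]_(v in `]0%R, x[) (wt v * passage r v).
have VE r : \int[mu]_(v in `]0%R, x[) (v%:E * passage r v) = V r.
  by apply: eq_integral => v xv; rewrite (wtE v).
under eq_integral do rewrite VE.
have mV : measurable_fun setT V by exact: measurable_passage_integral.
have V0 r : 0 <= V r by rewrite /V; nng.
pose H v r := \int[P]_w ind (X v w <= r)%R : \bar R.
have mH : measurable_fun setT (fun z => H z.1 z.2).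
  by apply: (measurable_integral1 P measurableT (fun (z : R * R) w => ind (X z.1 w <= z.2)%R)); [meas|move=> z w; nng].
have H0 v r : 0 <= H v r by rewrite /H; nng.
pose W r := \int[mu]_(v in `]0%R, x[) H v r.
have mW : measurable_fun setT W.
  by apply: (measurable_integral1 mu (measurable_itv _) (fun (r : R) v => H v r)); [meas|move=> z w; nng].
have LW s : (0 < s)%R -> \int[mu]_r ((expR (- (s * r)))%:E * W r) =
    ((1 - expR (- (f s * x))) / f s / s)%:E.
  move=> s0.
  transitivity (\int[mu]_r \int[mu]_(v in `]0%R, x[) ((expR (- (s * r)))%:E * H v r)).
    by apply: eq_integral => r _; rewrite [RHS]integralZ; [|exact: measurable_itv|nng|meas|move=> v; nng].
  etransitivity; first by apply: tonelli; [by []|exact: measurable_itv|meas|move=> r v; nng].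
  transitivity (\int[mu]_(v in `]0%R, x[) ((s^-1)%:E * (expR (- (f s * v)))%:E)).
    apply: eq_integral => v; rewrite inE/= in_itv/= => /andP[v0 _].
    by rewrite cdf_laplace// ?ltW// EFinM muleC.
  rewrite integralZ; [|exact: measurable_itv|by nng|by meas|by move=> v; nng].
  by rewrite integral_expR ?levy_exponent_gt0 ?(ltW x0)// -EFinM mulrC.
have mHx : measurable_fun setT (H x).
  exact: (comp2_measurable mH (@measurable_cst _ _ _ _ setT x) (@measurable_id _ _ setT)).
have LVH s : (0 < s)%R -> \int[mu]_r ((expR (- (s * r)))%:E * (V r + x%:E * H x r)) =
    ((1 - expR (- (f s * x))) / f s / s)%:E.
  move=> s0.
  transitivity (\int[mu]_r ((expR (- (s * r)))%:E * V r + x%:E * ((expR (- (s * r)))%:E * H x r))).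
    apply: eq_integral => r _; rewrite ge0_muleDr; [|by nng|by nng].
    by congr (_ + _); rewrite muleCA.
  rewrite integral_addition; [|by []|by meas|by move=> r; nng|by meas|by move=> r; nng].
  rewrite laplace_weighted_passage// integralZ; [|by []|by nng|by meas|by move=> r; nng].
  rewrite cdf_laplace ?(ltW x0)//.
  transitivity ((f s / s)%:E * ((1 - expR (- (f s * x))) / f s ^+ 2 - x * expR (- (f s * x)) / f s)%:E +
                x%:E * (expR (- (f s * x)) / s)%:E).
    congr (_ * _ + _); rewrite -integral_mul_expR ?levy_exponent_gt0 ?(ltW x0)//.
    by apply: eq_integral => v xv; rewrite -(wtE v xv).
  rewrite -!EFinM -EFinD; congr EFin.
  by field; rewrite !gt_eqF ?levy_exponent_gt0.
apply: laplace_unique_line => //.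
- by apply: emeasurable_funD => //; apply: emeasurable_funM => //; exact: measurable_cst.
- by move=> r; nng.
- by move=> r; rewrite /W; nng.
- move=> r r0; rewrite /V integral0_eq ?add0e => [|v _]; last by rewrite passageN ?mule0// ltW.
  by rewrite integral0_eq ?mule0// => w _; rewrite leNgt (lt_le_trans r0).
- move=> r r0; apply: integral0_eq => v _; apply: integral0_eq => w _.
  by rewrite leNgt (lt_le_trans r0).
- by move=> s s0; rewrite LVH// ltry.
- by move=> s s0; rewrite LW// LVH.
Qed.

(** The derivative of f at s. *)
Let jump s := \int[mu]_c ((c * expR (- (s * c)))%:E * n c).

Let jump_integrand_ge0 s c : 0 <= (c * expR (- (s * c)))%:E * n c.
Proof.
have [c0|c0] := leP c 0%R; first by rewrite nN// mule0.
by nng.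
Qed.

Let mjump (s : R) : measurable_fun setT (fun c : R => (c * expR (- (s * c)))%:E * n c).
Proof. by meas. Qed.

Let jump_lty s : (0 < s)%R -> jump s < +oo.
Proof.
move=> s0; apply: (@le_lt_trans _ _ ((s^-1)%:E * (f s)%:E)); last by rewrite -EFinM ltry.
rewrite Hf ?(ltW s0)// -integralZ; [|by []|by nng|by meas|by move=> c; rewrite prod_ge0// ltW].
apply: ge0_le_integral; [by []|by move=> c _; exact: jump_integrand_ge0|exact: mjump|by meas|].
move=> c _; have [c0|c0] := leP c 0%R; first by rewrite nN// !mule0.
rewrite muleA; apply: lee_wpmul2r => //; rewrite -EFinM lee_fin.
have k0 : (0 < s^-1)%R by rewrite invr_gt0.
have := @difference_quotient_bounds R c s^-1%R (ltW c0) k0.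
by rewrite invrK [(c * s)%R]mulrC => /andP[].
Qed.

Let jump_integrable (s : R) : (0 < s)%R -> mu.-integrable setT (fun c : R => (c * expR (- (s * c)))%:E * n c).
Proof.
move=> s0; apply/integrableP; split; first exact: mjump.
have -> : \int[mu]_c `|(c * expR (- (s * c)))%:E * n c| = jump s.
  by apply: eq_integral => c _; rewrite gee0_abs.
exact: jump_lty.
Qed.

Let exponent_quotient s m : (0 <= s)%R ->
  (m.+1%:R * (f (s + m.+1%:R^-1) - f s))%:E =
  \int[mu]_c ((m.+1%:R * (1 - expR (- (c / m.+1%:R))) * expR (- (s * c)))%:E * n c).
Proof.
move=> s0; set k := m.+1%:R.
have k0 : (0 < k^-1 :> R)%R by rewrite invr_gt0.
have q0 c : 0 <= ((1 - expR (- (k^-1 * c))) * expR (- (s * c)))%:E * n c.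
  by rewrite EFinM -muleA muleCA; apply: mule_ge0; [nng|apply: prod_ge0; exact: ltW].
have E : (f (s + k^-1))%:E = (f s)%:E + \int[mu]_c (((1 - expR (- (k^-1 * c))) * expR (- (s * c)))%:E * n c).
  rewrite !Hf ?addr_ge0 ?(ltW k0)//.
  rewrite -integral_addition; [|by []|by meas|by move=> c; exact: prod_ge0|by meas|by []].
  apply: eq_integral => c _; have [c0|c0] := leP c 0%R; first by rewrite nN// !mule0 adde0.
  rewrite -ge0_muleDl; last 2 first.
    by rewrite lee_fin subr_ge0 -expR0 ler_expR oppr_le0 mulr_ge0// ltW.
    by rewrite lee_fin mulr_ge0 ?expR_ge0// subr_ge0 -expR0 ler_expR oppr_le0 mulr_ge0// ltW.
  rewrite -EFinD; congr (_%:E * _).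
  have -> : (- ((s + k^-1) * c) = - (s * c) + - (k^-1 * c))%R by ring.
  by rewrite expRD; ring.
rewrite EFinM EFinB E addeAC subee// add0e.
rewrite -integralZ; [|by []|by []|by meas|by []].
apply: eq_integral => c _; rewrite muleA -EFinM; congr (_%:E * _).
by rewrite [(c / k)%R]mulrC mulrA.
Qed.

Let exponent_quotient_cvg s : (0 < s)%R ->
  (m.+1%:R * (f (s + m.+1%:R^-1) - f s))%:E @[m --> \oo] --> jump s.
Proof.
move=> s0; under eq_fun do rewrite exponent_quotient ?(ltW s0)//.
have finae := integrable_ae measurableT (jump_integrable s0).
have aeF := ae_filter_ringOfSetsType (@lebesgue_measure R).
have [] := @dominated_convergence _ _ R mu setT measurableT
  (fun m c => (m.+1%:R * (1 - expR (- (c / m.+1%:R))) * expR (- (s * c)))%:E * n c)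
  (fun c => (c * expR (- (s * c)))%:E * n c) (fun c => (c * expR (- (s * c)))%:E * n c) => //.
- by move=> m; meas.
- exact: mjump.
- move: finae; apply: filterS => c /(_ I) cfin _.
  have [c0|c0] := leP c 0%R; first by rewrite nN// !mule0; under eq_fun do rewrite mule0; exact: cvg_cst.
  have nfin : n c \is a fin_num.
    move: cfin; rewrite !ge0_fin_numE// => cfin; rewrite ltey; apply/negP => /eqP nc.
    by move: cfin; rewrite nc gt0_muley// lte_fin mulr_gt0// expR_gt0.
  apply: cvgeZr => //; apply/cvg_EFin; first exact: nearW.
  apply: cvgMl; apply: (@cvg_difference_quotient _ (fun=> c)); last exact: cvg_cst.
  by move=> _; exact: ltW.
- exact: jump_integrable.
- apply: aeW => c m _; have [c0|c0] := leP c 0%R; first by rewrite nN// !mule0 abse0.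
  have /andP[d1 d2] := @difference_quotient_bounds R c m.+1%:R (ltW c0) (ltr0Sn _ _).
  have e0 : (0 <= m.+1%:R * (1 - expR (- (c / m.+1%:R))))%R.
    by apply: le_trans d1; rewrite mulr_ge0 ?expR_ge0// ltW.
  rewrite gee0_abs; last by rewrite mule_ge0// lee_fin mulr_ge0 ?expR_ge0.
  by apply: lee_wpmul2r => //; rewrite lee_fin ler_wpM2r// expR_ge0.
Qed.

(** Dominated convergence: y e^(- s y) is bounded. *)
Let mean_quotient_cvg s v : (0 < s)%R -> (0 <= v)%R ->
  (m.+1%:R * (expR (- (v * f s)) - expR (- (v * f (s + m.+1%:R^-1)))))%:E @[m --> \oo] -->
  \int[P]_w (X v w * expR (- (s * X v w)))%:E.
Proof.
move=> s0 v0.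
have intX : P.-integrable setT (fun w => (X v w * expR (- (s * X v w)))%:E).
  apply: (@measurable_bounded_integrable _ _ _ P).
  - exact: measurableT.
  - by apply: (le_lt_trans (probability_le1 P measurableT)); rewrite ltry.
  - by meas.
  - exists s^-1%R; split=> [|M sM w _]; first exact: num_real.
    rewrite /= ger0_norm; last by nng.
    have k0 : (0 < s^-1)%R by rewrite invr_gt0.
    have := @difference_quotient_bounds R (X v w) s^-1%R (X0 v w) k0.
    rewrite invrK [(X v w * s)%R]mulrC => /andP[+ _] => /le_trans; apply.
    by rewrite (le_trans _ (ltW sM))// ler_piMr ?(ltW k0)// lerBlDr lerDl expR_ge0.
have E m : (m.+1%:R * (expR (- (v * f s)) - expR (- (v * f (s + m.+1%:R^-1)))))%:E =
    \int[P]_w (m.+1%:R * (1 - expR (- (X v w / m.+1%:R))) * expR (- (s * X v w)))%:E.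
  set k := m.+1%:R; have k0 : (0 < k^-1 :> R)%R by rewrite invr_gt0.
  have q0 w : (0 <= (1 - expR (- (k^-1 * X v w))) * expR (- (s * X v w)))%R.
    by rewrite mulr_ge0 ?expR_ge0// subr_ge0 -expR0 ler_expR oppr_le0 mulr_ge0// ltW.
  have H : (expR (- (v * f s)))%:E = (expR (- (v * f (s + k^-1))))%:E +
      \int[P]_w ((1 - expR (- (k^-1 * X v w))) * expR (- (s * X v w)))%:E.
    rewrite -(XL v0 (ltW s0)) -(XL v0 (addr_ge0 (ltW s0) (ltW k0))).
    rewrite -integral_addition; [|by []|by meas|by move=> w; nng|by meas|by move=> w; rewrite lee_fin].
    apply: eq_integral => w _; rewrite -EFinD; congr EFin.
    have -> : (- ((s + k^-1) * X v w) = - (s * X v w) + - (k^-1 * X v w))%R by ring.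
    by rewrite expRD; ring.
  rewrite EFinM EFinB H addeAC subee// add0e.
  rewrite -integralZ; [|by []|by []|by meas|by move=> w; rewrite lee_fin].
  by apply: eq_integral => w _; rewrite -EFinM [(X v w / k)%R]mulrC mulrA.
under eq_fun do rewrite E.
have [] := @dominated_convergence _ _ R P setT measurableT
  (fun m w => (m.+1%:R * (1 - expR (- (X v w / m.+1%:R))) * expR (- (s * X v w)))%:E)
  (fun w => (X v w * expR (- (s * X v w)))%:E) (fun w => (X v w * expR (- (s * X v w)))%:E) => //.
- by move=> m; meas.
- by meas.
- apply: aeW => w _; apply/cvg_EFin; first exact: nearW.
  apply: cvgMl; apply: (@cvg_difference_quotient _ (fun=> X v w)) => //.
  exact: cvg_cst.
- apply: aeW => w m _; rewrite lee_fin.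
  have /andP[d1 d2] := @difference_quotient_bounds R (X v w) m.+1%:R (X0 v w) (ltr0Sn _ _).
  have e0 : (0 <= m.+1%:R * (1 - expR (- (X v w / m.+1%:R))))%R.
    by apply: le_trans d1; nng.
  rewrite ger0_norm; last by rewrite mulr_ge0 ?expR_ge0.
  by apply: ler_wpM2r; rewrite ?expR_ge0.
Qed.

(** Both sides are minus the derivative at s of E e^(- s X v) = e^(- v f s), under the
    expectation on the left and by the chain rule on the right. *)
Let laplace_mean s v : (0 < s)%R -> (0 <= v)%R ->
  \int[P]_w (X v w * expR (- (s * X v w)))%:E = (v * expR (- (v * f s)))%:E * jump s.
Proof.
move=> s0 v0.
have jfin : jump s \is a fin_num.
  by rewrite ge0_fin_numE ?jump_lty//; apply: integral_ge0 => c _; exact: jump_integrand_ge0.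
pose u m : R := (m.+1%:R * (f (s + m.+1%:R^-1) - f s))%R.
have ul : u m @[m --> \oo] --> fine (jump s).
  by have := exponent_quotient_cvg s0; rewrite -(fineK jfin) => /fine_cvg.
have u0 m : (0 <= u m)%R.
  rewrite -lee_fin /u exponent_quotient ?(ltW s0)//; apply: integral_ge0 => c _.
  have [c0|c0] := leP c 0%R; first by rewrite nN// mule0.
  rewrite mule_ge0// lee_fin mulr_ge0 ?expR_ge0// mulr_ge0// subr_ge0 -expR0 ler_expR oppr_le0.
  by rewrite divr_ge0// ltW.
have := mean_quotient_cvg s0 v0 => /cvg_lim <-//.
rewrite -[jump s]fineK// -EFinM; apply/cvg_lim => //; apply/cvg_EFin; first exact: nearW.
have -> : (v * expR (- (v * f s)) * fine (jump s) = expR (- (v * f s)) * (v * fine (jump s)))%R by ring.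
have E m : (m.+1%:R * (expR (- (v * f s)) - expR (- (v * f (s + m.+1%:R^-1)))) =
    expR (- (v * f s)) * (m.+1%:R * (1 - expR (- ((v * u m) / m.+1%:R)))))%R.
  have -> : (- (v * f (s + m.+1%:R^-1)) = - (v * f s) + - (v * u m / m.+1%:R))%R.
    rewrite /u; field; exact: lt0r_neq0.
  by rewrite expRD; ring.
under eq_fun do rewrite /= E.
apply: cvgMr; apply: (@cvg_difference_quotient _ (fun m => v * u m)%R).
  by move=> m; rewrite mulr_ge0.
exact: cvgMr.
Qed.

(** Steutel's characterisation of infinitely divisible laws: weighting the law of X v by its
    value amounts to adding to X v an independent jump c drawn from the measure v c n c dc.
    By laplace_mean both sides have the same Laplace transform. *)
Lemma steutel (v : R) (psi : R -> \bar R) : (0 <= v)%R ->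
  measurable_fun setT psi -> (forall r, 0 <= psi r) ->
  \int[P]_w (psi (X v w) * (X v w)%:E) =
  \int[mu]_c (v%:E * (c%:E * n c) * \int[P]_w psi (c + X v w)%R).
Proof.
move=> v0 mpsi psi0.
pose a2 (z : R * T) : \bar R := v%:E * (z.1%:E * n z.1).
pose Z2 (z : R * T) : R := (Num.max z.1 0 + X v z.2)%R.
have a20 z : 0 <= a2 z.
  rewrite /a2; have [z0|z0] := leP z.1 0%R; first by rewrite nN// !mule0.
  by nng.
have ma2 : measurable_fun setT a2 by rewrite /a2; meas.
have mZ2 : measurable_fun setT Z2 by rewrite /Z2; meas.
have Z20 z : (0 <= Z2 z)%R by rewrite addr_ge0// le_max lexx orbT.
have E phi : measurable_fun setT phi -> (forall r, 0 <= phi r) ->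
    \int[mu \x P]_z (phi (Z2 z) * a2 z) =
    \int[mu]_c (v%:E * (c%:E * n c) * \int[P]_w phi (c + X v w)%R).
  move=> mphi phi0.
  rewrite fubini_tonelli1; last 2 first.
  - by meas.
  - by move=> z; rewrite mule_ge0.
  apply: eq_integral => c _; rewrite /fubini_F /=.
  have [c0|c0] := leP c 0%R.
    by rewrite nN// !mule0 mul0e; apply: integral0_eq => w _; rewrite /a2/= nN// !mule0.
  have a0 : 0 <= v%:E * (c%:E * n c) by rewrite mule_ge0// mule_ge0// lee_fin ltW.
  rewrite -ge0_integralZl//; last by meas.
  by apply: eq_integral => w _; rewrite /Z2 /a2 /= muleC max_l// ltW.
have mexp (s : R) : measurable_fun setT (fun r : R => (expR (- (s * r)))%:E) by meas.
have exp0 (s r : R) : 0 <= (expR (- (s * r)))%:E by nng.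
rewrite -(E psi)//; apply: laplace_unique => //.
- by meas.
- by move=> w; nng.
- move=> s s0; under eq_integral do rewrite -EFinM mulrC.
  by rewrite laplace_mean// lte_mul_pinfty ?jump_lty// lee_fin mulr_ge0 ?expR_ge0.
- move=> s s0; rewrite (E (fun r => (expR (- (s * r)))%:E))//.
  under eq_integral do rewrite -EFinM mulrC.
  rewrite laplace_mean//.
  rewrite -integralZ; [|by []|by rewrite mulr_ge0 ?expR_ge0|exact: mjump|exact: jump_integrand_ge0].
  apply: eq_integral => c _.
  transitivity (v%:E * (c%:E * n c) * ((expR (- (s * c)))%:E * (expR (- (v * f s)))%:E)).
    rewrite [LHS]muleA -EFinM [v%:E * (_ * _)]muleA -EFinM [RHS]muleAC -!EFinM.
    by congr (_%:E * _); ring.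
  congr (_ * _); rewrite -(XL v0 (ltW s0)) -[LHS]integralZ; [|by []|by nng|by meas|by move=> w; nng].
  by apply: eq_integral => w _; rewrite -EFinM -expRD; congr (expR _)%:E; ring.
Qed.

(** By monotone convergence f tends to the total mass of the Levy measure, which is infinite. *)
Let exponent_unbounded (C : R) : exists j : nat, (C < f j%:R)%R.
Proof.
apply: contrapT => /forallNP fC.
pose g (j : nat) c := (1 - expR (- (j%:R * c)))%:E * n c.
have mg j : measurable_fun setT (g j) by rewrite /g; meas.
have g0 j c : 0 <= g j c by exact: prod_ge0.
have cvg_g c : g j c @[j --> \oo] --> n c.
  rewrite /g; have [c0|c0] := leP c 0%R.
    by rewrite nN//; under eq_fun do rewrite mule0; exact: cvg_cst.
  have E : (1 - expR (- (j%:R * c)))%R @[j --> \oo] --> (1%R : R).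
    rewrite -[X in _ --> X]subr0; apply: cvgB; first exact: cvg_cst.
    apply: (@cvg_comp _ _ _ (fun j : nat => j%:R : R) (fun z => expR (- (z * c))) _ (pinfty_nbhs R)); first exact: cvgr_idn.
    apply: (@cvg_comp _ _ _ (fun z => (z * c)%R) (fun z => expR (- z)) _ (pinfty_nbhs R)); last exact: cvgr_expR.
    by apply: gt0_cvgMly => //; exact: cvg_id.
  rewrite -[X in _ --> X]mul1e.
  have [nfin|] := boolP (n c \is a fin_num); first by apply: cvgeZr => //; apply/cvg_EFin => //; exact: nearW.
  rewrite ge0_fin_numE// -leNgt leye_eq => /eqP ->; rewrite mul1e.
  apply: cvg_near_cst; exists 1%N => // j /= j1; rewrite gt0_muley// lte_fin subr_gt0.
  by rewrite expR_lt1 oppr_lt0 mulr_gt0// ltr0n.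
have nd c : {homo g^~ c : i j / (i <= j)%N >-> i <= j}.
  move=> i j ij; rewrite /g; have [c0|c0] := leP c 0%R; first by rewrite nN// !mule0.
  apply: lee_wpmul2r => //; rewrite lee_fin lerD2l lerN2 ler_expR lerN2.
  by rewrite ler_wpM2r ?(ltW c0)// ler_nat.
have := @cvg_monotone_convergence _ _ R mu setT measurableT g mg (fun j c _ => g0 j c) (fun c _ => nd c).
have -> : \int[mu]_x limn (g^~ x) = \int[mu]_x n x.
  by apply: eq_integral => c _; apply/cvg_lim => //; exact: cvg_g.
rewrite Hinf => H.
have : +oo <= C%:E.
  rewrite -(cvg_lim _ H)//; apply: lime_le; first by apply/cvg_ex; exists +oo.
  by apply: nearW => j; rewrite -Hf// lee_fin leNgt; apply/negP/fC.
by rewrite leye_eq.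
Qed.

(** P(X v = 0) <= E e^(- s X v) = e^(- v f s) for every s, and f is unbounded. *)
Let law_atom0 v : (0 < v)%R -> P [set w | X v w = 0%R] = 0.
Proof.
move=> v0; have mE : measurable [set w | X v w = 0%R].
  by rewrite -[X in measurable X]setTI; exact: (mXv v measurableT (measurable_set1 0%R)).
have le_exp (j : nat) : P [set w | X v w = 0%R] <= (expR (- (v * f j%:R)))%:E.
  rewrite -XL ?(ltW v0)// -[X in P X]setIT -integral_indic//.
  apply: ge0_le_integral; [by []|by move=> w _; rewrite lee_fin|by apply/measurable_EFinP|by meas|].
  move=> w _; rewrite lee_fin indicE; case: (boolP (w \in _)) => [|_]; last exact: expR_ge0.
  by rewrite inE /= => ->; rewrite mulr0 oppr0 expR0.
have Pfin : P [set w | X v w = 0%R] \is a fin_num by rewrite fin_num_measure.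
rewrite -(fineK Pfin) in le_exp *; set p := fine _ in le_exp *.
apply/eqP; rewrite eqe; apply: contrapT => /negP p0.
have {}p0 : (0 < p)%R by rewrite lt0r p0 fine_ge0.
have [j fj] := exponent_unbounded (v^-1 / p).
have := le_exp j; rewrite lee_fin leNgt => /negP; apply.
have u0 : (p^-1 < v * f j%:R)%R by rewrite -ltr_pdivrMl.
rewrite expRN invf_plt ?posrE ?expR_gt0// (lt_le_trans u0)// (le_trans _ (expR_ge1Dx _))//.
by rewrite lerDr.
Qed.

(** The weighted law of steutel has the density v E[(y - X v) n (y - X v)], which has to be
    divided by y; as the law of X v has no atom at 0, this describes it completely. The
    inverse is a power so that it is measurable without a case on y, and the arguments are
    clamped at 0 so that the function is nonnegative. *)
Definition law_density (v y : R) : \bar R :=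
  (powR (Num.max y 0) (-1)%R)%:E *
  ((Num.max v 0)%:E * \int[P]_w ((y - X v w)%:E * n (y - X v w))).

Let weight_ge0 c : 0 <= c%:E * n c.
Proof.
have [c0|c0] := leP c 0%R; first by rewrite nN// mule0.
by rewrite mule_ge0// lee_fin ltW.
Qed.

Let max0 v : 0 <= (Num.max v 0)%:E :> \bar R.
Proof. by rewrite lee_fin le_max lexx orbT. Qed.

Let pow0 y : 0 <= (powR (Num.max y 0) (-1)%R)%:E :> \bar R.
Proof. by rewrite lee_fin powR_ge0. Qed.

Let mpow : measurable_fun setT (fun y : R => (powR (Num.max y 0) (-1)%R)%:E).
Proof.
have mm : measurable_fun setT (fun y : R => Num.max y 0%R) by meas.
apply/measurable_EFinP; apply: (@measurableT_comp _ _ _ _ _ _ (fun x : R => powR x (-1)%R) _ (fun y : R => Num.max y 0%R)) => //.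
Qed.

Let mweight : measurable_fun setT (fun z : R * R => \int[P]_w ((z.2 - X z.1 w)%:E * n (z.2 - X z.1 w))).
Proof.
by apply: (measurable_integral1 P measurableT (fun (z : R * R) w => (z.2 - X z.1 w)%:E * n (z.2 - X z.1 w))); [meas|move=> z w].
Qed.

Lemma law_density_ge0 v y : 0 <= law_density v y.
Proof. by rewrite !mule_ge0//; apply: integral_ge0. Qed.

Lemma law_densityN v y : (y <= 0)%R -> law_density v y = 0.
Proof.
move=> y0; rewrite /law_density [X in _ * (_ * X)]integral0_eq ?mule0// => w _.
by rewrite nN ?mule0// subr_le0 (le_trans y0).
Qed.

Lemma measurable_law_density : measurable_fun setT (fun z => law_density z.1 z.2).
Proof.
apply: emeasurable_funM; first by apply: (comp_measurable mpow); exact: measurable_snd.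
by apply: emeasurable_funM => //; meas.
Qed.

(** steutel applied to psi y / y, and the change of variable y = c + X v. *)
Lemma law_densityE (v : R) (psi : R -> \bar R) : (0 < v)%R ->
  measurable_fun setT psi -> (forall r, 0 <= psi r) ->
  \int[P]_w psi (X v w) = \int[mu]_y (psi y * law_density v y).
Proof.
move=> v0 mpsi psi0.
have aeF := ae_filter_ringOfSetsType P.
have H2 : {ae P, forall w, X v w != 0%R}.
  exists [set w | X v w = 0%R]; split; [|exact: law_atom0|by move=> w /= /negP/negPn/eqP].
  by rewrite -[X in measurable X]setTI; exact: (mXv v measurableT (measurable_set1 0%R)).
pose phi y := psi y * (powR (Num.max y 0) (-1)%R)%:E.
have mphi : measurable_fun setT phi by apply: emeasurable_funM => //; exact: mpow.
have phi0 y : 0 <= phi y by exact: mule_ge0.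
transitivity (\int[P]_w (phi (X v w) * (X v w)%:E)).
  apply: ge0_ae_eq_integral => //; [by meas|by meas|by move=> w _; rewrite mule_ge0// lee_fin|].
  move: H2; apply: filterS => w Xw _; rewrite /phi max_l// powR_inv1// -muleA -EFinM.
  by rewrite mulVf// mule1.
rewrite steutel ?(ltW v0)//.
have a0 c : 0 <= v%:E * (c%:E * n c) by rewrite mule_ge0 ?lee_fin ?(ltW v0).
have ma : measurable_fun setT (fun c : R => v%:E * (c%:E * n c)) by meas.
transitivity (\int[mu]_c \int[P]_w (v%:E * (c%:E * n c) * phi (c + X v w)%R)).
  by apply: eq_integral => c _; rewrite [RHS]integralZe; [by []|by []|by []|by meas|by []].
etransitivity; first by apply: tonelli; [by []|by []|meas|move=> c w; rewrite mule_ge0].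
transitivity (\int[P]_w \int[mu]_y (v%:E * ((y - X v w)%:E * n (y - X v w)) * phi y)).
  apply: eq_integral => w _.
  rewrite -(@integral_shift _ (X v w) (fun c => v%:E * (c%:E * n c) * phi (c + X v w)%R)); [|by meas|by move=> c; rewrite mule_ge0].
  by apply: eq_integral => y _; rewrite subrK.
etransitivity; first by apply: tonelli; [by []|by []|meas|move=> w y; rewrite mule_ge0].
apply: eq_integral => y _.
transitivity (\int[P]_w (phi y * (v%:E * ((y - X v w)%:E * n (y - X v w))))).
  by apply: eq_integral => w _; rewrite muleC.
rewrite integralZe; [|by []|by []|by meas|by []].
rewrite /law_density (max_l (ltW v0)) /phi -[LHS]muleA; congr (_ * (_ * _)).
by apply: integralZ => //; [exact: ltW|meas].
Qed.

(** By Tonelli: a jump of size c contributes min(c, z) to both sides. *)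
Let integral_ltail z :
  \int[mu]_r (ind (r <= z)%R * ltail r) =
  z%:E * ltail z + \int[mu]_c (ind (c <= z)%R * (c%:E * n c)).
Proof.
have [z0|z0] := leP z 0%R.
  rewrite ltailN// mule0 add0e [LHS]integral0_eq => [|r _]; last first.
    by rewrite ind_mul; case: ifPn => // rz; rewrite ltailN// (le_trans rz).
  apply/esym/integral0_eq => c _; rewrite ind_mul; case: ifPn => // cz.
  by rewrite nN ?mule0// (le_trans cz).
transitivity (\int[mu]_r \int[mu]_c (ind (r <= z)%R * (ind (0 < r < c)%R * n c))).
  apply: eq_integral => r _; rewrite ge0_integralZl ?ind_ge0//; first by meas.
  by move=> c _; nng.
etransitivity; first by apply: tonelli; [by []|by []|meas|move=> r c; nng].
rewrite -[X in X + _]integralZ; [|by []|exact: ltW|by meas|by move=> c; nng].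
have zn c : 0 <= z%:E * (ind (0 < z < c)%R * n c) by rewrite mule_ge0 ?lee_fin ?(ltW z0)//; nng.
rewrite -integral_addition; [|by []|by meas|by []|by meas|by move=> c; rewrite mule_ge0 ?ind_ge0].
apply: eq_integral => c _; have [c0|c0] := leP c 0%R.
  by rewrite nN// !mule0 adde0; apply: integral0_eq => r _; rewrite !mule0.
transitivity (\int[mu]_r (n c * ind ((0 < r < c) && (r <= z))%R)).
  by apply: eq_integral => r _; rewrite muleA -ind_and andbC muleC.
rewrite ge0_integralZl//; [|by meas|by move=> r _; exact: ind_ge0].
have [cz|zc] := leP c z.
  rewrite andbF mul0e mule0 add0e mul1e muleC; congr (_ * _).
  rewrite (@integral_ind _ _ `]0%R, c[) ?lebesgue_measure_itv/= ?lte_fin ?c0 ?sube0//.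
  move=> r; rewrite in_itv/=; case: (ltP r c) => rc; rewrite ?andbF//.
  by rewrite (le_trans (ltW rc) cz) !andbT.
rewrite z0/= mul1e mul0e adde0 muleC; congr (_ * _).
rewrite (@integral_ind _ _ `]0%R, z]) ?lebesgue_measure_itv/= ?lte_fin ?z0 ?sube0//.
move=> r; rewrite in_itv/=; case: (leP r z) => rz; rewrite ?andbF//.
by rewrite (le_lt_trans rz zc) !andbT.
Qed.

(** Writes t as (t - X v) + X v under the expectation that defines passage; steutel transforms
    the second term. *)
Let time_passage t v : (0 <= t)%R -> (0 <= v)%R ->
  t%:E * passage t v = \int[P]_w ((t - X v w)%:E * ltail (t - X v w)) +
     \int[mu]_c (c%:E * n c * (v%:E * passage (t - c) v)).
Proof.
move=> t0 v0.
have zl z : 0 <= z%:E * ltail z.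
  have [z0|z0] := leP z 0%R; first by rewrite ltailN// mule0.
  by rewrite mule_ge0// lee_fin ltW.
have split (z y : R) : (0 <= y)%R -> (z + y)%:E * ltail z = z%:E * ltail z + ltail z * y%:E.
  move=> y0; have [z0|z0] := leP z 0%R; first by rewrite ltailN// !mule0 mul0e adde0.
  by rewrite EFinD ge0_muleDl ?lee_fin ?(ltW z0)// [y%:E * _]muleC.
transitivity (\int[P]_w ((t - X v w)%:E * ltail (t - X v w) + ltail (t - X v w) * (X v w)%:E)).
  transitivity (\int[P]_w (t%:E * ltail (t - X v w))).
    by apply/esym; apply: integralZ => //; meas.
  by apply: eq_integral => w _; rewrite -split// subrK.
rewrite integral_addition; [|by []|by meas|by []|by meas|by move=> w; nng].
congr (_ + _).
etransitivity; first by apply: (steutel (psi := fun r => ltail (t - r))) => //; meas.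
apply: eq_integral => c _; etransitivity; first exact: mule_swap.
apply: (congr1 (fun y => c%:E * n c * (v%:E * y))).
by apply: eq_integral => w _; apply: (congr1 ltail); ring.
Qed.

Let truncated_mean t x := \int[P]_w (ind (X x w <= t)%R * (X x w)%:E).

(** The identity that reaches every level t: the right-hand side is an integral over levels,
    hence insensitive to null sets, whereas the left-hand side involves the level t itself.
    When time_passage is integrated over v, the jump term and the truncated mean, which
    steutel expresses by the distribution function of X x, merge by weighted_passage_cdf;
    what is then left is summed by integral_ltail. *)
Let time_cumulated_passage t x : (0 < t)%R -> (0 < x)%R ->
  t%:E * \int[mu]_(v in `]0%R, x[) passage t v + truncated_mean t x =
  \int[mu]_r (ind (r <= t)%R * \int[mu]_(v in `]0%R, x[) passage r v).
Proof.
move=> t0 x0.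
pose J v := \int[P]_w ((t - X v w)%:E * ltail (t - X v w)).
pose S v := \int[mu]_c (c%:E * n c * ((Num.max v 0)%:E * passage (t - c) v)).
pose C v := \int[P]_w \int[mu]_c (ind (c <= t - X v w)%R * (c%:E * n c)).
have zl z : 0 <= z%:E * ltail z.
  have [z0|z0] := leP z 0%R; first by rewrite ltailN// mule0.
  by rewrite mule_ge0// lee_fin ltW.
have mJ : measurable_fun setT J.
  by apply: (measurable_integral1 P measurableT (fun v w => (t - X v w)%:E * ltail (t - X v w))); [meas|move=> v w].
have J0 v : 0 <= J v by apply: integral_ge0 => w _.
have mI : measurable_fun setT (fun z : R * T => \int[mu]_c (ind (c <= t - X z.1 z.2)%R * (c%:E * n c))).
  by apply: (measurable_integral1 mu measurableT (fun (z : R * T) c => ind (c <= t - X z.1 z.2)%R * (c%:E * n c))); [meas|move=> v w; rewrite mule_ge0 ?ind_ge0].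
have mIv (v : R) : measurable_fun setT (fun w => \int[mu]_c (ind (c <= t - X v w)%R * (c%:E * n c))).
  by apply: (measurable_integral1 mu measurableT (fun (w : T) c => ind (c <= t - X v w)%R * (c%:E * n c))); [meas|move=> w c; rewrite mule_ge0 ?ind_ge0].
have I0 v w : 0 <= \int[mu]_c (ind (c <= t - X v w)%R * (c%:E * n c)).
  by apply: integral_ge0 => c _; rewrite mule_ge0 ?ind_ge0.
have mC : measurable_fun setT C.
  exact: (measurable_integral1 P measurableT (fun v w => \int[mu]_c (ind (c <= t - X v w)%R * (c%:E * n c)))).
have C0 v : 0 <= C v by apply: integral_ge0.
(* The jump term and the truncated mean are convolutions of c n c with the two terms on the
   left of weighted_passage_cdf. *)
have key : \int[mu]_(v in `]0%R, x[) S v + truncated_mean t x = \int[mu]_(v in `]0%R, x[) C v.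
  pose psi r := (t - r)%:E * n (t - r).
  have psi0 r : 0 <= psi r by exact: weight_ge0.
  have mpsi : measurable_fun setT psi by rewrite /psi; meas.
  pose V r := \int[mu]_(v in `]0%R, x[) ((Num.max v 0)%:E * passage r v).
  have mV : measurable_fun setT V.
    by apply: (measurable_integral1 mu (measurable_itv _) (fun (r : R) v => (Num.max v 0)%:E * passage r v)); [meas|move=> r v; rewrite mule_ge0// lee_fin le_max lexx orbT].
  have V0 r : 0 <= V r by apply: integral_ge0 => v _; rewrite mule_ge0// lee_fin le_max lexx orbT.
  pose H v r := \int[P]_w ind (X v w <= r)%R : \bar R.
  have mH : measurable_fun setT (fun z => H z.1 z.2).
    by apply: (measurable_integral1 P measurableT (fun (z : R * R) w => ind (X z.1 w <= z.2)%R)); [meas|move=> z w; nng].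
  have H0 v r : 0 <= H v r by rewrite /H; nng.
  have mHx : measurable_fun setT (H x).
    exact: (comp2_measurable mH (@measurable_cst _ _ _ _ setT x) (@measurable_id _ _ setT)).
  have reflect (g : R -> \bar R) : measurable_fun setT g -> (forall r, 0 <= g r) ->
      \int[mu]_c (c%:E * n c * g (t - c)%R) = \int[mu]_r (psi r * g r).
    move=> mg g0; rewrite -(@integral_reflect _ t (fun r => psi r * g r)); [|by meas|by move=> r; rewrite mule_ge0].
    by apply: eq_integral => c _; rewrite /psi; congr (_%:E * n _ * _); ring.
  have mA : measurable_fun setT (fun c : R => c%:E * n c) by meas.
  have -> : \int[mu]_(v in `]0%R, x[) S v = \int[mu]_c (c%:E * n c * V (t - c)%R).
    etransitivity; first by apply: tonelli; [exact: measurable_itv|by []|meas|move=> v c; rewrite mule_ge0// mule_ge0// lee_fin le_max lexx orbT].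
    apply: eq_integral => c _; rewrite integralZe; [by []|exact: measurable_itv|by []|by meas|].
    by move=> v; rewrite mule_ge0// lee_fin le_max lexx orbT.
  have -> : truncated_mean t x = \int[mu]_c (c%:E * n c * (x%:E * H x (t - c)%R)).
    rewrite /truncated_mean (steutel (psi := fun r => ind (r <= t)%R)) ?(ltW x0)//; [|by meas|by move=> r; exact: ind_ge0].
    apply: eq_integral => c _; etransitivity; first exact: mule_swap.
    apply: (congr1 (fun y => c%:E * n c * (x%:E * y))).
    by apply: eq_integral => w _; apply: (congr1 ind); rewrite lerBrDl.
  have mxH : measurable_fun setT (fun r => x%:E * H x r) by apply: emeasurable_funM => //; exact: measurable_cst.
  have xH0 r : 0 <= x%:E * H x r by rewrite mule_ge0// lee_fin ltW.
  rewrite (reflect V)// (reflect (fun r => x%:E * H x r))//.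
  rewrite -integral_addition; [|by []|by meas|by move=> r; rewrite mule_ge0|by apply: emeasurable_funM|by move=> r; rewrite mule_ge0].
  transitivity (\int[mu]_r (psi r * (\int[mu]_(v in `]0%R, x[) (v%:E * passage r v) + x%:E * \int[P]_w ind (X x w <= r)%R))).
    have VE r : \int[mu]_(v in `]0%R, x[) (v%:E * passage r v) = V r.
      by apply: eq_integral => v; rewrite inE/= in_itv/= => /andP[v0 _]; rewrite max_l// ltW.
    by apply: eq_integral => r _; rewrite VE; apply/esym; exact: (ge0_muleDr (psi r) (V0 r) (xH0 r)).
  rewrite weighted_passage_cdf// -(reflect (fun r => \int[mu]_(v in `]0%R, x[) H v r)); last 2 first.
  - by apply: (measurable_integral1 mu (measurable_itv _) (fun (r : R) v => H v r)); [meas|].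
  - by move=> r; exact: integral_ge0.
  transitivity (\int[mu]_c \int[mu]_(v in `]0%R, x[) (c%:E * n c * H v (t - c)%R)).
    by apply: eq_integral => c _; rewrite [RHS]integralZe; [by []|exact: measurable_itv|by []|by meas|by []].
  etransitivity; first by apply: tonelli; [by []|exact: measurable_itv|meas|move=> v c; rewrite mule_ge0].
  apply: eq_integral => v _.
  transitivity (\int[mu]_c \int[P]_w (c%:E * n c * ind (X v w <= t - c)%R)).
    by apply: eq_integral => c _; rewrite ge0_integralZl//; [meas|move=> w _; exact: ind_ge0].
  etransitivity; first by apply: tonelli; [by []|by []|meas|move=> c w; rewrite mule_ge0 ?ind_ge0].
  by apply: eq_integral => w _; apply: eq_integral => c _; rewrite muleC lerBrDl addrC -lerBrDl.
have mS : measurable_fun setT S.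
  by apply: (measurable_integral1 mu measurableT (fun v c : R => c%:E * n c * ((Num.max v 0)%:E * passage (t - c) v))); [meas|move=> v c; rewrite mule_ge0// mule_ge0// lee_fin le_max lexx orbT].
have S0 v : 0 <= S v by apply: integral_ge0 => c _; rewrite mule_ge0// mule_ge0// lee_fin le_max lexx orbT.
have mixv : measurable (`]0%R, x[%classic : set (measurableTypeR R)) by exact: measurable_itv.
have -> : t%:E * \int[mu]_(v in `]0%R, x[) passage t v = \int[mu]_(v in `]0%R, x[) (J v + S v).
  transitivity (\int[mu]_(v in `]0%R, x[) (t%:E * passage t v)).
    apply/esym; apply: integralZ; [exact: mixv|exact: ltW|by meas|exact: pass0].
  apply: eq_integral => v; rewrite inE/= in_itv/= => /andP[v0 _].
  by rewrite /S (max_l (ltW v0)); exact: (time_passage (ltW t0) (ltW v0)).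
rewrite integral_addition; [|by []|by []|by []|by []|by []].
rewrite -addeA key -integral_addition; [|by []|by []|by []|by []|by []].
transitivity (\int[mu]_(v in `]0%R, x[) \int[P]_w \int[mu]_r (ind (r <= t)%R * ltail (r - X v w))).
  apply: eq_integral => v _; rewrite /J /C -[LHS]integral_addition; [|by []|by meas|by []|exact: mIv|by []].
  apply: eq_integral => w _; rewrite -integral_ltail.
  rewrite -(@integral_shift _ (X v w) (fun r => ind (r <= t - X v w)%R * ltail r)); [|by meas|by move=> r; nng].
  by apply: eq_integral => r _; rewrite lerBlDr subrK.
have mti (v : R) : measurable_fun setT (fun z : R * T => ind (z.1 <= t)%R * ltail (z.1 - X v z.2)) by meas.
transitivity (\int[mu]_(v in `]0%R, x[) \int[mu]_r (ind (r <= t)%R * passage r v)).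
  apply: eq_integral => v _.
  etransitivity; first by apply: tonelli; [by []|by []|meas|move=> w r; nng].
  by apply: eq_integral => r _; apply: integralZe; [by []|exact: ind_ge0|by meas|move=> w; nng].
etransitivity; first by apply: tonelli; [exact: mixv|by []|meas|move=> w r; nng].
by apply: eq_integral => r _; apply: integralZe; [exact: mixv|exact: ind_ge0|by meas|move=> w; nng].
Qed.

(** The integral of the survival function up to t is E min(X x, t). *)
Let integral_survival t x : (0 < t)%R ->
  \int[mu]_r (ind (r <= t)%R * (ind (0 <= r)%R * \int[P]_w ind (r < X x w)%R)) =
  t%:E * \int[P]_w ind (t < X x w)%R + truncated_mean t x.
Proof.
move=> t0.
transitivity (\int[mu]_r \int[P]_w (ind (0 <= r <= t)%R * ind (r < X x w)%R)).
  apply: eq_integral => r _; rewrite muleA -ind_and andbC ge0_integralZl ?ind_ge0//; first by meas.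
  by move=> w _; exact: ind_ge0.
etransitivity; first by apply: tonelli; [by []|by []|meas|move=> w r; nng].
rewrite -[X in X + _]integralZ; [|by []|exact: ltW|by meas|by move=> w; nng].
rewrite -integral_addition; [|by []|by meas|by move=> w; rewrite mule_ge0 ?ind_ge0// lee_fin ltW|by meas|by move=> w; nng].
apply: eq_integral => w _.
transitivity (\int[mu]_r ind ((0 <= r <= t) && (r < X x w))%R).
  by apply: eq_integral => r _; rewrite [RHS]ind_and.
have [tX|Xt] := ltP t (X x w).
  rewrite mul0e adde0 mule1 (@integral_ind _ _ `[0%R, t]) ?lebesgue_measure_itv/= ?lte_fin ?t0 ?sube0//.
  move=> r; rewrite in_itv/=; case: (leP r t) => rt; rewrite ?andbF//.
  by rewrite (le_lt_trans rt tX) !andbT.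
rewrite mule0 add0e mul1e (@integral_ind _ _ `[0%R, X x w[) ?lebesgue_measure_itv/= ?lte_fin ?sube0//.
  by have := X0 x w; rewrite le_eqVlt => /orP[/eqP <-|->//]; rewrite ltxx.
move=> r; rewrite in_itv/=; case: (ltP r (X x w)) => rt; rewrite ?andbF//.
by rewrite (le_trans (ltW rt) Xt) !andbT.
Qed.

(** By passage_survival, the right-hand side of time_cumulated_passage is the one of
    integral_survival; the truncated mean is finite and cancels, and t divides out. *)
Theorem passage_cdf t x : (0 < t)%R -> (0 < x)%R ->
  \int[mu]_(v in `]0%R, x[) passage t v = \int[P]_w ind (t < X x w)%R.
Proof.
move=> t0 x0.
have fin : truncated_mean t x \is a fin_num.
  rewrite ge0_fin_numE; last by apply: integral_ge0 => w _; nng.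
  apply: (@le_lt_trans _ _ (\int[P]_w (cst t%:E w))); last first.
    rewrite integral_cst//; apply: lte_mul_pinfty; [by rewrite lee_fin ltW|by []|].
    by apply: (le_lt_trans (probability_le1 P measurableT)); rewrite ltry.
  apply: ge0_le_integral; [by []|by move=> w _; nng|by meas|by []|].
  move=> w _; rewrite ind_mul; case: ifPn => [|_]; first by rewrite lee_fin.
  by rewrite lee_fin ltW.
have H : t%:E * \int[mu]_(v in `]0%R, x[) passage t v = t%:E * \int[P]_w ind (t < X x w)%R.
  have := time_cumulated_passage t0 x0.
  rewrite (passage_survival (psi := fun r => ind (r <= t)%R) x0); [|by meas|by move=> r; exact: ind_ge0].
  rewrite integral_survival// => E.
  by have /(congr1 (fun y => y - truncated_mean t x)) := E; rewrite !addeK.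
have t1 : (t^-1)%:E * t%:E = 1 by rewrite -EFinM mulVf// gt_eqF.
by rewrite -[LHS]mul1e -t1 -muleA H muleA t1 mul1e.
Qed.


End subordinator_laws.

(** * The inverse subordinator *)

Section random_time.
Context d d' (T : measurableType d) (V : measurableType d').

Lemma measurable_countable_choice (k : T -> nat) (g : nat -> T -> V) :
  (forall j, measurable [set x | k x = j]) ->
  (forall j, measurable_fun setT (g j)) ->
  measurable_fun setT (fun x => g (k x) x).
Proof.
move=> mk mg _ A mA; rewrite setTI.
have -> : (fun x => g (k x) x) @^-1` A = \bigcup_j ([set x | k x = j] `&` g j @^-1` A).
  by apply/seteqP; split=> [x Ax|x [j _ [/= <-]]]; [exists (k x)|].
apply: bigcup_measurable => j _; apply: measurableI; first exact: mk.
by rewrite -[X in measurable X]setTI; exact: mg.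
Qed.

End random_time.

(** With grid_time, approximates the time v strictly from the right by a multiple of
    1 / (m + 1): right-continuous processes then converge along the approximations, and take
    only countably many values of the time at each step. *)
Definition time_index (R : realType) (m : nat) (v : R) : nat :=
  Num.trunc (m.+1%:R * Num.max v 0).

Definition grid_time (R : realType) (m j : nat) : R := j.+1%:R / m.+1%:R.

Section discretisation.
Context (R : realType).

Lemma grid_time_ge0 m j : 0 <= grid_time R m j.
Proof. by rewrite divr_ge0. Qed.

Lemma measurable_time_index m j : measurable [set v : R | time_index m v = j].
Proof.
have mf : measurable_fun setT (fun v : R => m.+1%:R * Num.max v 0).
  by apply: measurable_funM => //; exact: measurable_maxr.
have E : [set v : R | time_index m v = j] =
    [set v | j%:R <= m.+1%:R * Num.max v 0] `&` [set v | m.+1%:R * Num.max v 0 < j.+1%:R].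
  have h0 (v : R) : 0 <= m.+1%:R * Num.max v 0 by rewrite mulr_ge0// le_max lexx orbT.
  apply/seteqP; split => [v /= /eqP|v /= [h1 h2]].
    by rewrite /time_index truncn_eq// => /andP.
  by apply/eqP; rewrite /time_index truncn_eq// h1 h2.
rewrite E; apply: measurableI.
- have := @measurable_fun_ler _ _ _ setT (cst j%:R) (fun v : R => m.+1%:R * Num.max v 0) (measurable_cst _) mf.
  by move=> /(_ measurableT [set true] I); rewrite setTI.
- have := @measurable_fun_ltr _ _ _ setT (fun v : R => m.+1%:R * Num.max v 0) (cst j.+1%:R) mf (measurable_cst _).
  by move=> /(_ measurableT [set true] I); rewrite setTI.
Qed.

Lemma cvg_grid_time (v : R) : 0 <= v ->
  (fun m => grid_time R m (time_index m v)) @ \oo --> v^'+.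
Proof.
move=> v0; have b m : v < grid_time R m (time_index m v) <= v + m.+1%:R^-1.
  rewrite /grid_time /time_index max_l//.
  have mv0 : 0 <= m.+1%:R * v by rewrite mulr_ge0.
  rewrite ltr_pdivlMr// mulrC truncnS_gt /= ler_pdivrMr// mulrDl mulVf//.
  by rewrite -natr1 lerD2r [v * _]mulrC truncn_le.
have c : v + m.+1%:R^-1 @[m --> \oo] --> v.
  by rewrite -[X in _ --> X]addr0; apply: cvgD; [exact: cvg_cst|exact: cvg_harmonic].
have c' : grid_time R m (time_index m v) @[m --> \oo] --> v.
  apply: (@squeeze_cvgr _ _ _ _ (cst v) (fun m => v + m.+1%:R^-1)) => //; last exact: cvg_cst.
  by apply: nearW => m /=; have /andP[/ltW -> ->] := b m.
move=> A /c' /=; rewrite !near_simpl /=.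
by apply: filterS => m; apply; have /andP[] := b m.
Qed.

(** Joint measurability: the limit of the process at the times of finer and finer grids. The
    time is clamped at 0 because the paths are known on the right half-line only. *)
Lemma measurable_right_continuous d (T : measurableType d) (X : R -> T -> R) :
  (forall v, measurable_fun setT (X v)) ->
  (forall w v, 0 <= v -> X s w @[s --> v^'+] --> X v w) ->
  measurable_fun setT (fun z : R * T => X (Num.max z.1 0) z.2).
Proof.
move=> mX rX.
apply: (@measurable_fun_cvg _ _ _ _
  (fun m (z : R * T) => X (grid_time R m (time_index m z.1)) z.2)).
- move=> m.
  apply: (measurable_countable_choice (k := fun z : R * T => time_index m z.1)
     (g := fun j z => X (grid_time R m j) z.2)).
  + move=> j; have := (@measurable_fst _ _ R T) measurableT _ (measurable_time_index m j).
    by rewrite setTI.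
  + by move=> j; apply: (measurableT_comp (mX _)); exact: measurable_snd.
- move=> [v w] _ /=; have v0 : 0 <= Num.max v 0 by rewrite le_max lexx orbT.
  have -> : (fun m => X (grid_time R m (time_index m v)) w) =
      (fun m => X (grid_time R m (time_index m (Num.max v 0))) w).
    by apply/funext => m; rewrite /time_index [in RHS]max_l.
  exact: (cvg_comp _ _ (cvg_grid_time v0) (rX w _ v0)).
Qed.

(** The left rays exhaust the line, so that finiteness on them is enough. *)
Lemma eq_measure_left_rays (m1 m2 : {measure set (measurableTypeR R) -> \bar R}) :
  (forall a : R, (m1 `]-oo, a[%classic < +oo)%E) ->
  (forall a : R, m1 `]-oo, a[%classic = m2 `]-oo, a[%classic) ->
  forall A, measurable A -> m1 A = m2 A.
Proof.
move=> fin eqray.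
pose G : set (set (measurableTypeR R)) := @RGenInftyO.G R.
apply: (measure_unique G (fun j => `]-oo, j%:R[%classic)).
- exact: RGenInftyO.measurableE.
- move=> A B [a ->] [b ->]; exists (Num.min a b); apply/seteqP; split => x /=;
    rewrite !in_itv/= lt_min.
    by move=> [-> ->].
  by move/andP.
- by move=> j; exists j%:R.
- apply/seteqP; split => // x _; exists (Num.trunc x).+1 => //=.
  by rewrite in_itv/= truncnS_gt.
- by move=> A [a ->].
- by move=> j; exact: fin.
Qed.

End discretisation.

Section inverse_time.
Context (R : realType) d (T : measurableType d) (P : probability T R) (f : R -> R)
  (D : R -> {RV P >-> R}).
Hypothesis HD : subordinator f D.
Hypothesis f1 : 0 < f 1.
Local Notation Y := (inverse_subordinator D).

Let lbY t w : has_lbound [set x : R | 0 <= x /\ t < D x w].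
Proof. by exists 0 => x []. Qed.

Lemma inverse_ge0 t w : 0 <= Y t w.
Proof.
rewrite /inverse_subordinator; set S := [set _ | _].
have [->|/set0P S0] := eqVneq S set0; first by rewrite inf0.
by apply: lb_le_inf => // x [].
Qed.

Lemma inverse_le t x w : 0 <= x -> t < D x w -> Y t w <= x.
Proof. by move=> x0 tD; apply: ge_inf. Qed.

(** The level must be exceeded at some time, as the infimum of the empty set is 0. *)
Lemma inverse_lt t x w : (exists m : nat, t < D m%:R w) -> Y t w < x -> t < D x w.
Proof.
move=> [m tm] Yx; have S0 : [set x : R | 0 <= x /\ t < D x w] !=set0 by exists m%:R.
have [y [y0 ty] yx] := inf_lt S0 Yx.
by apply: (lt_le_trans ty); apply: (sub_homo HD) => //; exact: ltW.
Qed.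

Let mD v : measurable_fun setT (D v : T -> R). Proof. by []. Qed.

Lemma measurable_above t v : measurable [set w | t < D v w].
Proof.
have := @measurable_fun_ltr _ _ _ setT (cst t) (D v) (measurable_cst _) (mD v).
by move=> /(_ measurableT [set true] I); rewrite setTI.
Qed.

(** Where the level t is ever exceeded, Y t < x says that it is exceeded strictly before x, a
    condition on countably many times; elsewhere Y t is 0. *)
Lemma measurable_inverse t : measurable_fun setT (Y t).
Proof.
pose N := \bigcap_(m in [set: nat]) ~` [set w | t < D m%:R w].
have mN : measurable N.
  by apply: bigcapT_measurable => m; apply: measurableC; exact: measurable_above.
apply: (measurability _ (@RGenInftyO.measurableE R)) => _ [_ [a ->] <-].
rewrite setTI; have [a0|a0] := leP a 0.
  rewrite (_ : _ @^-1` _ = set0)//; apply/seteqP; split => // w /=.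
  by rewrite in_itv/= => /(le_lt_trans (inverse_ge0 t w)); rewrite ltNge a0.
pose q m : R := Num.max (a - m.+1%:R^-1) 0.
rewrite (_ : _ @^-1` _ = N `|` \bigcup_m [set w | t < D (q m) w]).
  apply: measurableU => //; apply: bigcupT_measurable => m; exact: measurable_above.
have q0 m : 0 <= q m by rewrite le_max lexx orbT.
apply/seteqP; split => w /=.
  rewrite in_itv/= => Ya; have [|/existsNP[m /contrapT tm]] := pselect (forall m : nat, ~ t < D m%:R w).
    by move=> Nw; left => m _; exact: Nw.
  right; have S0 : [set x : R | 0 <= x /\ t < D x w] !=set0 by exists m%:R.
  have [y [y0 ty] ya] := inf_lt S0 Ya.
  exists (Num.trunc (a - y)^-1) => //=; apply: (lt_le_trans ty); apply: (sub_homo HD) => //.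
  rewrite le_max lerBrDr -lerBrDl -[X in _ <= X]invrK lef_pV2 ?posrE ?invr_gt0 ?subr_gt0//.
  by rewrite ltW// truncnS_gt.
rewrite in_itv/= => -[Nw|[m _ /= tm]]; last first.
  by apply: (le_lt_trans (inverse_le (q0 m) tm)); rewrite gt_max a0 andbT gtrBl invr_gt0.
rewrite /inverse_subordinator; set S := [set _ | _].
suff -> : S = set0 by rewrite inf0.
apply/seteqP; split => // x [x0 tx]; apply: (Nw (Num.trunc x).+1 I) => /=.
by apply: (lt_le_trans tx); apply: (sub_homo HD) => //; rewrite ltW// truncnS_gt.
Qed.

(** Markov's inequality: P(D m <= t) <= e^t E e^(- D m) = e^(t - m f 1), which tends to 0. *)
Lemma subordinator_bounded_null t : P (\bigcap_(m in [set: nat]) ~` [set w | t < D m%:R w]) = 0%E.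
Proof.
set N := \bigcap_(m in _) _.
have mN : measurable N.
  by apply: bigcapT_measurable => m; apply: measurableC; exact: measurable_above.
have le_exp (m : nat) : (P N <= (expR t * expR (- (m%:R * f 1)))%:E)%E.
  have e0 : (0 <= (expR t)%:E :> \bar R)%E by rewrite lee_fin expR_ge0.
  have me : measurable_fun setT (fun w => (expR (- (1 * D m%:R w)))%:E : \bar R).
    apply/measurable_EFinP; apply: measurableT_comp => //; apply: measurable_funN.
    by apply: measurable_funM.
  rewrite EFinM -(sub_laplace HD) ?ler01//.
  rewrite unlock -ge0_integralZl//.
  rewrite -[X in P X]setIT -integral_indic//.
  apply: ge0_le_integral; [by []|by move=> w _; rewrite lee_fin|by apply/measurable_EFinP| |].
  - by apply: emeasurable_funM => //; exact: measurable_cst.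
  - move=> w _; rewrite -EFinM lee_fin indicE mul1r.
    case: (boolP (w \in N)) => [|_]; last by rewrite mulr_ge0 ?expR_ge0.
    rewrite inE => /(_ m I) /negP; rewrite -leNgt => Dt.
    have h : 1 <= expR (t - D m%:R w) by rewrite -[X in X <= _]expR0 ler_expR subr_ge0.
    by rewrite -expRD; exact: h.
have Pfin : P N \is a fin_num by rewrite fin_num_measure.
rewrite -(fineK Pfin) in le_exp *; set p := fine _ in le_exp *.
apply/eqP; rewrite eqe; apply: contrapT => /negP p0.
have {}p0 : 0 < p by rewrite lt0r p0 fine_ge0.
have := le_exp (Num.trunc (expR t / p / f 1)).+1; rewrite lee_fin leNgt => /negP; apply.
set m := (Num.trunc _).+1.
have u0 : expR t / p < m%:R * f 1 by rewrite -ltr_pdivrMr// truncnS_gt.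
rewrite expRN ltr_pdivrMr ?expR_gt0// -ltr_pdivrMl// mulrC (lt_le_trans u0)// (le_trans _ (expR_ge1Dx _))//.
by rewrite lerDr.
Qed.

(** {Y t < a} and {t < D a} differ by the paths that stay below t and by {Y t = a}. *)
Lemma inverse_cdf t a : 0 < a -> P [set w | Y t w = a] = 0%E ->
  P [set w | Y t w < a] = P [set w | t < D a w].
Proof.
move=> a0 Ya0; set N := \bigcap_(m in [set: nat]) ~` [set w | t < D m%:R w].
have mN : measurable N.
  by apply: bigcapT_measurable => m; apply: measurableC; exact: measurable_above.
have mlt : measurable [set w | Y t w < a].
  have := measurable_inverse t measurableT (measurable_itv `]-oo, a[).
  by rewrite setTI (_ : _ @^-1` _ = [set w | Y t w < a])//; apply/seteqP; split => w; rewrite /= in_itv.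
have meq : measurable [set w | Y t w = a].
  by have := measurable_inverse t measurableT (measurable_set1 a); rewrite setTI.
have ma := measurable_above t a.
apply/eqP; rewrite eq_le; apply/andP; split.
  rewrite -[leRHS](measureU0 ma mN (subordinator_bounded_null t)).
  apply: le_measure; rewrite ?inE//; first exact: measurableU.
  move=> w /= Yw; have [Nw|/existsNP[m /contrapT tm]] := pselect (forall m : nat, ~ t < D m%:R w).
    by right => m _; exact: Nw.
  by left; apply: inverse_lt => //; exists m.
rewrite -[leRHS](measureU0 mlt meq Ya0); apply: le_measure; rewrite ?inE//; first exact: measurableU.
move=> w /= tD; have := inverse_le (ltW a0) tD.
by rewrite le_eqVlt => /orP[/eqP ->|->]; [right|left].
Qed.

End inverse_time.

(** Puts the Levy measure in the form, a density on the line, from which the first passage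
    densities were derived. *)
Lemma levy_setup (R : realType) (nubar : {measure set (measurableTypeR R) -> \bar R}) (f : R -> R) :
  levy_measure nubar -> bernstein_of nubar f ->
  exists n : R -> \bar R, [/\ measurable_fun setT n, (forall c, 0 <= n c)%E,
    (forall c, c <= 0 -> n c = 0%E),
    (forall s, 0 <= s -> ((f s)%:E = \int[lebesgue_measure]_c ((1 - expR (- (s * c)))%:E * n c))%E) &
    (\int[lebesgue_measure]_c n c = +oo)%E /\
    (forall z, 0 < z -> (tail nubar z)%:E = ltail n z)].
Proof.
move=> Hnu Hf; have [n [mn n0 nN nE]] := levy_density Hnu.
exists n; split => //.
- move=> s s0; rewrite Hf//.
  have := @integral_ind_itv R _ _ nubar (fun x : R => 0 < x) (fun x => (1 - expR (- (s * x)))%:E).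
  rewrite (_ : [set x | 0 < x] = `]0, +oo[%classic); last first.
    by apply/seteqP; split => x; rewrite /= in_itv/= andbT.
  move=> <-; rewrite nE.
  + apply: eq_integral => c _; rewrite ind_mul; case: ltP => c0//.
    by rewrite nN// !mule0.
  + by meas.
  + move=> c; rewrite ind_mul; case: ltP => c0//.
    by rewrite lee_fin subr_ge0 expR_le1 oppr_le0 mulr_ge0// ltW.
- have nuE (b : R -> bool) : measurable_fun setT b ->
      nubar [set x | b x] = (\int[lebesgue_measure]_c (ind (b c) * n c))%E.
    move=> mb; have mbs : measurable [set x : measurableTypeR R | b x].
      by have := mb measurableT [set true] I; rewrite setTI.
    rewrite -nE; [|by meas|by move=> c; exact: ind_ge0].
    transitivity (\int[nubar]_x (ind (b x) * cst 1 x))%E.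
      by rewrite integral_ind_itv integral_cst// mul1e.
    by apply: eq_integral => x _; rewrite mule1.
  split.
    rewrite -(levy_infinite Hnu) (_ : `]0, +oo[%classic = [set x | 0 < x]); last first.
      by apply/seteqP; split => x; rewrite /= in_itv/= andbT.
    rewrite nuE; last by meas.
    by apply: eq_integral => c _; rewrite ind_mul; case: ltP => c0//; rewrite nN.
  move=> z z0; rewrite levy_tailE// (_ : `]z, +oo[%classic = [set x | 0 < z < x]); last first.
    by apply/seteqP; split => x; rewrite /= in_itv/= andbT z0.
  by rewrite nuE//; meas.
Qed.

Section expectation_of_a_law.
Context (R : realType) (d : measure_display) (T : measurableType d) (P : probability T R) (Y : T -> R).
Hypothesis mY : measurable_fun setT Y.
Local Notation mu := (@lebesgue_measure R).

(** The law of Y and the measure of density p agree on the rays, hence everywhere. *)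
Lemma expectation_rays (p psi : R -> \bar R) :
  measurable_fun setT p -> (forall u, 0 <= p u)%E ->
  (forall a, P (Y @^-1` `]-oo, a[) = \int[mu]_(u in `]-oo, a[) p u)%E ->
  measurable_fun setT psi -> (forall u, 0 <= psi u)%E ->
  (\int[P]_w psi (Y w) = \int[mu]_u (psi u * p u))%E.
Proof.
move=> mp p0 pE mpsi psi0.
have m1 : measurable_fun setT (cst 1%E : T -> \bar R) by [].
have one0 (w : T) : (0 <= cst 1 w :> \bar R)%E by [].
have mY' : measurable_fun setT (Y : T -> measurableTypeR R) by [].
pose k1 : {measure set (measurableTypeR R) -> \bar R} := weighted_law P m1 one0 mY'.
have mid := @measurable_id _ (measurableTypeR R) setT.
pose k2 : {measure set (measurableTypeR R) -> \bar R} :=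
  weighted_law (mu : {measure set (measurableTypeR R) -> \bar R}) mp p0 mid.
have mYA (A : set (measurableTypeR R)) : measurable A -> measurable (Y @^-1` A).
  by move=> mA; rewrite -[X in measurable X]setTI; exact: mY.
have k1E (A : set (measurableTypeR R)) : measurable A -> k1 A = P (Y @^-1` A).
  by move=> mA; rewrite /k1 /= /weighted_law integral_cst ?mul1e//; exact: mYA.
have k12 := @eq_measure_left_rays R k1 k2.
transitivity (\int[k1]_u psi u)%E.
  rewrite (@integral_weighted_law _ T _ (measurableTypeR R) R P (cst 1%E) Y m1 one0 mY' k1 psi)//.
  by apply: eq_integral => w _; rewrite mule1.
rewrite (@integral_weighted_law _ (measurableTypeR R) _ (measurableTypeR R) R mu p id mp p0 mid k1 psi)//.
apply: k12 => a; rewrite k1E ?pE//; try exact: measurable_itv.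
by rewrite -pE (le_lt_trans (probability_le1 P _)) ?ltry//; apply: mYA; exact: measurable_itv.
Qed.

Lemma expectation_density (g : R -> R) (psi : R -> \bar R) :
  is_density P Y g -> measurable_fun setT psi -> (forall u, 0 <= psi u)%E ->
  (\int[P]_w psi (Y w) = \int[mu]_(u in `]0%R, +oo[) (psi u * (g u)%:E))%E.
Proof.
move=> [mg g0 gE] mpsi psi0.
have mI : measurable (`]0, +oo[ : set (measurableTypeR R)) by exact: measurable_itv.
rewrite (expectation_rays (p := (fun u => (g u)%:E) \_ `]0, +oo[))//.
- rewrite [RHS]integral_mkcond; apply: eq_integral => u _; rewrite !patchE.
  by case: ifP => // _; rewrite mule0.
- by apply/(measurable_restrict _ mI measurableT); rewrite setTI; exact/measurable_EFinP.
- move=> u; rewrite patchE; case: ifPn => // /set_mem; rewrite /= in_itv/= andbT => u0.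
  by rewrite lee_fin g0.
- by move=> a; rewrite gE ?integral_mkcondr//; exact: measurable_itv.
Qed.

End expectation_of_a_law.

Section first_passage.
Context (R : realType) (d : measure_display) (T : measurableType d) (P : probability T R)
    (nubar : {measure set (measurableTypeR R) -> \bar R}) (f : R -> R)
    (D : R -> {RV P >-> R}) (h : R -> R -> R).
Hypotheses (Hnubar : levy_measure nubar) (Hf : bernstein_of nubar f) (HD : subordinator f D)
    (Hh : forall t, 0 < t -> is_density P (inverse_subordinator D t) (h t)).
Local Notation mu := (@lebesgue_measure R).
Local Notation Y := (inverse_subordinator D).

(** What the sequel uses of the laws of the subordinator: a version pass t of the density of the
    inverse at every time t > 0, interchangeable with h t, and the density dens v of D v, related
    by P(Y t >= v) = P(D v <= t) and by the convolution with the tail. The version pass, unlike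
    h, is jointly measurable and has an explicit Laplace transform in t. *)
Lemma first_passage_law : exists pass dens : R -> R -> \bar R,
  [/\ measurable_fun setT (fun z => pass z.1 z.2) /\ (forall t v, 0 <= pass t v)%E,
      [/\ measurable_fun setT (fun z => dens z.1 z.2), (forall v y, 0 <= dens v y)%E,
        (forall v y, y <= 0 -> dens v y = 0%E) &
        forall v, 0 < v -> (\int[mu]_y dens v y = 1)%E],
      (forall t (psi : R -> \bar R), 0 < t -> measurable_fun setT psi -> (forall u, 0 <= psi u)%E ->
        (\int[mu]_(u in `]0%R, +oo[) (psi u * (h t u)%:E) = \int[mu]_(u in `]0%R, +oo[) (psi u * pass t u))%E),
      (forall t v, 0 < t -> 0 < v ->
        (\int[mu]_(u in `[v, +oo[) pass t u = \int[mu]_y (ind (y <= t)%R * dens v y))%E) &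
      [/\ measurable_fun setT (fun z : R => if 0 < z then tail nubar z else 0),
        (forall t v, 0 < v -> (pass t v =
           \int[mu]_y ((if (0 < t - y)%R then tail nubar (t - y) else 0)%:E * dens v y))%E),
        (forall v, 0 < v -> (\int[mu]_t ((expR (- t))%:E * pass t v) <= (f 1)%:E)%E) &
        (forall v, 0 < v -> P [set w | D v w <= 0] = 0%E)]].
Proof.
have [n [mn n0 nN nf [ninf ntail]]] := levy_setup Hnubar Hf.
pose X v w := D (Num.max v 0) w.
have mX : measurable_fun setT (fun z : R * T => X z.1 z.2).
  by apply: (@measurable_right_continuous _ _ _ (fun v => D v : T -> R)) => // w v; exact: (sub_rcont HD).
have X0 v w : 0 <= X v w.
  by rewrite -(sub_start HD w) /X; apply: (sub_homo HD); rewrite ?le_max ?lexx ?orbT.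
have XL v s : 0 <= v -> 0 <= s -> (\int[P]_w (expR (- (s * X v w)))%:E = (expR (- (v * f s)))%:E)%E.
  by move=> v0 s0; have := sub_laplace HD s0 v0; rewrite unlock /X (max_l v0).
have f1 : 0 < f 1 by exact: (levy_exponent_gt0 mn n0 nN nf ninf).
have tE z : ltail n z = (if 0 < z then tail nubar z else 0)%:E.
  by case: ifPn => [z0|]; [rewrite ntail|rewrite -leNgt => z0; rewrite ltailN].
pose pass := passage n P X; pose dens := law_density n P X.
have mpass : measurable_fun setT (fun z => pass z.1 z.2) by exact: measurable_passage.
have pass0 t v : (0 <= pass t v)%E by exact: passage_ge0.
have mdens : measurable_fun setT (fun z => dens z.1 z.2) by exact: measurable_law_density.
have dens0 v y : (0 <= dens v y)%E by exact: law_density_ge0.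
have densE v (psi : R -> \bar R) : 0 < v -> measurable_fun setT psi -> (forall r, 0 <= psi r)%E ->
    (\int[P]_w psi (X v w) = \int[mu]_y (psi y * dens v y))%E.
  by move=> v0 mpsi psi0; apply: (law_densityE mn n0 nN nf ninf).
have cdf t x : 0 < t -> 0 < x -> (\int[mu]_(v in `]0%R, x[) pass t v = P [set w | (t < D x w)%R])%E.
  move=> t0 x0; rewrite (passage_cdf mn n0 nN nf ninf mX X0 XL)//.
  transitivity (\int[P]_w (ind (t < X x w)%R * cst 1 w))%E.
    by apply: eq_integral => w _; rewrite mule1.
  rewrite integral_ind_itv integral_cst; last exact: (measurable_above D t (Num.max x 0)).
  by rewrite mul1e /X max_l// ltW.
have A t (psi : R -> \bar R) : 0 < t -> measurable_fun setT psi -> (forall u, 0 <= psi u)%E ->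
    (\int[mu]_(u in `]0%R, +oo[) (psi u * (h t u)%:E) = \int[mu]_(u in `]0%R, +oo[) (psi u * pass t u))%E.
  move=> t0 mpsi psi0; have [mh h0 hE] := Hh t0.
  have mpt : measurable_fun setT (pass t) by meas.
  have mI : measurable (`]0, +oo[ : set (measurableTypeR R)) by exact: measurable_itv.
  rewrite -(expectation_density (measurable_inverse HD t) (Hh t0) mpsi psi0).
  rewrite (expectation_rays (measurable_inverse HD t) (p := (pass t) \_ `]0, +oo[))//.
  - rewrite [RHS]integral_mkcond; apply: eq_integral => u _; rewrite !patchE.
    by case: ifP => // _; rewrite mule0.
  - by apply/(measurable_restrict _ mI measurableT); exact: (measurable_funTS mpt).
  - by move=> u; rewrite patchE; case: ifP.
  move=> a; rewrite -integral_mkcondr; have [a0|a0] := leP a 0.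
    rewrite (_ : _ `&` _ = set0) ?integral_set0; last first.
      apply/seteqP; split => // x; rewrite /= !in_itv/= andbT => -[xa x0].
      by have := lt_le_trans xa a0; rewrite ltNge (ltW x0).
    rewrite (_ : _ @^-1` _ = set0) ?measure0//; apply/seteqP; split => // w /=.
    by rewrite in_itv/= => /(le_lt_trans (inverse_ge0 D t w)); rewrite ltNge a0.
  rewrite (_ : _ `&` _ = `]0, a[%classic); last first.
    by apply/seteqP; split => x; rewrite /= !in_itv/= ?andbT; [by move=> [-> ->]|by move=> /andP[-> ->]].
  rewrite cdf// -(inverse_cdf HD f1 a0).
    by congr (P _); apply/seteqP; split => w; rewrite /= in_itv.
  have := hE [set a] (measurable_set1 a).
  rewrite (_ : Y t @^-1` [set a] = [set w | Y t w = a])// => ->.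
  have sub : [set a] `&` `]0, +oo[ `<=` [set a] by move=> x [].
  have maI : measurable ([set a] `&` `]0, +oo[ : set (measurableTypeR R)) by exact: measurableI.
  apply: null_set_integral => //.
    apply/measurable_EFinP; apply: measurable_funS mh => //; exact: measurable_itv.
  exact: (subset_measure0 maI (measurable_set1 a) sub (lebesgue_measure_set1 a)).
have B t v : 0 < t -> 0 < v ->
        (\int[mu]_(u in `[v, +oo[) pass t u = \int[mu]_y (ind (y <= t)%R * dens v y))%E.
  move=> t0 v0; have [mh h0 hE] := Hh t0.
  have mpt : measurable_fun setT (pass t) by meas.
  have total : (\int[mu]_(u in `]0%R, +oo[) pass t u = 1)%E.
    transitivity (\int[mu]_(u in `]0%R, +oo[) (cst 1 u * pass t u))%E.
      by apply: eq_integral => u _; rewrite mul1e.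
    rewrite -(A t (cst 1%E) t0)//.
    transitivity (\int[mu]_(u in `]0%R, +oo[) (h t u)%:E)%E.
      by apply: eq_integral => u _; rewrite mul1e.
    by have := hE setT measurableT; rewrite setTI preimage_setT probability_setT.
  have mD : measurable [set w | t < D v w] by exact: (measurable_above D t v).
  rewrite -(densE v (fun y => ind (y <= t)) v0); [|by meas|by move=> r; exact: ind_ge0].
  transitivity (P (~` [set w | t < D v w])); last first.
    transitivity (\int[P]_w (ind (X v w <= t)%R * cst 1 w))%E; last first.
      by apply: eq_integral => w _; rewrite mule1.
    have E : [set w | X v w <= t] = ~` [set w | t < D v w].
      by apply/seteqP; split => w /=; rewrite /X (max_l (ltW v0)) leNgt => /negP.
    by rewrite integral_ind_itv E integral_cst ?mul1e//; exact: measurableC.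
  rewrite probability_setC// -(cdf t v t0 v0).
  have split_itv : `]0, +oo[%classic = `]0, v[%classic `|` `[v, +oo[%classic :> set (measurableTypeR R).
    by rewrite -itv_bndbnd_setU// bnd_simp ltW.
  move: total; rewrite split_itv ge0_integral_setU; last 5 first.
  - exact: measurable_itv.
  - exact: measurable_itv.
  - exact: measurable_funTS.
  - by [].
  - apply/disj_setPS => x [] /=; rewrite !in_itv/= => /andP[_ xv]; rewrite andbT leNgt xv//.
  have fin : (\int[mu]_(x in `]0%R, v[) pass t x)%E \is a fin_num.
    by rewrite cdf// fin_num_measure.
  by move=> /(congr1 (fun y => y - \int[mu]_(x in `]0%R, v[) pass t x))%E; rewrite addeAC subee// add0e.
exists pass, dens; split => //.
- split => //; first by move=> v y; exact: law_densityN.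
  move=> v v0; transitivity (\int[mu]_y (cst 1 y * dens v y))%E.
    by apply: eq_integral => y _; rewrite mul1e.
  by rewrite -(densE v (cst 1%E) v0)// integral_cst// mul1e; exact: probability_setT.
- split.
  + apply/measurable_EFinP; rewrite (_ : EFin \o _ = ltail n); last by apply/funext => z; rewrite /= tE.
    exact: measurable_ltail.
  + move=> t v v0; rewrite /pass /passage (densE v (fun y => ltail n (t - y)) v0).
    * by apply: eq_integral => y _; rewrite tE.
    * have mt := measurable_ltail mn n0; by meas.
    * by move=> r; exact: ltail_ge0.
  + move=> v v0; have E := laplace_passage mn n0 nN nf mX XL (@ltr01 R) (ltW v0).
    apply: (@le_trans _ _ (\int[mu]_r ((expR (- (1 * r)))%:E * pass r v))%E).
      by rewrite le_eqVlt; apply/orP; left; apply/eqP; apply: eq_integral => r _; rewrite mul1r.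
    rewrite E lee_fin divr1 ler_piMl ?(ltW f1)// expR_le1 oppr_le0 mulr_ge0 ?ltW//.
  + move=> v v0; transitivity (\int[P]_w (ind (X v w <= 0)%R * cst 1 w))%E.
      rewrite integral_ind_itv (_ : [set w | X v w <= 0] = [set w | D v w <= 0]); last first.
        by apply/seteqP; split => w; rewrite /= /X (max_l (ltW v0)).
      rewrite integral_cst ?mul1e// (_ : [set w | _] = ~` [set w | 0 < D v w]); last first.
        by apply/seteqP; split => w /=; rewrite leNgt => /negP.
      by apply: measurableC; exact: (measurable_above D 0 v).
    transitivity (\int[P]_w ind (X v w <= 0)%R)%E.
      by apply: eq_integral => w _; rewrite mule1.
    rewrite (densE v (fun y => ind (y <= 0)) v0); [|by meas|by move=> r; exact: ind_ge0].
    apply: integral0_eq => y _; rewrite ind_mul; case: ifP => // y0.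
    exact: law_densityN.
Qed.

End first_passage.

(** * State probabilities of the counting process *)

Lemma littleo_slope (R : realType) (A : R -> R) :
  A =o_ (0^'+) (fun h : R => h) -> A h / h @[h --> 0^'+] --> (0 : R).
Proof.
move=> /eqoP Ao; apply/cvgr0Pnorm_le => e e0.
have := Ao e e0; apply: filter_app; near=> h => H.
have h0 : 0 < h by near: h; exact: nbhs_right_gt.
rewrite normrM normfV (gtr0_norm h0) ler_pdivrMr//.
by move: H; rewrite (gtr0_norm h0).
Unshelve. all: by end_near. Qed.

Section ngcp_pmf.
Context (R : realType) (d : measure_display) (T : measurableType d) (P : probability T R)
    (k : nat) (lam : nat -> R -> R) (M : R -> {RV P >-> nat}).
Hypotheses (Hlam : forall j, (1 <= j <= k)%N -> intensity (lam j)) (HM : ngcp k lam M).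
Local Notation mu := (@lebesgue_measure R).
Local Notation q := (fun n u => prob_eq P (M u) n).
Local Notation r := (forward_rhs k lam q).

Lemma measurable_count u (A : set nat) : measurable (M u @^-1` A).
Proof. by rewrite -[X in measurable X]setTI; exact: measurable_funP. Qed.

Lemma measurable_count_eq u n : measurable [set w | M u w = n].
Proof. exact: (measurable_count u [set n]). Qed.

Lemma state_probE u n : (q n u)%:E = P [set w | M u w = n].
Proof. by rewrite /prob_eq fineK// fin_num_measure//; exact: measurable_count_eq. Qed.

Lemma state_prob_ge0 u n : 0 <= q n u.
Proof. by rewrite fine_ge0. Qed.

(** Unlike conditional probabilities, joint ones make sense also from a negligible state. *)
Let joint n m u h := fine (P ([set w | M (u + h) w = n] `&` [set w | M u w = m])).

Let joint0 n m u h : q m u = 0 -> joint n m u h = 0.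
Proof.
move=> q0; have E : P [set w | M u w = m] = 0%E by rewrite -state_probE q0.
rewrite /joint (subset_measure0 _ _ _ E)//; last exact: measurable_count_eq.
by apply: measurableI; exact: measurable_count_eq.
Qed.

Let jointE n m u h : joint n m u h = q m u * condP P [set w | M (u + h) w = n] [set w | M u w = m].
Proof.
rewrite /condP; have [q0|q0] := eqVneq (q m u) 0; first by rewrite q0 mul0r joint0.
by rewrite mulrC divfK.
Qed.

(** The paths are nondecreasing: only values up to n lead to n, and the sum is finite. *)
Let state_prob_split n u h : 0 <= u -> 0 <= h -> q n (u + h) = \sum_(m < n.+1) joint n m u h.
Proof.
move=> u0 h0; apply/EFin_inj; rewrite state_probE -sumEFin.
have E (m : 'I_n.+1) : (joint n m u h)%:E = P ([set w | M (u + h) w = n] `&` [set w | M u w = m]).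
  by rewrite /joint fineK// fin_num_measure//; apply: measurableI; exact: measurable_count_eq.
under eq_bigr do rewrite E.
rewrite -measure_semi_additive_ord.
- rewrite -(bigcup_mkord n.+1 (fun m => [set w | M (u + h) w = n] `&` [set w | M u w = m])).
  congr (P _); apply/seteqP; split => [w /= Mw|w [m _ []]//].
  exists (M u w) => //=; rewrite ltnS -Mw; apply: (ngcp_homo HM); rewrite ?lerDl//.
- by move=> m; apply: measurableI; exact: measurable_count_eq.
- apply/trivIsetP => i j _ _ ij; apply/seteqP; split => // w /= [[_ ->] [_ /val_inj]].
  by move=> /eqP; rewrite (negbTE ij).
- by apply: bigsetU_measurable => m _; apply: measurableI; exact: measurable_count_eq.
Qed.

(** The three kinds of transition of the infinitesimal description, from m to n >= m. *)
Definition jump_rate (n m : nat) (u : R) : R :=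
  if m == n then - \sum_(1 <= j < k.+1) lam j u
  else if (n - m <= k)%N then lam (n - m)%N u else 0.

(** The three infinitesimal conditions, read as the derivatives at h = 0+ of the transition
    probabilities. *)
Let cond_slope n m u : 0 <= u -> (m <= n)%N -> q m u != 0 ->
  (condP P [set w | M (u + h) w = n] [set w | M u w = m] - (m == n)%:R) / h @[h --> 0^'+] -->
    jump_rate n m u.
Proof.
move=> u0 mn q0.
have Pm : P [set w | M u w = m] != 0%E by rewrite -state_probE eqe.
have key (c : R) (A B : R -> R) : B =o_ (0^'+) (fun h : R => h) ->
    (forall h, A h - c * h = B h) -> A h / h @[h --> 0^'+] --> c.
  move=> /littleo_slope H AB; rewrite -[c]add0r.
  have : B h / h + c @[h --> 0^'+] --> 0 + c by apply: cvgD => //; exact: cvg_cst.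
  apply: cvg_trans; apply: near_eq_cvg; near=> h.
  have h0 : 0 < h by near: h; exact: nbhs_right_gt.
  by rewrite -AB mulrBl mulfK ?gt_eqF// subrK.
rewrite /jump_rate; have [mEn|mn'] := eqVneq m n.
  subst n; apply: key; first exact: (ngcp_stay HM u0 Pm).
  by move=> h /=; ring.
have {mn'}mn' : (m < n)%N by rewrite ltn_neqAle mn'.
under eq_fun do rewrite subr0.
case: ifPn => nmk.
  apply: key; first apply: (@ngcp_jump _ _ _ _ _ _ _ HM u m (n - m) u0 Pm).
    by rewrite subn_gt0 mn' nmk.
  by move=> h; rewrite subnKC// ltnW.
apply: littleo_slope; apply: (ngcp_large HM u0 Pm).
by rewrite -ltnNge in nmk; rewrite -ltn_subRL.
Unshelve. all: by end_near. Qed.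

Let rate_sum n u : \sum_(m < n.+1) q m u * jump_rate n m u = r n u.
Proof.
rewrite big_ord_recr /= /jump_rate eqxx /forward_rhs addrC.
congr (_ + _).
  by rewrite mulrN mulr_sumr; congr (- _); apply: eq_bigr => j _; rewrite mulrC.
rewrite -(big_mkord predT (fun m => q m u * (if m == n then - \sum_(1 <= j < k.+1) lam j u
  else if (n - m <= k)%N then lam (n - m)%N u else 0))).
rewrite big_nat_rev /= add0n [RHS]big_add1 /= (big_nat_widen _ _ _ _ _ (geq_minl n k)).
rewrite [RHS]big_mkcond [LHS]big_nat_cond [RHS]big_nat_cond.
apply: eq_bigr => i /andP[/andP[_ ilt] _].
rewrite leq_min ilt /= subKn// ltn_eqF; last by rewrite ltn_subrL (leq_trans _ ilt).
by case: ifP => _; rewrite ?mulr0// mulrC.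
Qed.

(** The infinitesimal conditions concern h > 0 at a fixed time, so they give a derivative on
    the right only. *)
Lemma state_prob_right_derivative n u : 0 <= u ->
  (q n (u + h) - q n u) / h @[h --> 0^'+] --> r n u.
Proof.
move=> u0; rewrite -rate_sum.
have : \sum_(m < n.+1) (q m u * ((condP P [set w | M (u + h) w = n] [set w | M u w = m] - ((m : nat) == n)%:R) / h))
    @[h --> 0^'+] --> \sum_(m < n.+1) q m u * jump_rate n m u.
  apply: cvg_big => [|m _]; first exact: add_continuous.
  have [->|qm] := eqVneq (q m u) 0.
    by under eq_fun do rewrite mul0r; rewrite mul0r; exact: cvg_cst.
  by apply: cvgMr; apply: cond_slope => //; rewrite -ltnS.
apply: cvg_trans; apply: near_eq_cvg; near=> h.
have h0 : 0 < h by near: h; exact: nbhs_right_gt.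
rewrite state_prob_split// ?(ltW h0)//.
have -> : q n u = \sum_(m < n.+1) q m u * ((m : nat) == n)%:R.
  rewrite big_ord_recr /= eqxx mulr1 big1 ?add0r// => m _.
  by rewrite (ltn_eqF (ltn_ord m)) mulr0.
rewrite -sumrB mulr_suml; apply: eq_bigr => m _.
by rewrite jointE mulrA mulrBr.
Unshelve. all: by end_near. Qed.

Lemma state_prob_start n : q n 0 = (n == 0%N)%:R.
Proof.
apply/EFin_inj; rewrite state_probE; have [->|n0] := eqVneq n 0%N.
  rewrite (_ : [set w | _] = setT) ?probability_setT//.
  by apply/seteqP; split => // w _ /=; exact: (ngcp_start HM).
rewrite (_ : [set w | _] = set0) ?measure0//.
by apply/seteqP; split => // w /=; rewrite (ngcp_start HM) => /esym/eqP; rewrite (negbTE n0).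
Qed.

Let state_prob_dist n u v : 0 <= u -> 0 <= v ->
  `|q n u - q n v| <= fine (P [set w | M u w != M v w]).
Proof.
move=> u0 v0.
have mne a b : measurable [set w | M a w != M b w].
  rewrite (_ : [set w | _] = \bigcup_j ([set w | M a w = j] `&` ~` [set w | M b w = j])).
    apply: bigcupT_measurable => j; apply: measurableI; first exact: measurable_count_eq.
    by apply: measurableC; exact: measurable_count_eq.
  apply/seteqP; split => w /=; first by move=> /eqP ne; exists (M a w) => //; split => // /esym.
  by move=> [j _ [/= <- /eqP]]; rewrite eq_sym.
have le a b : q n a <= q n b + fine (P [set w | M a w != M b w]).
  rewrite -lee_fin EFinD !state_probE fineK; last by rewrite fin_num_measure.
  apply: (@le_trans _ _ (P ([set w | M b w = n] `|` [set w | M a w != M b w]))); last by apply: measureU2; [exact: measurable_count_eq|exact: mne].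
  apply: le_measure; rewrite ?inE.
  - exact: measurable_count_eq.
  - by apply: measurableU => //; exact: measurable_count_eq.
  - move=> w /= Ma; have [Mab|] := eqVneq (M a w) (M b w); last by right.
    by left; rewrite -Mab.
have ne_sym : [set w | M v w != M u w] = [set w | M u w != M v w].
  by apply/seteqP; split => w /=; rewrite eq_sym.
have h1 := le u v; have h2 := le v u; rewrite ne_sym in h2.
by rewrite ler_norml; apply/andP; split; lra.
Qed.

(** From the continuity in probability: the paths are only right-continuous. *)
Lemma state_prob_continuous n : continuous (fun u : R => q n (Num.max u 0)).
Proof.
move=> x; have x0 : 0 <= Num.max x 0 by rewrite le_max lexx orbT.
have cmax : Num.max u 0 @[u --> x] --> within [set s : R | 0 <= s] (nbhs (Num.max x 0)).
  move=> A; rewrite /= /within /= => H.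
  have c : Num.max u 0 @[u --> x] --> Num.max x 0.
    by apply: continuous_max; [exact: cvg_id|exact: cvg_cst].
  have := c _ H; rewrite /= !near_simpl; apply: filterS => u /=.
  by apply; rewrite le_max lexx orbT.
have := ngcp_cont HM x0 => /fine_cvg /= H0.
have {H0} := cvg_comp _ _ cmax H0 => /= H0.
apply/cvgrPdist_le => e e0; move/cvgrPdist_le : H0 => /(_ e e0).
apply: filterS => u /=; rewrite sub0r normrN ger0_norm ?fine_ge0// => H.
rewrite distrC; apply: le_trans H.
by apply: state_prob_dist => //; rewrite le_max lexx orbT.
Qed.

Lemma measurable_state_prob n : measurable_fun setT (fun u : R => q n (Num.max u 0)).
Proof. by apply: continuous_measurable_fun; exact: state_prob_continuous. Qed.

Let measurable_intensity j : (1 <= j <= k)%N ->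
  measurable_fun setT (fun u : R => lam j (Num.max u 0)).
Proof.
move=> jk; have [ml _ _] := Hlam jk.
apply: (measurable_comp (measurable_itv `[0, +oo[) _ ml).
- by move=> _ [u _ <-] /=; rewrite in_itv/= andbT le_max lexx orbT.
- exact: measurable_maxr.
Qed.

Lemma measurable_forward n : measurable_fun setT (fun u : R => r n (Num.max u 0)).
Proof.
pose l j u := if (1 <= j <= k)%N then lam j (Num.max u 0) else 0.
have ml j : measurable_fun setT (l j).
  by have := @measurable_intensity j; rewrite /l; case: (1 <= j <= k)%N => // H; exact: H.
pose s1 u := \sum_(1 <= j < k.+1) l j u * q n (Num.max u 0).
pose s2 u := \sum_(1 <= j < (minn n k).+1) l j u * q (n - j)%N (Num.max u 0).
rewrite (_ : (fun u => r n (Num.max u 0)) = (fun u => - s1 u + s2 u)).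
  apply: measurable_funD; first apply: measurable_funN.
  - by apply: measurable_sum => j; apply: measurable_funM => //; exact: measurable_state_prob.
  - by apply: measurable_sum => j; apply: measurable_funM => //; exact: measurable_state_prob.
apply/funext => u; rewrite /s1 /s2 /forward_rhs /l; congr (- _ + _).
  by apply: eq_big_nat => j; rewrite ltnS => ->.
apply: eq_big_nat => j; rewrite ltnS leq_min => /andP[j1 /andP[_ jk]].
by rewrite j1 jk.
Qed.

(** The probability P(M u < n) is nonincreasing in u, which the probabilities of single
    states are not; right_derivative_integral needs a monotone function. *)
Let S n u := \sum_(m < n) q m u.

Let cumulatedE n u : (S n u)%:E = P [set w | (M u w < n)%N].
Proof.
rewrite -sumEFin; under eq_bigr do rewrite state_probE.
rewrite -measure_semi_additive_ord.
- rewrite -(bigcup_mkord n (fun m => [set w | M u w = m])); congr (P _).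
  by apply/seteqP; split => [w [m /= mn ->]//|w /= Mn]; exists (M u w).
- by move=> m; exact: measurable_count_eq.
- apply/trivIsetP => i j _ _ ij; apply/seteqP; split => // w /= [-> /val_inj].
  by move=> /eqP; rewrite (negbTE ij).
- by apply: bigsetU_measurable => m _; exact: measurable_count_eq.
Qed.

Let cumulated_le1 n u : 0 <= S n u <= 1.
Proof.
rewrite sumr_ge0/=; last by move=> m _; exact: state_prob_ge0.
rewrite -lee_fin cumulatedE; apply: probability_le1.
exact: (measurable_count u [set m | (m < n)%N]).
Qed.

Let cumulated_homo n u v : 0 <= u -> u <= v -> S n v <= S n u.
Proof.
move=> u0 uv; rewrite -lee_fin !cumulatedE; apply: le_measure; rewrite ?inE.
- exact: (measurable_count v [set m | (m < n)%N]).
- exact: (measurable_count u [set m | (m < n)%N]).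
- by move=> w /=; apply: leq_ltn_trans; exact: (ngcp_homo HM).
Qed.

(** The right derivative of 1 - P(M u < n), extended by 0 to the negative times, where the
    process is stopped at its initial value. *)
Let G n u := - \sum_(m < n) (if 0 <= u then r m (Num.max u 0) else 0).

Let cumulated_right_derivative n x :
  (- S n (Num.max (x + h) 0) - (- S n (Num.max x 0))) / h @[h --> 0^'+] --> G n x.
Proof.
rewrite /G -[X in _ --> X]sumrN; have [x0|x0] := leP 0 x.
  have : \sum_(m < n) - ((q m (x + h) - q m x) / h) @[h --> 0^'+] --> \sum_(m < n) - r m x.
    apply: cvg_big => [|m _]; first exact: add_continuous.
    by apply: cvgN; exact: state_prob_right_derivative.
  apply: cvg_trans; apply: near_eq_cvg; near=> h.
  have h0 : 0 < h by near: h; exact: nbhs_right_gt.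
  rewrite !max_l ?addr_ge0 ?(ltW h0)// /S -opprD -sumrB mulNr mulr_suml -sumrN.
  by apply: eq_bigr => m _.
rewrite big1 => [|m _]; last by rewrite oppr0.
apply: cvg_near_cst; near=> h.
have hx : h <= - x by near: h; apply: nbhs_right_le; rewrite oppr_gt0.
rewrite max_r ?subrr ?mul0r//.
by rewrite -lerBrDl sub0r.
Unshelve. all: by end_near. Qed.

Let cumulated_integral n (b : R) : 0 < b ->
  mu.-integrable `]0, b] (EFin \o G n) /\
  (S n 0 - S n b)%:E = (\int[mu]_(x in `]0%R, b]) (G n x)%:E)%E.
Proof.
move=> b0; pose F x := - S n (Num.max x 0).
have ndF : {homo F : x y / x <= y}.
  move=> x y xy; rewrite lerN2; apply: cumulated_homo; first by rewrite le_max lexx orbT.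
  by rewrite ge_max !le_max xy lexx orbT.
have cF : continuous F.
  move=> x; apply: cvgN; apply: cvg_big => [|m _]; first exact: add_continuous.
  exact: state_prob_continuous.
have mG : measurable_fun setT (G n).
  apply: measurable_funN; apply: measurable_sum => m.
  apply: measurable_fun_ifT => //; last exact: measurable_forward.
  exact: measurable_fun_ler.
have [intG E] := right_derivative_integral ndF cF b0 (@cumulated_right_derivative n) mG.
by split => //; rewrite -E /F (max_l (ltW b0)) (max_l (lexx 0)) opprK addrC.
Qed.

Let G_ge0 n x : 0 <= G n x.
Proof.
have H := @cumulated_right_derivative n x.
rewrite -(cvg_lim (@Rhausdorff R) H); apply: limr_ge; first by apply/cvg_ex; exists (G n x).
near=> h; have h0 : 0 < h by near: h; exact: nbhs_right_gt.
apply: divr_ge0; last exact: ltW.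
rewrite subr_ge0 lerN2; apply: cumulated_homo; first by rewrite le_max lexx orbT.
by rewrite ge_max; apply/andP; split; rewrite le_max ?lerDl ?(ltW h0) ?lexx ?orbT.
Unshelve. all: by end_near. Qed.

Let measurable_G n : measurable_fun setT (G n).
Proof.
apply: measurable_funN; apply: measurable_sum => m.
apply: measurable_fun_ifT => //; last exact: measurable_forward.
exact: measurable_fun_ler.
Qed.

(** A nonnegative function whose integrals over the intervals ]0, m] are increments of a
    probability, hence at most 1. *)
Let G_integrable n : mu.-integrable `]0, +oo[ (EFin \o G n).
Proof.
have mI (b : R) : measurable (`]0, b]%classic : set (measurableTypeR R)) by exact: measurable_itv.
apply/integrableP; split; first by apply/measurable_EFinP; apply: measurable_funTS; exact: measurable_G.
have -> : (\int[mu]_(x in `]0%R, +oo[) `|(EFin \o G n) x| = \int[mu]_(x in `]0%R, +oo[) (G n x)%:E)%E.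
  by apply: eq_integral => x _; rewrite /= ger0_norm.
apply: (@le_lt_trans _ _ 1%E); last exact: ltry.
pose F (m : nat) : set (measurableTypeR R) := `]0, m%:R]%classic.
have UF : \bigcup_m F m = `]0, +oo[%classic.
  apply/seteqP; split => x; rewrite /F /= in_itv/= ?andbT; first by move=> [m _]; rewrite /= in_itv/= => /andP[].
  move=> x0; exists (Num.trunc x).+1 => //=; by rewrite in_itv/= x0 ltW// truncnS_gt.
rewrite -UF.
have H : (\int[mu]_(x in F m) (G n x)%:E @[m --> \oo] --> \int[mu]_(x in \bigcup_m F m) (G n x)%:E)%E.
  apply: ge0_nondecreasing_set_cvg_integral.
  - move=> a b ab; apply/subsetPset => x; rewrite /F /= !in_itv/= => /andP[-> /le_trans]; apply.
    by rewrite ler_nat.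
  - by move=> m; exact: mI.
  - by move=> m; apply/measurable_EFinP; apply: measurable_funTS; exact: measurable_G.
  - by move=> m x _; rewrite lee_fin.
rewrite -(cvg_lim _ H)//; apply: lime_le; first by apply/cvg_ex; eexists; exact: H.
apply: nearW => -[|m]; first by rewrite /F set_itvoc0 integral_set0.
have [_ <-] := @cumulated_integral n m.+1%:R (ltr0Sn _ _).
have /andP[a0 a1] := cumulated_le1 n 0; have /andP[b0 b1] := cumulated_le1 n m.+1%:R.
by rewrite lee_fin; lra.
Qed.

(** The right-hand side of the forward equation is the difference of two consecutive G. *)
Lemma forward_integrable n : mu.-integrable `]0, +oo[ (EFin \o r n).
Proof.
have mI : measurable (`]0, +oo[%classic : set (measurableTypeR R)) by exact: measurable_itv.
have := integrableB mI (G_integrable n) (G_integrable n.+1).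
apply: eq_integrable => // x; rewrite inE/= in_itv/= andbT => x0.
rewrite /G big_ord_recr /= (ltW x0) (max_l (ltW x0)) -EFinB; congr EFin; ring.
Qed.

(** The integrated forward equation, as the difference of the integrals of two consecutive G. *)
Lemma state_prob_integral n u : 0 <= u ->
  (q n u)%:E = ((n == 0%N)%:R%:E + \int[mu]_(x in `]0%R, u]) (r n x)%:E)%E.
Proof.
rewrite le_eqVlt => /orP[/eqP <-|u0].
  by rewrite state_prob_start set_itvoc0 integral_set0 adde0.
have [i1 E1] := cumulated_integral n u0.
have [i2 E2] := cumulated_integral n.+1 u0.
have mI : measurable (`]0, u]%classic : set (measurableTypeR R)) by exact: measurable_itv.
have -> : (\int[mu]_(x in `]0%R, u]) (r n x)%:E = \int[mu]_(x in `]0%R, u]) ((G n x)%:E - (G n.+1 x)%:E))%E.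
  apply: eq_integral => x; rewrite inE/= in_itv/= => /andP[x0 _].
  rewrite /G big_ord_recr /= (ltW x0) (max_l (ltW x0)) -EFinB; congr EFin; ring.
rewrite integralB// -E1 -E2 -EFinB -EFinD; congr EFin.
rewrite /S !big_ord_recr/= state_prob_start; ring.
Qed.

End ngcp_pmf.

(** * The change of time *)

Section time_change.
Context (R : realType) (d : measure_display) (T : measurableType d) (P : probability T R)
    (k : nat) (lam : nat -> R -> R) (M : R -> {RV P >-> nat}) (Y : R -> T -> R) (t : R).
Hypotheses (HM : ngcp k lam M) (HMY : independent_processes P M Y)
  (mY : measurable_fun setT (Y t)) (Y0 : forall w, 0 <= Y t w) (t0 : 0 <= t).
Local Notation q := (fun n u => prob_eq P (M u) n).
Local Notation idx m w := (time_index m (Y t w)).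

Let midx m j : measurable [set w | idx m w = j].
Proof.
have mj : measurable ([set v : R | time_index m v = j]) by exact: measurable_time_index.
have := mY measurableT mj; rewrite setTI.
by rewrite (_ : Y t @^-1` _ = [set w | idx m w = j]).
Qed.

Let grid_state n w :
  \forall m \near \oo, (M (grid_time R m (idx m w)) w == n) = (M (Y t w) w == n).
Proof.
have := cvg_comp _ _ (cvg_grid_time (Y0 w)) (@ngcp_rcont _ _ _ _ _ _ _ HM w _ (Y0 w)).
move=> /(_ _ (discrete_set1 _)); rewrite /= !near_simpl.
by apply: filterS => m /= ->.
Qed.

Let Z n m (w : T) : R := (M (grid_time R m (idx m w)) w == n)%:R.

Let mem_state u n w : (w \in [set w | M u w = n]) = (M u w == n).
Proof. by apply/idP/eqP; rewrite inE. Qed.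

Let mZ n m : measurable_fun setT (Z n m).
Proof.
have H := @measurable_countable_choice _ _ T R (fun w => idx m w)
  (fun j w => (M (grid_time R m j) w == n)%:R) (midx m).
apply: H => j.
rewrite (_ : (fun w => _) = \1_[set w | M (grid_time R m j) w = n]).
  by apply: measurable_indic; exact: measurable_count_eq.
by apply/funext => w; rewrite indicE mem_state.
Qed.

Let cvg_Z n w : Z n m w @[m --> \oo] --> ((M (Y t w) w == n)%:R : R).
Proof.
apply: cvg_near_cst; have := grid_state n w.
by apply: filterS => m; rewrite /Z => ->.
Qed.

Lemma measurable_time_changed n : measurable [set w | M (Y t w) w = n].
Proof.
have mf := @measurable_fun_cvg _ T R setT (Z n) (fun w => (M (Y t w) w == n)%:R) (mZ n) (fun w _ => @cvg_Z n w).
have := mf measurableT [set 1] (measurable_set1 1); rewrite setTI.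
congr (measurable _); apply/seteqP; split => w /=; last by move=> ->; rewrite eqxx.
by have [//|_ /eqP] := eqVneq; rewrite eq_sym oner_eq0.
Qed.

(** When Y t is replaced by the times of a grid, the event splits into countably many
    intersections of an event of M at a fixed time with an event of Y t. *)
Let grid_mixture n m :
  (\int[P]_w (Z n m w)%:E = \int[P]_w (q n (grid_time R m (idx m w)))%:E)%E.
Proof.
pose B j := [set w | idx m w = j].
have UB : \bigcup_j B j = setT by apply/seteqP; split => // w _; exists (idx m w).
have tB : trivIset setT B.
  by apply/trivIsetP => i j _ _ ij; apply/seteqP; split => // w [Bi Bj]; move: ij; rewrite -Bi -Bj eqxx.
have split_int (g : T -> \bar R) : measurable_fun setT g -> (forall w, 0 <= g w)%E ->
    (\int[P]_w g w = \sum_(j <oo) \int[P]_(w in B j) g w)%E.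
  move=> mg g0; rewrite -UB ge0_integral_bigcup//.
  - by move=> j; exact: midx.
  - by rewrite UB.
rewrite (split_int (fun w => (Z n m w)%:E)); last 2 first.
- by apply/measurable_EFinP; exact: mZ.
- by move=> w; rewrite lee_fin ler0n.
rewrite (split_int (fun w => (q n (grid_time R m (idx m w)))%:E)); last 2 first.
- apply/measurable_EFinP.
  exact: (@measurable_countable_choice _ _ T R (fun w => idx m w)
    (fun j _ => q n (grid_time R m j)) (midx m)).
- by move=> w; rewrite lee_fin; exact: state_prob_ge0.
apply: eq_eseriesr => j _.
transitivity (\int[P]_(w in B j) (\1_[set w | M (grid_time R m j) w = n] w)%:E)%E.
  apply: eq_integral => w; rewrite inE /B /= => jE; by rewrite /Z jE indicE mem_state.
rewrite integral_indic//; last exact: measurable_count_eq.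
transitivity (\int[P]_(w in B j) (cst (q n (grid_time R m j))%:E w))%E; last first.
  by apply: eq_integral => w; rewrite inE /B /= => ->.
rewrite integral_cst; last exact: midx.
rewrite state_probE; apply: HMY; apply: sub_gen_smallest.
- exists (grid_time R m j), [set n]; split => //; exact: grid_time_ge0.
- by exists t, [set v | time_index m v = j]; split => //; exact: measurable_time_index.
- exact: midx.
Qed.

(** Limit of grid_mixture by dominated convergence: the process is right-continuous and
    its state probabilities are continuous. *)
Lemma time_changed_prob n :
  P [set w | M (Y t w) w = n] = (\int[P]_w (q n (Y t w))%:E)%E.
Proof.
have mE := measurable_time_changed n.
have b1 (x : R) : 0 <= x <= 1 -> (`|x%:E| <= cst 1 x)%E.
  by move=> /andP[x0 x1]; rewrite lee_fin ger0_norm.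
have int1 : P.-integrable setT (cst 1%E).
  by apply/integrableP; split => //; under eq_integral do rewrite gee0_abs//; rewrite integral_cst// mul1e; apply: (le_lt_trans (probability_le1 P measurableT)); rewrite ltry.
have L1 : (\int[P]_w (Z n m w)%:E @[m --> \oo] --> \int[P]_w ((M (Y t w) w == n)%:R)%:E)%E.
  have [] := @dominated_convergence _ T R P setT measurableT (fun m w => (Z n m w)%:E)
    (fun w => ((M (Y t w) w == n)%:R)%:E) (cst 1%E) => //.
  - by move=> m; apply/measurable_EFinP; exact: mZ.
  - apply/measurable_EFinP; exact: (@measurable_fun_cvg _ T R setT (Z n) (fun w => (M (Y t w) w == n)%:R) (mZ n) (fun w _ => @cvg_Z n w)).
  - by apply: aeW => w _; apply/cvg_EFin; [exact: nearW|exact: cvg_Z].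
  - by apply: aeW => w m _; rewrite lee_fin normr_nat lern1 leq_b1.
have q01 u : 0 <= q n u <= 1.
  rewrite state_prob_ge0/= -lee_fin state_probE; apply: probability_le1; exact: measurable_count_eq.
have mq := measurable_state_prob HM n.
have qY : (fun w => q n (Y t w)) = (fun w => q n (Num.max (Y t w) 0)).
  by apply/funext => w; rewrite max_l.
have mqY : measurable_fun setT (fun w => q n (Y t w)) by rewrite qY; exact: (measurableT_comp mq mY).
have L2 : (\int[P]_w (q n (grid_time R m (idx m w)))%:E @[m --> \oo] --> \int[P]_w (q n (Y t w))%:E)%E.
  have [] := @dominated_convergence _ T R P setT measurableT
    (fun m w => (q n (grid_time R m (idx m w)))%:E)
    (fun w => (q n (Y t w))%:E) (cst 1%E) => //.
  - move=> m; apply/measurable_EFinP.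
    exact: (@measurable_countable_choice _ _ T R (fun w => idx m w)
      (fun j _ => q n (grid_time R m j)) (midx m)).
  - by apply/measurable_EFinP.
  - apply: aeW => w _; apply/cvg_EFin; first exact: nearW.
    have cg : grid_time R m (idx m w) @[m --> \oo] --> Y t w.
      by apply: cvg_trans (cvg_grid_time (Y0 w)) _; exact: cvg_within.
    have := cvg_comp _ _ cg (@state_prob_continuous _ _ _ _ _ _ _ HM n (Y t w)).
    rewrite max_l//; apply: cvg_trans; apply: near_eq_cvg; apply: nearW => m /=.
    by rewrite max_l// grid_time_ge0.
  - by apply: aeW => w m _; rewrite lee_fin; have /andP[h0 h1] := q01 (grid_time R m (idx m w)); rewrite ger0_norm.
transitivity (\int[P]_w ((M (Y t w) w == n)%:R)%:E)%E.
  rewrite -[X in P X]setIT -integral_indic//; apply: eq_integral => w _.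
  rewrite indicE; have -> // : (w \in [set w0 | M (Y t w0) w0 = n]) = (M (Y t w) w == n).
  by apply/idP/eqP; rewrite inE.
have E : (fun m => \int[P]_w (Z n m w)%:E)%E = (fun m => \int[P]_w (q n (grid_time R m (idx m w)))%:E)%E.
  by apply/funext => m; exact: grid_mixture.
rewrite E in L1.
exact: (cvg_unique _ L1 L2).
Qed.

End time_change.

(** * The Caputo derivative of the state probabilities *)

Section almost_everywhere.
Context d (T : measurableType d) (R : realType) (m : {measure set T -> \bar R}).

Import HBNNSimple.

(** The functions need not be measurable: a simple function below one of them is
    below the other one once it is killed on the null set. *)
Lemma ge0_integral_null_le (f g : T -> \bar R) (N : set T) : measurable N -> m N = 0%E ->
  (forall x, 0 <= f x)%E -> (forall x, 0 <= g x)%E -> (forall x, ~ N x -> f x = g x) ->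
  (\int[m]_x f x <= \int[m]_x g x)%E.
Proof.
move=> mN N0 f0 g0 fg; rewrite !ge0_integralTE//; apply: ub_ereal_sup => _ [h /= hf <-].
pose h' := proj_nnsfun h (measurableC mN).
have -> : sintegral m h = sintegral m h'.
  have sE (u : {nnsfun T >-> R}) : sintegral m u = (\int[m]_x (u x)%:E)%E.
    by rewrite integral_nnsfun// patch_setT.
  rewrite !sE; apply: ge0_ae_eq_integral => //.
  - by apply/measurable_EFinP.
  - by apply/measurable_EFinP.
  - by move=> x _; rewrite lee_fin.
  - by move=> x _; rewrite lee_fin.
  - exists N; split => // x /= H; apply: contrapT => Nx; apply: H => _.
    by rewrite /= mindicE mem_set// mulr1.
apply: ereal_sup_ubound; exists h' => //= x.
rewrite mindicE; case: (boolP (x \in ~` N)) => [|_]; last by rewrite mulr0.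
by rewrite inE /= => Nx; rewrite mulr1 -fg.
Qed.

(** The function r |-> u (r - x) has no derivative for the x of a null set, where its formal
    derivative is an arbitrary value, not known to be measurable in x: the integral of
    Caputo's derivative must be compared with a measurable one without measurability. *)
Lemma integral_null (f g : T -> \bar R) (D N : set T) : measurable N -> m N = 0%E ->
  (forall x, D x -> ~ N x -> f x = g x) ->
  (\int[m]_(x in D) f x = \int[m]_(x in D) g x)%E.
Proof.
move=> mN N0 fg; rewrite integral_mkcond [RHS]integral_mkcond.
have E x : ~ N x -> (f \_ D) x = (g \_ D) x.
  by move=> Nx; rewrite !patchE; case: ifPn => // /set_mem Dx; exact: fg.
have H (u v : T -> \bar R) : (forall x, 0 <= u x)%E -> (forall x, 0 <= v x)%E ->
    (forall x, ~ N x -> u x = v x) -> (\int[m]_x u x = \int[m]_x v x)%E.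
  move=> u0 v0 uv; apply/eqP; rewrite eq_le.
  by rewrite (ge0_integral_null_le mN N0 u0 v0 uv) (ge0_integral_null_le mN N0 v0 u0)// => x /uv.
rewrite integralE [RHS]integralE; congr (_ - _)%E; apply: H => // x Nx.
- by rewrite !funeposE E.
- by rewrite !funenegE E.
Qed.

End almost_everywhere.

Section calculus.
Context (R : realType).
Local Notation mu := (@lebesgue_measure R).

Lemma integral_ind_sub (b : R -> bool) (A B : set R) (phi : R -> \bar R) :
  (forall x, A x <-> B x /\ b x) ->
  (\int[mu]_(x in A) phi x = \int[mu]_(x in B) (ind (b x) * phi x))%E.
Proof.
move=> AB; rewrite integral_mkcond [RHS]integral_mkcond; apply: eq_integral => x _.
rewrite !patchE ind_mul; case: ifPn => [/set_mem /AB[Bx bx]|nA].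
  by rewrite mem_set// bx.
case: ifPn => // /set_mem Bx; case: ifP => // bx.
by move: nA; rewrite mem_set//; apply/AB.
Qed.

(** The integral of |g| over a set is small when the measure of the set is. *)
Lemma abs_continuous_integral (g u : R -> R) (a b : R) :
  mu.-integrable setT (EFin \o g) ->
  (forall x y, a <= x -> x <= y -> u y - u x = (\int[mu]_(z in `]x, y]) g z)%R) ->
  abs_continuous_on a b u.
Proof.
move=> ig ug e e0; have [d [d0 Hd]] := integral_normr_continuous ig e0.
exists d => // n x y xy tI sum_lt.
pose F (i : 'I_n) : set (measurableTypeR R) := `]x i, y i[%classic.
have mF i : measurable (F i) by exact: measurable_itv.
pose U := \big[setU/set0]_(i < n) F i.
have mU : measurable U by exact: bigsetU_measurable.
have igA (A : set (measurableTypeR R)) : measurable A -> mu.-integrable A (EFin \o g).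
  by move=> mA; apply: integrableS ig.
have muU : (mu U < d%:E)%E.
  rewrite (@measure_semi_additive_ord _ _ _ mu n F)//.
  apply: (@le_lt_trans _ _ (\sum_(i < n) (y i - x i)%:E)%E); last by rewrite sumEFin lte_fin.
  apply: lee_sum => i _; rewrite [leLHS](lebesgue_measure_itv `]x i, y i[)/= lte_fin.
  by case: ifP => // _; rewrite lee_fin subr_ge0; have [_ []] := xy i.
apply: le_lt_trans (Hd U mU muU).
have fin (A : set (measurableTypeR R)) : measurable A ->
    ((\int[mu]_(z in A) `|g z|)%R)%:E = (\int[mu]_(z in A) (`|g z|)%:E)%E.
  move=> mA; rewrite /Rintegral fineK//; apply: integrable_fin_num => //.
  by apply: integrableS (integrable_abse ig).
rewrite -lee_fin -sumEFin fin// ge0_integral_bigsetU//; last 3 first.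
- by rewrite index_enum_uniq.
- by move: tI; congr (trivIset _ _); apply/seteqP; split => // i _ /=; rewrite mem_index_enum.
- by apply/measurable_EFinP; apply: measurable_funTS; apply: measurableT_comp => //; move/integrableP : ig => [/measurable_EFinP].
apply: lee_sum => i _; have [ax [xy' yb]] := xy i.
rewrite -fin// lee_fin ug//.
have iF : mu.-integrable `]x i, y i[ (EFin \o g) by apply: igA; exact: measurable_itv.
rewrite -(Rintegral_itv_bndo_bndc iF).
by apply: le_normr_Rintegral => //; exact: measurable_itv.
Qed.

(** The formula for u is required on the right half-line only: for x < t the points r - x stay
    there when r is close to t. *)
Lemma shifted_derive1 (u F : R -> R) (c t x g : R) : x < t ->
  (forall y, 0 < y -> u y = c + F y) ->
  derivable F (t - x) 1 -> derive1 F (t - x) = g ->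
  derive1 (fun r => u (r - x)) t = g.
Proof.
move=> xt uF dF <-; rewrite /derive1; apply: cvg_lim; first exact: Rhausdorff.
have y0 : 0 < t - x by rewrite subr_gt0.
apply: cvg_trans (derivable_cvg_derive1 dF); apply: near_eq_cvg.
near=> h.
have hy : 0 < h + (t - x).
  rewrite -ltrBlDr sub0r; near: h; apply: cvg_within.
  by apply: lt_nbhsr; rewrite oppr_lt0.
rewrite /= -addrA (uF _ hy) (uF _ y0) opprD addrACA subrr add0r.
by [].
Unshelve. all: by end_near. Qed.

(** For almost every x the derivative under the integral is the density gp - gm at t - x, and
    the reflection x |-> t - x gives the convolution. The terms gp and gm are kept apart
    because nu is singular at 0, so that their convolutions with it may be infinite at some t. *)
Lemma caputo_cdf (nu u : R -> R) (gp gm : R -> R) (c t : R) :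
  measurable_fun setT gp -> measurable_fun setT gm ->
  (forall y, 0 <= gp y) -> (forall y, 0 <= gm y) ->
  (forall y, y <= 0 -> gp y = 0) -> (forall y, y <= 0 -> gm y = 0) ->
  mu.-integrable setT (EFin \o gp) -> mu.-integrable setT (EFin \o gm) ->
  measurable_fun setT (fun z : R => if 0 < z then nu z else 0) ->
  (forall z, 0 < z -> 0 <= nu z) ->
  (forall y, 0 < y -> u y = c + (\int[mu]_(z in `]-oo, y]) (gp z - gm z))%R) ->
  (\int[mu]_y ((if 0 < t - y then nu (t - y) else 0)%:E * (gp y)%:E) < +oo)%E ->
  (\int[mu]_y ((if 0 < t - y then nu (t - y) else 0)%:E * (gm y)%:E) < +oo)%E ->
  caputo nu u t =
    (\int[mu]_y ((if (0 < t - y)%R then nu (t - y) else 0)%:E * (gp y)%:E) -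
     \int[mu]_y ((if (0 < t - y)%R then nu (t - y) else 0)%:E * (gm y)%:E))%E.
Proof.
move=> mgp mgm gp0 gm0 gpN gmN igp igm mnu nu0 uE finp finm.
pose g y := gp y - gm y.
have ig : mu.-integrable setT (EFin \o g).
  by have := integrableB measurableT igp igm; apply: eq_integrable => // x _; rewrite /= EFinB.
pose N1 z := if 0 < z then nu z else 0.
have N10 z : 0 <= N1 z by rewrite /N1; case: ifP => // /nu0.
pose F x := (\int[mu]_(z in [set` `]-oo, x]]) g z)%R.
have [N [mN N0 HN]] : {ae mu, forall x, derivable F x 1 /\ derive1 F x = g x}.
  apply: FTC1Ny.
  - by move=> y; apply: integrableS ig => //; exact: measurable_itv.
  - exact: open_integrable_locally openT ig.
pose N' := (fun x => t - x) @^-1` N.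
have mN' : measurable N'.
  rewrite -[N']setTI; apply: (measurable_funB (measurable_cst t) (@measurable_id _ _ setT)) => //.
have N'0 : mu N' = 0%E.
  have E (A : set (measurableTypeR R)) : measurable A -> mu A = (\int[mu]_x (\1_A x)%:E)%E.
    by move=> mA; rewrite integral_indic// setIT.
  rewrite E// -N0 E//.
  rewrite -(@integral_reflect _ t (fun x => (\1_N x)%:E)).
  - by [].
  - by apply/measurable_EFinP; exact: measurable_indic.
  - by move=> x; rewrite lee_fin.
pose a (h : R -> R) x := ((h (t - x))%:E * (N1 x)%:E)%E.
have ma (h : R -> R) : measurable_fun setT h -> measurable_fun setT (a h).
  move=> mh; have mN1 : measurable_fun setT N1 by exact: mnu.
  by rewrite /a; meas.
have aE (h : R -> R) : measurable_fun setT h -> (forall y, 0 <= h y) -> (forall y, y <= 0 -> h y = 0) ->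
    (\int[mu]_(x in `]0%R, t[) a h x = \int[mu]_y ((N1 (t - y))%:E * (h y)%:E))%E.
  move=> mh h0 hN.
  rewrite -(@integral_reflect _ t (fun y => (N1 (t - y))%:E * (h y)%:E)%E); last 2 first.
  - have mN1 : measurable_fun setT N1 by exact: mnu.
    by meas.
  - by move=> y; rewrite mule_ge0 ?lee_fin.
  rewrite integral_mkcond; apply: eq_integral => x _; rewrite patchE /a.
  rewrite (_ : t - (t - x) = x)%R; last by ring.
  rewrite muleC; case: ifPn => //; rewrite notin_setE /= in_itv/= => /negP; rewrite negb_and -!leNgt => /orP[x0|tx].
  - by rewrite /N1 ltNge x0 mul0e.
  - by rewrite hN ?mule0// subr_le0.
have ia (h : R -> R) : measurable_fun setT h -> (forall y, 0 <= h y) -> (forall y, y <= 0 -> h y = 0) ->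
    (\int[mu]_y ((N1 (t - y))%:E * (h y)%:E) < +oo)%E -> mu.-integrable `]0, t[ (a h).
  move=> mh h0 hN fin; apply/integrableP; split; first by apply: measurable_funTS; exact: ma.
  under eq_integral do rewrite gee0_abs ?mule_ge0 ?lee_fin//.
  by rewrite aE.
rewrite /caputo (@integral_null _ _ _ mu _ (fun x => a gp x - a gm x)%E _ N' mN' N'0).
  rewrite integralB; [|exact: measurable_itv|exact: ia|exact: ia].
  by rewrite !aE.
move=> x; rewrite /= in_itv/= => /andP[x0 xt] Nx.
have [dF FE] : derivable F (t - x) 1 /\ derive1 F (t - x) = g (t - x).
  by apply: contrapT => H; apply: Nx; exact: HN.
rewrite (shifted_derive1 xt uE dF FE) /a /N1 x0 -!EFinM -EFinB; congr EFin.
by rewrite /g mulrBl.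
Qed.

End calculus.

Section mixture.
Local Open Scope ereal_scope.
Context (R : realType) (dens : R -> R -> \bar R).
Hypotheses (mdens : measurable_fun setT (fun z => dens z.1 z.2)) (dens0 : forall v y, 0 <= dens v y)
  (densN : forall v y, (y <= 0)%R -> dens v y = 0)
  (dens1 : forall v, (0 < v)%R -> \int[lebesgue_measure]_y dens v y = 1).
Local Notation mu := (@lebesgue_measure R).

(** The density of the mixture of the laws dens v with weights w v. The mixed density may be
    infinite on a null set, hence the passage to finite values. *)
Lemma mixture_density (w : R -> R) : measurable_fun setT w -> (forall v, 0 <= w v)%R ->
  mu.-integrable `]0%R, +oo[ (EFin \o w) ->
  exists g : R -> R, [/\ measurable_fun setT g, (forall y, 0 <= g y)%R,
    mu.-integrable setT (EFin \o g), (forall y, (y <= 0)%R -> g y = 0%R) &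
    forall psi : R -> \bar R, measurable_fun setT psi -> (forall y, 0 <= psi y) ->
      \int[mu]_y (psi y * (g y)%:E) =
      \int[mu]_(v in `]0%R, +oo[) ((w v)%:E * \int[mu]_y (psi y * dens v y))].
Proof.
move=> mw w0 iw.
have mI : measurable (`]0%R, +oo[%classic : set (measurableTypeR R)) by exact: measurable_itv.
pose G y := \int[mu]_(v in `]0%R, +oo[) ((w v)%:E * dens v y).
have w0' v : 0 <= (w v)%:E by rewrite lee_fin.
have mw' : measurable_fun setT (fun v : R => (w v)%:E) by exact/measurable_EFinP.
have mG : measurable_fun setT G.
  by apply: (measurable_integral1 mu mI (fun (y : R) v => (w v)%:E * dens v y)); [meas|move=> y v; rewrite mule_ge0].
have G0 y : 0 <= G y by apply: integral_ge0 => v _; rewrite mule_ge0.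
have key (psi : R -> \bar R) : measurable_fun setT psi -> (forall y, 0 <= psi y) ->
    \int[mu]_y (psi y * G y) =
    \int[mu]_(v in `]0%R, +oo[) ((w v)%:E * \int[mu]_y (psi y * dens v y)).
  move=> mpsi psi0.
  transitivity (\int[mu]_y \int[mu]_(v in `]0%R, +oo[) (psi y * ((w v)%:E * dens v y))).
    apply: eq_integral => y _; apply/esym; apply: integralZe; [exact: mI|exact: psi0|by meas|].
    by move=> v; rewrite mule_ge0.
  etransitivity; first by apply: tonelli; [by []|exact: mI|meas|move=> y v; rewrite !mule_ge0].
  apply: eq_integral => v _.
  transitivity (\int[mu]_y ((w v)%:E * (psi y * dens v y))).
    by apply: eq_integral => y _; rewrite muleCA.
  by apply: integralZe; [by []|exact: w0'|by meas|move=> y; rewrite mule_ge0].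
have intG : \int[mu]_y G y < +oo.
  have := key (cst 1) (measurable_cst _) (fun=> lee01).
  rewrite (_ : \int[mu]_y (cst 1 y * G y) = \int[mu]_y G y); last first.
    by apply: eq_integral => y _; rewrite mul1e.
  move=> ->; move/integrableP : iw => [_]; congr (_ < _).
  apply: eq_integral => v; rewrite inE/= in_itv/= andbT => v0.
  rewrite /= ger0_norm// -[LHS]mule1; congr (_ * _).
  rewrite -[LHS](dens1 v0); apply: eq_integral => y _; exact/esym/mul1e.
have iG : mu.-integrable setT G.
  by apply/integrableP; split => //; under eq_integral do rewrite gee0_abs//.
have fG := integrable_ae measurableT iG.
have aeF := ae_filter_ringOfSetsType mu.
have key2 (psi : R -> \bar R) : measurable_fun setT psi -> (forall y, 0 <= psi y) ->
    \int[mu]_y (psi y * (fine (G y))%:E) = \int[mu]_y (psi y * G y).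
  move=> mpsi psi0; apply: ge0_ae_eq_integral => //.
  - apply: emeasurable_funM => //; apply/measurable_EFinP; exact: measurableT_comp mG.
  - exact: emeasurable_funM.
  - by move=> y _; rewrite mule_ge0// lee_fin fine_ge0.
  - by move=> y _; rewrite mule_ge0.
  - by move: fG; apply: filterS => y /(_ I) /fineK ->.
exists (fun y => fine (G y)); split.
- exact: measurableT_comp mG.
- by move=> y; rewrite fine_ge0.
- apply/integrableP; split; first by apply/measurable_EFinP; exact: measurableT_comp mG.
  apply: le_lt_trans intG; have := key2 (cst 1) (measurable_cst _) (fun=> lee01).
  rewrite (_ : \int[mu]_y (cst 1 y * G y) = \int[mu]_y G y); last first.
    by apply: eq_integral => y _; rewrite mul1e.
  move=> <-; rewrite le_eqVlt; apply/orP; left; apply/eqP; apply: eq_integral => y _.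
  by rewrite /= ger0_norm ?fine_ge0// mul1e.
- by move=> y y0; rewrite /G integral0_eq// => v _; rewrite densN// mule0.
- by move=> psi mpsi psi0; rewrite key2// key.
Qed.

End mixture.

Section mixtures.
Local Open Scope ereal_scope.
Context (R : realType) (pass dens : R -> R -> \bar R).
Local Notation mu := (@lebesgue_measure R).
Hypotheses (mpass : measurable_fun setT (fun z => pass z.1 z.2)) (pass0 : forall t v, 0 <= pass t v).

(** By Tonelli: both sides are the integral of w v pass t u over v <= u, as the integral of
    pass t from v on is the distribution function of dens v at t. *)
Lemma mixture_cdf (w : R -> R) (g : R -> R) (t : R) : measurable_fun setT w -> (forall v, 0 <= w v)%R ->
  (forall v, (0 < v)%R -> \int[mu]_(u in `[v, +oo[) pass t u = \int[mu]_y (ind (y <= t)%R * dens v y)) ->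
  (forall psi : R -> \bar R, measurable_fun setT psi -> (forall y, 0 <= psi y) ->
      \int[mu]_y (psi y * (g y)%:E) =
      \int[mu]_(v in `]0%R, +oo[) ((w v)%:E * \int[mu]_y (psi y * dens v y))) ->
  \int[mu]_(y in `]-oo, t]) (g y)%:E =
  \int[mu]_(u in `]0%R, +oo[) (pass t u * \int[mu]_(v in `]0%R, u]) (w v)%:E).
Proof.
move=> mw w0 cdf gE.
have mI : measurable (`]0%R, +oo[%classic : set (measurableTypeR R)) by exact: measurable_itv.
have w0' v : 0 <= (w v)%:E by rewrite lee_fin.
have mw' : measurable_fun setT (fun v : R => (w v)%:E) by exact/measurable_EFinP.
have mpt : measurable_fun setT (pass t) by meas.
rewrite (@integral_ind_sub _ (fun y => (y <= t)%R) _ setT); last first.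
  by move=> x; rewrite /= in_itv/=; split => // -[].
rewrite gE; [|by meas|by move=> y; exact: ind_ge0].
transitivity (\int[mu]_(v in `]0%R, +oo[) \int[mu]_(u in `]0%R, +oo[) ((w v)%:E * (ind (v <= u)%R * pass t u))).
  apply: eq_integral => v; rewrite inE/= in_itv/= andbT => v0.
  rewrite -cdf// (@integral_ind_sub _ (fun u => (v <= u)%R) _ `]0%R, +oo[%classic); last first.
    move=> x; rewrite /= !in_itv/= !andbT; split => [vx|[_]//].
    by split => //; exact: lt_le_trans vx.
  by apply/esym; apply: integralZe => //; [meas|move=> u; rewrite mule_ge0 ?ind_ge0].
etransitivity; first by apply: tonelli; [exact: mI|exact: mI|meas|move=> v u; rewrite !mule_ge0 ?ind_ge0].
apply: eq_integral => u; rewrite inE/= in_itv/= andbT => u0.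
transitivity (\int[mu]_(v in `]0%R, +oo[) (pass t u * (ind (v <= u)%R * (w v)%:E))).
  by apply: eq_integral => v _; rewrite muleCA [RHS]muleCA [_ * pass t u]muleC.
rewrite integralZe; [|exact: mI|exact: pass0|by meas|by move=> v; rewrite mule_ge0 ?ind_ge0].
congr (_ * _); apply/esym; apply: integral_ind_sub => v; rewrite /= !in_itv/= andbT.
by split => [/andP[]//|[-> ->]].
Qed.

(** Integrated against e^(- t), the mixture is at most C times the total weight by Tonelli;
    hence it is finite at almost every t. *)
Lemma mixture_passage_ae (W : R -> \bar R) (C : R) : measurable_fun setT W -> (forall v, 0 <= W v) ->
  \int[mu]_(v in `]0%R, +oo[) W v < +oo -> (0 <= C)%R ->
  (forall v, (0 < v)%R -> \int[mu]_t ((expR (- t))%:E * pass t v) <= C%:E) ->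
  {ae mu, forall t, \int[mu]_(v in `]0%R, +oo[) (W v * pass t v) < +oo}.
Proof.
move=> mW W0 intW C0 lap.
have mI : measurable (`]0%R, +oo[%classic : set (measurableTypeR R)) by exact: measurable_itv.
pose I t := \int[mu]_(v in `]0%R, +oo[) (W v * pass t v).
have I0 t : 0 <= I t by apply: integral_ge0 => v _; rewrite mule_ge0.
have mIt : measurable_fun setT I.
  by apply: (measurable_integral1 mu mI (fun (t v : R) => W v * pass t v)); [meas|move=> t v; rewrite mule_ge0].
have e0 t : 0 <= (expR (- t))%:E :> \bar R by rewrite lee_fin expR_ge0.
have mE : measurable_fun setT (fun t : R => (expR (- t))%:E * I t) by meas.
pose L v := \int[mu]_t ((expR (- t))%:E * pass t v).
have mL : measurable_fun setT L.
  by apply: (measurable_integral1 mu measurableT (fun (v t : R) => (expR (- t))%:E * pass t v)); [meas|move=> t v; rewrite mule_ge0].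
have L0 v : 0 <= L v by apply: integral_ge0 => t _; rewrite mule_ge0.
have swap : \int[mu]_t ((expR (- t))%:E * I t) = \int[mu]_(v in `]0%R, +oo[) (W v * L v).
  transitivity (\int[mu]_t \int[mu]_(v in `]0%R, +oo[) ((expR (- t))%:E * (W v * pass t v))).
    by apply: eq_integral => t _; apply/esym; apply: integralZe; [exact: mI|exact: e0|by meas|move=> v; rewrite mule_ge0].
  etransitivity; first by apply: tonelli; [by []|exact: mI|meas|move=> t v; rewrite !mule_ge0].
  apply: eq_integral => v _; transitivity (\int[mu]_t (W v * ((expR (- t))%:E * pass t v))).
    by apply: eq_integral => t _; rewrite muleCA.
  by apply: integralZe; [by []|exact: W0|by meas|move=> t; rewrite mule_ge0].
have finI : \int[mu]_t ((expR (- t))%:E * I t) < +oo.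
  rewrite swap; apply: (@le_lt_trans _ _ (\int[mu]_(v in `]0%R, +oo[) (C%:E * W v))).
    apply: ge0_le_integral; [exact: mI|by move=> v _; rewrite mule_ge0| | |].
    - by apply: measurable_funTS; meas.
    - by apply: measurable_funTS; meas.
    - move=> v; rewrite /= in_itv/= andbT => v0; rewrite muleC; apply: lee_wpmul2r => //.
      exact: lap.
  by rewrite integralZ//; apply: lte_mul_pinfty => //; rewrite lee_fin.
have iE : mu.-integrable setT (fun t => (expR (- t))%:E * I t).
  apply/integrableP; split => //.
  by under eq_integral do rewrite gee0_abs ?mule_ge0//.
have aeF := ae_filter_ringOfSetsType mu.
have := integrable_ae measurableT iE; apply: filterS => t /(_ Logic.I).
rewrite ge0_fin_numE ?mule_ge0// => fin.
rewrite ltNge leye_eq; apply/negP => /eqP It; move: fin.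
have -> : I t = +oo by exact: It.
by rewrite gt0_muley// lte_fin expR_gt0.
Qed.

End mixtures.

Section subordinated_process.
Context (R : realType) (d : measure_display)
    (T : measurableType d) (P : probability T R)
    (nubar : {measure set (measurableTypeR R) -> \bar R}) (f : R -> R)
    (D : R -> {RV P >-> R}) (h : R -> R -> R)
    (k : nat) (lam : nat -> R -> R) (M : R -> {RV P >-> nat}).
Hypotheses (Hnubar : levy_measure nubar)
    (Hf : bernstein_of nubar f)
    (HD : subordinator f D)
    (Hh : forall t, 0 < t -> is_density P (inverse_subordinator D t) (h t))
    (Hlam : forall j, (1 <= j <= k)%N -> intensity (lam j))
    (HM : ngcp k lam M)
    (Hindep : independent_processes P M (inverse_subordinator D)).
Local Notation mu := (@lebesgue_measure R).
Local Notation Y := (inverse_subordinator D).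
Local Notation q := (fun n u => prob_eq P (M u) n).
Local Notation qf := (fun n t => prob_eq P (fun w => M (Y t w) w) n).
Local Notation r := (forward_rhs k lam q).

(** The positive and negative parts of the forward right-hand side; the argument is clamped
    so that they are measurable on the whole line. *)
Let wp n v := Num.max (r n (Num.max v 0)) 0.
Let wm n v := Num.max (- r n (Num.max v 0)) 0.

Let mwp n : measurable_fun setT (wp n).
Proof. by apply: measurable_maxr => //; exact: measurable_forward. Qed.

Let mwm n : measurable_fun setT (wm n).
Proof. by apply: measurable_maxr => //; apply: measurable_funN; exact: measurable_forward. Qed.

Let wp0 n v : 0 <= wp n v. Proof. by rewrite le_max lexx orbT. Qed.
Let wm0 n v : 0 <= wm n v. Proof. by rewrite le_max lexx orbT. Qed.

Let forwardE n v : 0 <= v -> r n v = wp n v - wm n v.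
Proof.
move=> v0; rewrite /wp /wm (max_l v0); case: (leP (r n v) 0) => H.
  by rewrite max_l ?oppr_ge0// sub0r opprK.
by rewrite max_r ?oppr_le0 ?ltW// subr0.
Qed.

Let forward_normE n v : 0 <= v -> `|r n v| = wp n v + wm n v.
Proof.
move=> v0; rewrite /wp /wm (max_l v0); case: (leP (r n v) 0) => H.
  by rewrite max_l ?oppr_ge0// add0r ler0_norm.
by rewrite max_r ?oppr_le0 ?ltW// addr0 gtr0_norm.
Qed.

Let mI : measurable (`]0, +oo[%classic : set (measurableTypeR R)).
Proof. exact: measurable_itv. Qed.

Let part_integrable n (w : R -> R) : measurable_fun setT w -> (forall v, 0 <= w v) ->
  (forall v, 0 <= v -> w v <= `|r n v|) -> mu.-integrable `]0, +oo[ (EFin \o w).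
Proof.
move=> mw w0 wr; apply: (le_integrable mI _ _ (forward_integrable Hlam HM n)).
  by apply/measurable_EFinP; exact: measurable_funTS.
move=> x; rewrite /= in_itv/= andbT => x0.
by rewrite lee_fin ger0_norm// wr// ltW.
Qed.

Let iwp n : mu.-integrable `]0, +oo[ (EFin \o wp n).
Proof. by apply: (@part_integrable n) => // v v0; rewrite (forward_normE n v0) lerDl. Qed.

Let iwm n : mu.-integrable `]0, +oo[ (EFin \o wm n).
Proof. by apply: (@part_integrable n) => // v v0; rewrite (forward_normE n v0) lerDr. Qed.

Let measurable_state n t : 0 <= t -> measurable [set w | M (Y t w) w = n].
Proof.
move=> t0; apply: (measurable_time_changed (Y := Y) HM) => //; first exact: (measurable_inverse HD).
by move=> w; exact: inverse_ge0.
Qed.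

Let qfE n t : 0 <= t -> (qf n t)%:E = P [set w | M (Y t w) w = n].
Proof. by move=> t0; rewrite fineK// fin_num_measure//; exact: measurable_state. Qed.

Let qf_density n t : 0 < t ->
  (qf n t)%:E = (\int[mu]_(u in `]0%R, +oo[) ((q n (Num.max u 0))%:E * (h t u)%:E))%E.
Proof.
move=> t0; rewrite (qfE n (ltW t0)).
have mY := measurable_inverse HD t.
have Y0 w : 0 <= Y t w by exact: inverse_ge0.
rewrite (time_changed_prob HM Hindep mY Y0 (ltW t0) n).
rewrite -(expectation_density mY (Hh t0) (psi := fun u => (q n (Num.max u 0))%:E)).
- by apply: eq_integral => w _; rewrite (max_l (Y0 w)).
- by apply/measurable_EFinP; exact: (measurable_state_prob HM).
- by move=> u; rewrite lee_fin; exact: state_prob_ge0.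
Qed.

(** A path that is positive at all the times 1 / (m + 1) exceeds the level 0 immediately, so
    that its inverse starts from 0. *)
Lemma time_changed_start n : (forall v, 0 < v -> P [set w | D v w <= 0] = 0%E) ->
  qf n 0 = (n == 0%N)%:R.
Proof.
move=> D0; pose N := \bigcup_m [set w | D (m.+1%:R^-1) w <= 0].
have mDm m : measurable [set w | D (m.+1%:R^-1) w <= 0].
  rewrite (_ : [set w | _] = ~` [set w | 0 < D (m.+1%:R^-1) w]); last first.
    by apply/seteqP; split => w /=; rewrite leNgt => /negP.
  by apply: measurableC; exact: (measurable_above D 0 _).
have mN : measurable N by apply: bigcupT_measurable.
have N0 : P N = 0%E.
  apply/eqP; rewrite eq_le measure_ge0 andbT.
  apply: (le_trans (measure_sigma_subadditive P mDm mN (@subset_refl _ N))).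
  by rewrite eseries0// => m _ _; apply: D0; rewrite invr_gt0.
have YN w : ~ N w -> M (Y 0 w) w = 0%N.
  move=> Nw; suff -> : Y 0 w = 0 by exact: (ngcp_start HM).
  apply/eqP; rewrite eq_le inverse_ge0 andbT; apply/ler_addgt0Pr => e e0; rewrite add0r.
  apply: (@le_trans _ _ (Num.trunc e^-1).+1%:R^-1).
    apply: inverse_le => //; rewrite ltNge; apply/negP => H; apply: Nw.
    by exists (Num.trunc e^-1).
  by rewrite -[leRHS]invrK lef_pV2 ?posrE ?invr_gt0// ltW// truncnS_gt.
apply/EFin_inj; rewrite (qfE n (lexx 0)); have mS := measurable_state n (lexx 0).
have [n0|n0] := eqVneq n 0%N.
  have SN : [set w | M (Y 0 w) w = n] `|` N = setT.
    apply/seteqP; split => // w _; have [Nw|Nw] := pselect (N w); first by right.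
    by left; rewrite /= n0 YN.
  by rewrite -(measureU0 mS mN N0) SN; exact: probability_setT.
apply: (subset_measure0 mS mN) => // w /= Mn; apply: contrapT => /YN.
by rewrite Mn => /eqP; rewrite (negbTE n0).
Qed.

(** The forward equation, integrated in time and averaged over the first passage,
    with all terms moved to the side on which they are nonnegative. *)
Let forward_balance n t (p : R -> \bar R) : 0 < t -> measurable_fun setT p -> (forall u, 0 <= p u)%E ->
  (forall psi : R -> \bar R, measurable_fun setT psi -> (forall u, 0 <= psi u)%E ->
    (\int[mu]_(u in `]0%R, +oo[) (psi u * (h t u)%:E) = \int[mu]_(u in `]0%R, +oo[) (psi u * p u))%E) ->
  ((qf n t)%:E + \int[mu]_(u in `]0%R, +oo[) (p u * \int[mu]_(v in `]0%R, u]) (wm n v)%:E) =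
   (n == 0%N)%:R%:E + \int[mu]_(u in `]0%R, +oo[) (p u * \int[mu]_(v in `]0%R, u]) (wp n v)%:E))%E.
Proof.
move=> t0 mp p0 ph.
have total : (\int[mu]_(u in `]0%R, +oo[) p u = 1)%E.
  have [_ _ hE] := Hh t0.
  transitivity (\int[mu]_(u in `]0%R, +oo[) (cst 1 u * p u))%E.
    by apply: eq_integral => u _; rewrite mul1e.
  rewrite -(ph (cst 1%E))//.
  transitivity (\int[mu]_(u in `]0%R, +oo[) (h t u)%:E)%E.
    by apply: eq_integral => u _; rewrite mul1e.
  by have := hE setT measurableT; rewrite setTI preimage_setT probability_setT.
have iw b (w : R -> R) : mu.-integrable `]0, +oo[ (EFin \o w) -> mu.-integrable `]0, b] (EFin \o w).
  move=> iw'; apply: (integrableS mI _ _ iw'); first exact: measurable_itv.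
  by move=> x; rewrite /= !in_itv/= andbT => /andP[].
(* q integrates the forward equation; in nonnegative terms, no subtraction of infinities *)
have qI u : 0 < u -> ((q n u)%:E + \int[mu]_(v in `]0%R, u]) (wm n v)%:E =
    (n == 0%N)%:R%:E + \int[mu]_(v in `]0%R, u]) (wp n v)%:E)%E.
  move=> u0; rewrite (state_prob_integral Hlam HM n (ltW u0)) -addeA; congr (_ + _)%E.
  rewrite (_ : (\int[mu]_(x in `]0%R, u]) (r n x)%:E = \int[mu]_(x in `]0%R, u]) ((wp n x)%:E - (wm n x)%:E))%E); last first.
    apply: eq_integral => x; rewrite inE/= in_itv/= => /andP[x0 _].
    by rewrite (forwardE n (ltW x0)) EFinB.
  rewrite integralB; [|exact: measurable_itv|exact: iw|exact: iw].
  by rewrite subeK//; apply: integrable_fin_num; [exact: measurable_itv|exact: iw].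
have mI0 (w : R -> R) : measurable_fun setT w -> (forall v, 0 <= w v) ->
    measurable_fun setT (fun u : R => \int[mu]_(v in `]0%R, u]) (w v)%:E)%E.
  move=> mw w0; have mw' : measurable_fun setT (fun v : R => (w v)%:E) by exact/measurable_EFinP.
  rewrite (_ : (fun u => _) = (fun u : R => \int[mu]_(v in `]0%R, +oo[) (ind (v <= u)%R * (w v)%:E))%E).
    apply: (measurable_integral1 mu mI (fun (u v : R) => ind (v <= u)%R * (w v)%:E)%E); first by meas.
    by move=> u v; rewrite mule_ge0 ?ind_ge0// lee_fin.
  apply/funext => u; apply: integral_ind_sub => v; rewrite /= !in_itv/= andbT.
  by split => [/andP[]//|[-> ->]].
have mIm := mI0 _ (mwm n) (wm0 n); have mIp := mI0 _ (mwp n) (wp0 n).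
have Im0 u : (0 <= \int[mu]_(v in `]0%R, u]) (wm n v)%:E)%E.
  by apply: integral_ge0 => v _; rewrite lee_fin.
have Ip0 u : (0 <= \int[mu]_(v in `]0%R, u]) (wp n v)%:E)%E.
  by apply: integral_ge0 => v _; rewrite lee_fin.
have mq : measurable_fun setT (fun u : R => (q n (Num.max u 0))%:E).
  by apply/measurable_EFinP; exact: (measurable_state_prob HM).
have q0' u : (0 <= (q n (Num.max u 0))%:E :> \bar R)%E by rewrite lee_fin; exact: state_prob_ge0.
rewrite (qf_density n t0) (ph (fun u => (q n (Num.max u 0))%:E) mq q0').
have d0 : (0 <= (n == 0%N)%:R%:E :> \bar R)%E by rewrite lee_fin.
rewrite -integral_addition; last 5 first.
- exact: mI.
- exact: emeasurable_funM.
- by move=> u; rewrite mule_ge0.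
- exact: emeasurable_funM.
- by move=> u; rewrite mule_ge0.
transitivity (\int[mu]_(u in `]0%R, +oo[) ((n == 0%N)%:R%:E * p u +
    p u * \int[mu]_(v in `]0%R, u]) (wp n v)%:E))%E.
  apply: eq_integral => u; rewrite inE/= in_itv/= andbT => u0.
  rewrite (max_l (ltW u0)) muleC -ge0_muleDr//; last by rewrite lee_fin; exact: state_prob_ge0.
  by rewrite qI// ge0_muleDr// [(_ * p u)%E]muleC.
rewrite integral_addition; last 5 first.
- exact: mI.
- by meas.
- by move=> u; rewrite mule_ge0.
- exact: emeasurable_funM.
- by move=> u; rewrite mule_ge0.
congr (_ + _)%E; rewrite integralZe; [|exact: mI|exact: d0|exact: mp|exact: p0].
by rewrite total mule1.
Qed.

(** The averaged forward equation says that qf n is the integral of gp - gm, the mixtures of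
    the densities of D v with weights wp and wm. This gives the absolute continuity, and by
    caputo_cdf the Caputo derivative is the convolution of gp - gm with the tail. As the
    convolution of dens v with the tail is pass t v, it equals the integral of the weights
    against pass t, that is against h t. *)
Lemma caputo_time_changed n :
  let rhs t u := (r n u * h t u)%:E in
  [/\ qf n 0 = (n == 0%N)%:R,
      forall t, 0 <= t -> abs_continuous_on 0 t (qf n),
      {ae mu, forall t : R, 0 < t -> mu.-integrable `]0, +oo[ (rhs t)} &
      forall t, 0 < t -> mu.-integrable `]0, +oo[ (rhs t) ->
        caputo (tail nubar) (qf n) t = (\int[mu]_(u in `]0%R, +oo[) rhs t u)%E].
Proof.
move=> rhs.
have [pass [dens [[mpass pass0] [mdens dens0 densN dens1] pass_h cdf [mnu passE pass_lap D0]]]] :=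
  first_passage_law Hnubar Hf HD Hh.
have [gp [mgp gp0 igp gpN gpE]] := mixture_density mdens dens0 densN dens1 (mwp n) (wp0 n) (iwp n).
have [gm [mgm gm0 igm gmN gmE]] := mixture_density mdens dens0 densN dens1 (mwm n) (wm0 n) (iwm n).
have q0 := time_changed_start n D0.
have mpt t : measurable_fun setT (pass t) by meas.
pose g y := gp y - gm y.
have ig : mu.-integrable setT (EFin \o g).
  by have := integrableB measurableT igp igm; apply: eq_integrable => // x _; rewrite /= EFinB.
have igI (A : set (measurableTypeR R)) (u : R -> R) : measurable A -> mu.-integrable setT (EFin \o u) -> mu.-integrable A (EFin \o u).
  by move=> mA; apply: integrableS.
have qfI t : 0 < t -> ((qf n t)%:E + \int[mu]_(y in `]-oo, t]) (gm y)%:E =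
    (n == 0%N)%:R%:E + \int[mu]_(y in `]-oo, t]) (gp y)%:E)%E.
  move=> t0; have cdft v : 0 < v -> (\int[mu]_(u in `[v, +oo[) pass t u = \int[mu]_y (ind (y <= t)%R * dens v y))%E.
    by move=> v0; exact: cdf.
  rewrite (mixture_cdf mpass pass0 (mwm n) (wm0 n) cdft gmE).
  rewrite (mixture_cdf mpass pass0 (mwp n) (wp0 n) cdft gpE).
  apply: forward_balance => // psi mpsi psi0; exact: pass_h.
have mray t : measurable (`]-oo, t]%classic : set (measurableTypeR R)) by exact: measurable_itv.
have fin_ray t (w : R -> R) : mu.-integrable setT (EFin \o w) ->
    ((\int[mu]_(y in `]-oo, t]) w y)%R%:E = \int[mu]_(y in `]-oo, t]) (w y)%:E)%E.
  move=> iw'; rewrite /Rintegral fineK//; apply: integrable_fin_num; first exact: mray.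
  exact: igI.
have qfE' t : 0 <= t -> qf n t = (n == 0%N)%:R + (\int[mu]_(z in `]-oo, t]) (gp z - gm z))%R.
  rewrite le_eqVlt => /orP[/eqP <-|t0].
    rewrite q0 /Rintegral integral0_eq ?addr0// => y; rewrite /= in_itv/= => y0.
    by rewrite gpN// gmN// subrr.
  rewrite RintegralB; [|exact: mray|exact: igI|exact: igI].
  have := qfI t t0; rewrite -(fin_ray t gm igm) -(fin_ray t gp igp) -!EFinD => -[E].
  by rewrite addrA -E addrK.
split => //.
- move=> t t0; apply: (@abs_continuous_integral _ g (qf n) 0 t ig) => x y x0 xy.
  rewrite (qfE' y (le_trans x0 xy)) (qfE' x x0) opprD addrACA subrr add0r.
  by rewrite Rintegral_itvB; [by []|exact: igI|by []|by rewrite bnd_simp].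
- pose W v := (`|r n (Num.max v 0)|)%:E : \bar R.
  have W0 v : (0 <= W v)%E by rewrite lee_fin.
  have mW : measurable_fun setT W.
    by apply/measurable_EFinP; apply: measurableT_comp => //; exact: (measurable_forward Hlam HM).
  have intW : (\int[mu]_(v in `]0%R, +oo[) W v < +oo)%E.
    have /integrableP[_] := forward_integrable Hlam HM n; apply: le_lt_trans.
    rewrite le_eqVlt; apply/orP; left; apply/eqP; apply: eq_integral => v.
    by rewrite inE/= in_itv/= andbT => v0; rewrite /W (max_l (ltW v0)).
  have f10 : 0 <= f 1 by have := pass_lap 1 ltr01; rewrite -lee_fin; apply: le_trans; apply: integral_ge0 => t _; rewrite mule_ge0// lee_fin expR_ge0.
  have aeF := ae_filter_ringOfSetsType mu.
  have := mixture_passage_ae mpass pass0 mW W0 intW f10 pass_lap.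
  apply: filterS => t fin t0; have [mh h0 hE] := Hh t0.
  apply/integrableP; split.
    apply/measurable_EFinP; apply: measurable_funM => //.
    by have /integrableP[/measurable_EFinP] := forward_integrable Hlam HM n.
  rewrite (_ : (\int[mu]_(x in `]0%R, +oo[) `|rhs t x|)%E = (\int[mu]_(u in `]0%R, +oo[) (W u * (h t u)%:E))%E).
    by rewrite (pass_h t W t0).
  apply: eq_integral => u; rewrite inE/= in_itv/= andbT => u0.
  by rewrite /rhs /W (max_l (ltW u0)) normrM (ger0_norm (h0 u u0)).
- move=> t t0 irhs; have [mh h0 hE] := Hh t0.
  pose Tt (z : R) : R := if 0 < z then tail nubar z else 0.
  have mT : measurable_fun setT Tt by exact: mnu.
  have Tt0 z : 0 <= Tt z by rewrite /Tt; case: ifP => // _; rewrite fine_ge0.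
  have part (w g0 : R -> R) : measurable_fun setT w -> (forall v, 0 <= w v) ->
      (forall psi : R -> \bar R, measurable_fun setT psi -> (forall y, 0 <= psi y)%E ->
        (\int[mu]_y (psi y * (g0 y)%:E) =
         \int[mu]_(v in `]0%R, +oo[) ((w v)%:E * \int[mu]_y (psi y * dens v y)))%E) ->
      (\int[mu]_y ((Tt (t - y))%:E * (g0 y)%:E) = \int[mu]_(u in `]0%R, +oo[) ((w u)%:E * (h t u)%:E))%E.
    move=> mw w0 gE; rewrite gE; [|by meas|by move=> y; rewrite lee_fin].
    rewrite (pass_h t (fun u => (w u)%:E) t0); [|exact/measurable_EFinP|by move=> u; rewrite lee_fin].
    by apply: eq_integral => v; rewrite inE/= in_itv/= andbT => v0; rewrite passE.
  have ipart (w : R -> R) : measurable_fun setT w -> (forall v, 0 <= w v) ->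
      (forall v, 0 <= v -> w v <= `|r n v|) -> mu.-integrable `]0, +oo[ (fun u => (w u)%:E * (h t u)%:E)%E.
    move=> mw w0 wr; apply: (le_integrable mI _ _ irhs).
      apply: emeasurable_funM; apply/measurable_EFinP => //; exact: measurable_funTS.
    move=> u; rewrite /= in_itv/= andbT => u0; rewrite lee_fin !normrM.
    by rewrite ler_wpM2r// (ger0_norm (w0 u)) wr// ltW.
  have wpr v : 0 <= v -> wp n v <= `|r n v| by move=> v0; rewrite (forward_normE n v0) lerDl.
  have wmr v : 0 <= v -> wm n v <= `|r n v| by move=> v0; rewrite (forward_normE n v0) lerDr.
  have ip := ipart _ (mwp n) (wp0 n) wpr.
  have im := ipart _ (mwm n) (wm0 n) wmr.
  have Ep := part _ _ (mwp n) (wp0 n) gpE; have Em := part _ _ (mwm n) (wm0 n) gmE.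
  have fin (w : R -> R) : (forall v, 0 <= w v) ->
      mu.-integrable `]0, +oo[ (fun u => (w u)%:E * (h t u)%:E)%E ->
      (\int[mu]_(u in `]0%R, +oo[) ((w u)%:E * (h t u)%:E) < +oo)%E.
    move=> w0 /integrableP[_]; apply: le_lt_trans; rewrite le_eqVlt; apply/orP; left; apply/eqP.
    apply: eq_integral => u; rewrite inE/= in_itv/= andbT => u0.
    by rewrite ger0_norm ?EFinM// mulr_ge0 ?h0.
  rewrite (caputo_cdf mgp mgm gp0 gm0 gpN gmN igp igm mT (fun z _ => fine_ge0 _) (fun y y0 => qfE' y (ltW y0))).
  - rewrite Ep Em -integralB//; apply: eq_integral => u; rewrite inE/= in_itv/= andbT => u0.
    by rewrite /rhs (forwardE n (ltW u0)) mulrBl EFinB !EFinM.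
  - by [].
  - by move: (fin _ (wp0 n) ip); rewrite -Ep.
  - by move: (fin _ (wm0 n) im); rewrite -Em.
Qed.

End subordinated_process.

Theorem corollary3p2 (R : realType) (d : measure_display)
    (T : measurableType d) (P : probability T R)
    (nubar : {measure set (measurableTypeR R) -> \bar R}) (f : R -> R)
    (D : R -> {RV P >-> R}) (h : R -> R -> R)
    (k : nat) (lam : nat -> R -> R) (M : R -> {RV P >-> nat})
    (Hnubar : levy_measure nubar)
    (Hf : bernstein_of nubar f)
    (HD : subordinator f D)
    (Hh : forall t, 0 < t -> is_density P (inverse_subordinator D t) (h t))
    (Hlam : forall j, (1 <= j <= k)%N -> intensity (lam j))
    (HM : ngcp k lam M)
    (Hindep : independent_processes P M (inverse_subordinator D)) :
  let q n u := prob_eq P (M u) n in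
  let qf n t := prob_eq P (fun w => M (inverse_subordinator D t w) w) n in
  let rhs n t u := (forward_rhs k lam q n u * h t u)%:E in
  forall n : nat,
  [/\ qf n 0 = (n == 0%N)%:R,
      forall t, 0 <= t -> abs_continuous_on 0 t (qf n),
      {ae lebesgue_measure, forall t : R, 0 < t ->
        lebesgue_measure.-integrable `]0, +oo[ (rhs n t)} &
      forall t, 0 < t ->
        lebesgue_measure.-integrable `]0, +oo[ (rhs n t) ->
        caputo (tail nubar) (qf n) t =
        (\int[lebesgue_measure]_(u in `]0%R, +oo[) rhs n t u)%E].
Proof. move=> q qf rhs n; exact: (caputo_time_changed Hnubar Hf HD Hh Hlam HM Hindep n). Qed.
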